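(* Let $\mathfrak g$ be a simple Lie algebra endowed with the invariant scalar product $\langle\cdot,\cdot\rangle=\lambda\cdot(\text{Killing form})$, $\lambda\neq 0$, and let $w_{\mathfrak g}$ be the associated Lie algebra weight system and $\bar w_{\mathfrak g}=w_{\mathfrak g}\circ\pi$. Then for all integers $i\ge 1$, $j\ge 0$, $$\bar w_{\mathfrak g}(J_{i,j})=\bar w_{\mathfrak g}(J_{i-1,j+1})+\frac{1}{\lambda}\,\bar w_{\mathfrak g}(J_{i-1,j}).$$
   Context: A closed Jacobi diagram is a connected graph consisting of a distinguished oriented circle (the Wilson loop) together with vertices on the loop (each incident to exactly one edge off the loop, called a leg) and internal trivalent vertices off the loop, each with a fixed cyclic order of its three half-edges; its degree is half its number of vertices. Chord diagrams are those closed diagrams with no internal vertices. The internal graph is obtained by deleting the Wilson loop; its connected components are the components of the diagram. Let $\mathcal C$ be the vector space spanned by closed diagrams modulo the STU relations $S=T-U$, where $S$ has an internal vertex joined to the loop by a leg and to two further half-edges $x,y$ (in the vertex's cyclic order), and $T$, $U$ are obtained by deleting that vertex and attaching $x,y$ directly to two adjacent points of the loop, in the order $x,y$ along the loop orientation for $T$ and $y,x$ for $U$. $\mathcal C$ is isomorphic to the space $\mathcal A^{fr}$ of chord diagrams modulo 4-term relations, and is a commutative cocommutative connected graded Hopf algebra: the product glues two Wilson loops by cutting them, and the coproduct is $\delta(D)=\sum_{J\subseteq [D]}D_J\otimes D_{\bar J}$ over subsets $J$ of the set $[D]$ of components. The projection $\pi$ onto primitive elements along the subspace of decomposable elements (products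 of elements of positive degree) is $$\pi(D)=D-\sum_{i\ge 2}(-1)^i(i-1)!\sum_{[D_1]\sqcup\dots\sqcup[D_i]=[D],\ [D_j]\ne\emptyset}D_1\cdots D_i,$$ the inner sum over unordered splittings of the set of components into nonempty parts, $D_j$ the subdiagram formed by the components in $[D_j]$. For a Lie algebra $\mathfrak g$ with a nondegenerate invariant form, basis $e_1,\dots,e_m$ and dual basis $e_1^*,\dots,e_m^*$, the weight system $w_{\mathfrak g}$ sends a chord diagram $D$ with $n$ chords to the element of $ZU(\mathfrak g)$ obtained by choosing a base point on the loop, labelling the first endpoint of each chord $a$ by $e_{i_a}$ and the second by $e_{i_a}^*$, multiplying the labels in the order along the loop and summing over all $i_a\in\{1,\dots,m\}$; it satisfies the 4-term relations and extends linearly to $\mathcal C$ via the STU relations. Write $\bar w_{\mathfrak g}=w_{\mathfrak g}\circ\pi$. The diagram $J_{i,j}$ ($i,j\ge0$), of degree $i+j+2$, is drawn in the plane inside its Wilson loop (loop oriented counterclockwise, internal vertices oriented counterclockwise by the planar drawing). Counterclockwise along the loop take points $p_1$, then $a_1,\dots,a_j$, then $p_2$, $p_3$, then $b_j,\dots,b_1$, then $p_4$ (so $p_1,p_2$ lie on the upper arc, $p_3,p_4$ on the lower arc, $p_2,p_3$ on the left and $p_4,p_1$ on the right), with chords $a_kb_k$, $k=1,\dots,j$ (mutually parallel, each separating $\{p_2,p_3\}$ from $\{p_1,p_4\}$). If $i=0$, the remaining part consists of the two chords $p_1p_2$ and $p_3p_4$, so $J_{0,j}$ is a chord diagram whose intersection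 graph is the complete bipartite graph $K_{2,j}$. If $i\ge1$, the remaining part is a planar ladder: internal vertices $u_1,\dots,u_i$ (upper rail) and $v_1,\dots,v_i$ (lower rail), edges $u_ku_{k+1}$, $v_kv_{k+1}$ ($1\le k<i$), rungs $u_kv_k$ ($1\le k\le i$), and legs $u_1p_2$, $v_1p_3$, $u_ip_1$, $v_ip_4$ (thus $i-1$ square cells, and the $j$ chords cross both rails). In particular $J_{i,0}$ is the ladder with $i$ rungs and four legs. *)

(* Defs.v *)
From HB Require Import structures.
From mathcomp Require Import all_boot all_order all_algebra.
Set Implicit Arguments. Unset Strict Implicit. Unset Printing Implicit Defensive.
Import GRing.Theory Num.Theory.
Local Open Scope ring_scope.

(* Closed Jacobi diagrams (combinatorial data).                         *)
(* An "end" is either a loop point  (p, None)  or the slot s of the     *)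
(* internal trivalent vertex v,  (v, Some s); the slots 0,1,2 of a      *)
(* vertex are listed in the vertex's cyclic order.                      *)
(* A diagram lists its loop points in the order of the oriented loop,   *)
(* starting at a base point, its internal vertices, and its edges       *)
(* (a perfect matching of the ends).                                    *)
Unset Implicit Arguments.
Definition dend := (nat * option 'I_3)%type.

Record diag := Diag { dpts : seq nat; dverts : seq nat; dedges : seq (dend * dend) }.

Definition dedge0 : dend * dend := ((0%N, None), (0%N, None)).

Definition vend (x y : dend) : bool := [&& x.2 != None, y.2 != None & x.1 == y.1].
Definition eadj (e f : dend * dend) : bool :=
  [|| vend e.1 f.1, vend e.1 f.2, vend e.2 f.1 | vend e.2 f.2].

Definition dadj (D : diag) : rel 'I_(size (dedges D)) :=
  fun q r => eadj (nth dedge0 (dedges D) q) (nth dedge0 (dedges D) r).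

Definition dcomp (D : diag) (q : 'I_(size (dedges D))) : {set 'I_(size (dedges D))} :=
  [set r | connect (dadj D) q r].
Definition dcomps (D : diag) : {set {set 'I_(size (dedges D))}} :=
  [set dcomp D q | q : 'I_(size (dedges D))].

(* the subdiagram D_S formed by the edges in S (a union of components) *)
Definition subdiag (D : diag) (S : {set 'I_(size (dedges D))}) : diag :=
  let es := [seq nth dedge0 (dedges D) q | q : 'I_(size (dedges D)) <- enum S] in
  Diag [seq p <- dpts D | has (fun e => (e.1 == (p, None)) || (e.2 == (p, None))) es]
       [seq v <- dverts D | has (fun e => vend (v, Some ord0) e.1 || vend (v, Some ord0) e.2) es]
       es.

(* product: cut both loops at their base points and glue *)
Definition dmul (D1 D2 : diag) : diag :=
  Diag (dpts D1 ++ dpts D2) (dverts D1 ++ dverts D2) (dedges D1 ++ dedges D2).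
Definition dunit : diag := Diag [::] [::] [::].

(* The diagrams J_{i,j}.  Loop points (counterclockwise, base point p1):*)
(* p1 = 0, a_k = k (1<=k<=j), p2 = j+1, p3 = j+2, b_k = 2j+3-k, p4=2j+3. *)
(* Ladder: u_k = k-1, v_k = i+k-1.  Counterclockwise cyclic orders from *)
(* the planar drawing: u_k : (right, left, rung), v_k : (right, rung,   *)
(* left).                                                               *)
Definition s0 : 'I_3 := @Ordinal 3 0 isT.
Definition s1 : 'I_3 := @Ordinal 3 1 isT.
Definition s2 : 'I_3 := @Ordinal 3 2 isT.

Definition Jdiag (i j : nat) : diag :=
  let P1 := 0%N in let P2 := j.+1 in let P3 := j.+2 in let P4 := (2 * j + 3)%N in
  let chords := [seq ((k, None), ((2 * j + 3 - k)%N, None)) | k <- iota 1 j] in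
  if i is 0 then
    Diag (iota 0 (2 * j + 4)) [::]
         ([:: ((P1, None), (P2, None)); ((P3, None), (P4, None))] ++ chords)
  else
    Diag (iota 0 (2 * j + 4)) (iota 0 (2 * i))
      ([:: ((0%N, Some s1), (P2, None)); ((i - 1)%N, Some s0, (P1, None));
           ((i, Some s2), (P3, None)); (((2 * i - 1)%N, Some s0), (P4, None))]
       ++ [seq (((k - 1)%N, Some s0), (k, Some s1)) | k <- iota 1 (i - 1)]
       ++ [seq (((i + k - 1)%N, Some s0), ((i + k)%N, Some s2)) | k <- iota 1 (i - 1)]
       ++ [seq (((k - 1)%N, Some s2), ((i + k - 1)%N, Some s1)) | k <- iota 1 i]
       ++ chords).

Set Implicit Arguments.
Section Lie.
Variables (K : fieldType) (n : nat).

Definition lie_axioms (br : 'rV[K]_n -> 'rV[K]_n -> 'rV[K]_n) : Prop :=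
  [/\ (forall (a : K) x y z, br (a *: x + y) z = a *: br x z + br y z),
      (forall (a : K) x y z, br x (a *: y + z) = a *: br x y + br x z),
      (forall x, br x x = 0) &
      (forall x y z, br x (br y z) + br y (br z x) + br z (br x y) = 0)].

(* matrix of ad x acting on row vectors: v *m ad_mx x = br x v *)
Definition ad_mx (br : 'rV[K]_n -> 'rV[K]_n -> 'rV[K]_n) (x : 'rV[K]_n) : 'M[K]_n := \matrix_(j, k) (br x (delta_mx 0 j)) 0 k.
Definition killing (br : 'rV[K]_n -> 'rV[K]_n -> 'rV[K]_n) (x y : 'rV[K]_n) : K := \tr (ad_mx br x *m ad_mx br y).

Definition lie_ideal (br : 'rV[K]_n -> 'rV[K]_n -> 'rV[K]_n) (I : 'M[K]_n) : Prop :=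
  forall x y : 'rV[K]_n, (y <= I)%MS -> (br x y <= I)%MS.

Definition simple_lie (br : 'rV[K]_n -> 'rV[K]_n -> 'rV[K]_n) : Prop :=
  [/\ lie_axioms br, (exists x y, br x y != 0) &
      forall I : 'M[K]_n, lie_ideal br I -> \rank I = 0%N \/ \rank I = n].

(* Tensor algebra T(g) (functions on words in the standard basis) and  *)
(* the two-sided ideal defining U(g).                                   *)
Definition tens := seq 'I_n -> K.
Definition tone : tens := fun w => (w == [::])%:R.
Definition tmul (t u : tens) : tens :=
  fun w => \sum_(k < (size w).+1) t (take k w) * u (drop k w).
Definition tvec (v : 'rV[K]_n) : tens := fun w => if w is [:: i] then v 0 i else 0.
Definition tword (w0 : seq 'I_n) : tens := fun w => (w == w0)%:R.
Definition sbas (a : 'I_n) : 'rV[K]_n := delta_mx 0 a.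
Definition urel (br : 'rV[K]_n -> 'rV[K]_n -> 'rV[K]_n) (a b : 'I_n) : tens :=
  fun w => tmul (tvec (sbas a)) (tvec (sbas b)) w - tmul (tvec (sbas b)) (tvec (sbas a)) w
           - tvec (br (sbas a) (sbas b)) w.
(* t lies in the ideal generated by  xy - yx - [x,y];  i.e. t = 0 in U(g) *)
Definition in_uideal (br : 'rV[K]_n -> 'rV[K]_n -> 'rV[K]_n) (t : tens) : Prop :=
  exists s : seq (K * seq 'I_n * 'I_n * 'I_n * seq 'I_n),
    forall w, t w = \sum_(x <- s) let: (c, w1, a, b, w2) := x in
                    c * tmul (tmul (tword w1) (urel br a b)) (tword w2) w.

(* The Lie algebra weight system, with basis rows of E and dual basis  *)
(* rows of Ed w.r.t. the form  form.  Each edge labelled by a basis    *)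
(* index c has one end labelled e_c and the other e_c^*; an internal   *)
(* vertex with ends (x1,x2,x3) in cyclic order contributes             *)
(* form [x1,x2] x3; loop points are multiplied in loop order.          *)
Definition end_label (E Ed : 'M[K]_n) (D : diag)
    (lab : {ffun 'I_(size (dedges D)) -> 'I_n}) (x : dend) : 'rV[K]_n :=
  \sum_(q < size (dedges D))
     ((if (nth dedge0 (dedges D) q).1 == x then row (lab q) E else 0)
      + (if (nth dedge0 (dedges D) q).2 == x then row (lab q) Ed else 0)).

Definition wsys (br : 'rV[K]_n -> 'rV[K]_n -> 'rV[K]_n) (form : 'rV[K]_n -> 'rV[K]_n -> K) (E Ed : 'M[K]_n) (D : diag) : tens :=
  fun w => \sum_(lab : {ffun 'I_(size (dedges D)) -> 'I_n})
     (\prod_(v <- dverts D)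
         form (br (end_label E Ed lab (v, Some s0)) (end_label E Ed lab (v, Some s1)))
              (end_label E Ed lab (v, Some s2)))
     * (\big[tmul/tone]_(p <- dpts D) tvec (end_label E Ed lab (p, None))) w.

Definition wbar (br : 'rV[K]_n -> 'rV[K]_n -> 'rV[K]_n) (form : 'rV[K]_n -> 'rV[K]_n -> K) (E Ed : 'M[K]_n) (D : diag) : tens :=
  fun w => wsys br form E Ed D w -
    \sum_(P : {set {set {set 'I_(size (dedges D))}}} | partition P (dcomps D) && (1 < #|P|)%N)
       ((-1) ^+ #|P| * (#|P|.-1)`!%:R) *
       wsys br form E Ed (\big[dmul/dunit]_(B <- enum P) subdiag D (cover B)) w.

End Lie.

(* Main.v *)
Require Import Defs.
From HB Require Import structures.
From Stdlib Require Import FunctionalExtensionality.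
From mathcomp Require Import all_boot all_order all_algebra.
From mathcomp Require Import zify ring.
Set Implicit Arguments. Unset Strict Implicit. Unset Printing Implicit Defensive.
Import GRing.Theory.
Local Open Scope ring_scope.

(** Let [C] be the value of the one-chord diagram, a central element of [U(g)].
    In [J_{i-1,s+1}], commute the two ends of the innermost chord past the legs
    [p2] and [p3].  The doubly bracketed term is a new rung, i.e. [J_{i,s}]; each
    singly bracketed term is half the adjoint Casimir acting on a leg, i.e.
    [-1/(2 lam) J_{i-1,s}]; the rest is [C J_{i-1,s}].  Hence in [U(g)]
      [w(J_{i,s}) = w(J_{i-1,s+1}) - C w(J_{i-1,s}) + 1/lam w(J_{i-1,s})].
    Every block of a partition of the components of [J_{i,j}] that consists of
    chords only is a power of [C], so the partition sum defining the projection
    is the [j]-th finite difference in [s] of [w(J_{i,s}) C^(j-s)], and the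
    identity above becomes the theorem.  For [i - 1 = 0] the ladder splits into
    two chords; the partitions separating them contribute polynomials in [C]
    which cancel. *)

(** * Sums over set partitions *)

(** The finite difference arises by inserting the chords one at a time. A chord put into a block of
    its own turns the coefficient [mobius k] into [- k * mobius k], which cancels the k copies of
    the unchanged value coming from the k existing blocks; only the change caused by joining the
    block of the ladder survives. When p1p2 and p3p4 lie in different blocks, a new chord can join
    either one, so each chord contributes twice the difference. The value of such a partition is a
    product of factors C and of one factor C - 1/(2 lam) per crossing chord, so that its difference
    is multiplication by -1/(2 lam). The power 2^(j+1) for j+1 chords then meets -1/(2 lam), and the
    result is opposite to 2^j / lam, which comes with j chords. The blocks are multiplied in the
    order of [enum P], about which nothing is known. Diagrams are therefore evaluated as label sums
    with the loop points in an explicit order, and centrality of C brings every such order to one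
    normal form. *)

Section PartitionRecursion.
Variables (T : finType).
Implicit Types (x y : T) (X B : {set T}) (P Q : {set {set T}}).

(* [B = set0] stands for putting [x] in a block of its own. *)
Definition part_add x Q B : {set {set T}} := (x |: B) |: (Q :\ B).
(** The final [:\ set0] discards the remnant of a block that consisted of [x] alone. *)
Definition part_del x P : {set {set T}} :=
  (pblock P x :\ x |: (P :\ pblock P x)) :\ set0.

Lemma partition_D1_set0 X Q B :
  partition Q X -> B \in set0 |: Q -> partition (Q :\ B) (X :\: B).
Proof.
move=> pQ /setU1P[->|BQ]; last exact: partitionD1.
rewrite setD0; suff -> : Q :\ set0 = Q by [].
by apply/setDidPl; rewrite disjoint_sym disjoints1 (partition0 pQ).
Qed.

Lemma subset_set0U1 X Q B : partition Q X -> B \in set0 |: Q -> B \subset X.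
Proof. by move=> pQ /setU1P[->|/(partitionS pQ)//]; rewrite sub0set. Qed.

Lemma partition_part_add x X Q B :
  x \notin X -> partition Q X -> B \in set0 |: Q ->
  partition (part_add x Q B) (x |: X).
Proof.
move=> xX pQ BQ; have BX := subset_set0U1 pQ BQ.
have -> : x |: X = (x |: B) :|: (X :\: B).
  by rewrite -setUA -{1}(setID X B) (setIidPr BX).
apply: partitionU1; first exact: partition_D1_set0.
  by apply/set0Pn; exists x; rewrite setU11.
rewrite -setI_eq0 setIUl; apply/eqP/setP => y; rewrite !inE.
have [->|_] /= := eqVneq y x; first by rewrite (negPf xX) !andbF.
by case: (y \in B); rewrite ?andbF.
Qed.

Lemma setU1_notin_partition x X Q B :
  x \notin X -> partition Q X -> (x |: B) \notin Q.
Proof.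
move=> xX pQ; apply: contra xX => /(partitionS pQ)/subsetP; apply.
exact: setU11.
Qed.

Lemma card_part_add x X Q B :
  x \notin X -> partition Q X -> B \in set0 |: Q ->
  #|part_add x Q B| = (#|Q| + (B == set0))%N.
Proof.
move=> xX pQ BQ.
rewrite /part_add cardsU1 !inE (negPf (setU1_notin_partition B xX pQ)) andbF /=.
have [->|B0] := eqVneq B set0.
  suff -> : Q :\ set0 = Q by rewrite addnC.
  by apply/setDidPl; rewrite disjoint_sym disjoints1 (partition0 pQ).
by move: BQ; rewrite !inE (negPf B0) /= => BQ; rewrite addn0 (cardsD1 B Q) BQ.
Qed.

Lemma pblock_part_add_new x X Q B :
  x \notin X -> partition Q X -> B \in set0 |: Q ->
  pblock (part_add x Q B) x = x |: B.
Proof.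
move=> xX pQ BQ; apply: def_pblock; rewrite ?setU11 //.
exact: partition_trivIset (partition_part_add xX pQ BQ).
Qed.

Lemma pblock_part_add x X Q B y :
  x \notin X -> partition Q X -> B \in set0 |: Q -> y \in X ->
  pblock (part_add x Q B) y = if pblock Q y == B then x |: B else pblock Q y.
Proof.
move=> xX pQ BQ yX; have tP := partition_trivIset (partition_part_add xX pQ BQ).
have yQ : y \in cover Q by rewrite (cover_partition pQ).
case: eqVneq => [eB|nB]; apply: def_pblock; rewrite ?mem_pblock //.
- exact: setU11.
- by rewrite -eB inE mem_pblock yQ orbT.
by rewrite !inE nB pblock_mem ?orbT.
Qed.

Lemma partition_part_del x X P :
  x \notin X -> partition P (x |: X) ->
  partition (part_del x P) X /\ pblock P x :\ x \in set0 |: part_del x P.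
Proof.
move=> xX pP; rewrite /part_del.
have xP : x \in cover P by rewrite (cover_partition pP) setU11.
set C := pblock P x.
have CP : C \in P by rewrite pblock_mem.
have xC : x \in C by rewrite mem_pblock.
have CX : C \subset x |: X := partitionS pP CP.
have pD := partitionD1 pP CP.
have n0 : set0 \notin P :\ C by rewrite (partition0 pD).
have [B0|B0] := eqVneq (C :\ x) set0.
  rewrite B0; split; last by rewrite setU11.
  have -> : (set0 |: P :\ C) :\ set0 = P :\ C by rewrite setU1K.
  have Cx : C = [set x] by rewrite -(setD1K xC) B0 setU0.
  by move: pD; rewrite Cx setU1K.
have eQ : ((C :\ x) |: P :\ C) :\ set0 = (C :\ x) |: P :\ C.
  apply/setDidPl; rewrite disjoint_sym disjoints1 in_setU1 (negPf n0) orbF.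
  by rewrite eq_sym.
rewrite eQ; split; last by rewrite !inE eqxx orbT.
have -> : X = (C :\ x) :|: ((x |: X) :\: C).
  apply/setP => y; rewrite !inE.
  have [->|nyx] /= := eqVneq y x; first by rewrite xC (negPf xX).
  case yC: (y \in C) => //=.
  by move/subsetP: CX => /(_ y yC); rewrite !inE (negPf nyx).
apply: partitionU1 => //.
rewrite -setI_eq0; apply/eqP/setP => y; rewrite !inE.
by case: (y \in C); rewrite ?andbF.
Qed.

Lemma part_delK x X P :
  x \notin X -> partition P (x |: X) ->
  part_add x (part_del x P) (pblock P x :\ x) = P.
Proof.
move=> xX pP; rewrite /part_add /part_del.
have xP : x \in cover P by rewrite (cover_partition pP) setU11.
set C := pblock P x.
have CP : C \in P by rewrite pblock_mem.
have xC : x \in C by rewrite mem_pblock.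
have tP := partition_trivIset pP.
rewrite setD1K // -[RHS](setD1K CP); congr (_ |: _).
apply/setP => Y; rewrite !inE.
have [->|YB] /= := eqVneq Y (C :\ x).
  apply/esym/negbTE/negP => /andP[nC BP].
  have [z zB] : exists z, z \in C :\ x by apply/set0Pn; apply: partition_neq0 pP BP.
  have zC : z \in C by move: zB; rewrite !inE => /andP[].
  by move: nC; rewrite -(def_pblock tP BP zB) (def_pblock tP CP zC) eqxx.
have [->|//] := eqVneq Y set0.
by rewrite /= (partition0 pP) andbF.
Qed.

Lemma part_addK x X Q B :
  x \notin X -> partition Q X -> B \in set0 |: Q ->
  part_del x (part_add x Q B) = Q /\ pblock (part_add x Q B) x :\ x = B.
Proof.
move=> xX pQ BQ; have eB := pblock_part_add_new xX pQ BQ.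
have xB : x \notin B by apply: contra xX; apply: subsetP (subset_set0U1 pQ BQ) x.
rewrite /part_del eB setU1K //; split=> //.
rewrite /part_add setU1K; last first.
  by rewrite !inE (negPf (setU1_notin_partition B xX pQ)) andbF.
apply/setP => Y; rewrite !inE.
have [->|Y0] /= := eqVneq Y set0; first by rewrite (partition0 pQ).
have [eYB|//] := eqVneq Y B => /=; rewrite eYB in Y0 *.
by move: BQ; rewrite !inE (negPf Y0).
Qed.
End PartitionRecursion.

(** * Partition sums with Moebius coefficients as iterated differences *)

Section PartitionSums.
Variables (T : finType) (K : comNzRingType).
Implicit Types (x L : T) (X B : {set T}) (P Q : {set {set T}}).

(** The maps [part_add] and ([part_del], block of [x] without [x]) are mutually inverse, so the sum
    is reindexed by a smaller partition and the block that receives [x]. *)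
Lemma sum_partitionU1 (V : nmodType) x X (f : {set {set T}} -> V) : x \notin X ->
  \sum_(P | partition P (x |: X)) f P =
  \sum_(Q | partition Q X) \sum_(B in set0 |: Q) f (part_add x Q B).
Proof.
move=> xX; rewrite pair_big_dep /=.
rewrite (reindex_onto (fun q : {set {set T}} * {set T} => part_add x q.1 q.2)
                      (fun P => (part_del x P, pblock P x :\ x))) /=; last first.
  by move=> P pP; rewrite (part_delK xX pP).
apply: eq_bigl => -[Q B] /=; apply/andP/andP => [[pP /eqP[eQ eB]]|[pQ BQ]].
  by have := partition_part_del xX pP; rewrite eQ eB.
by have [-> ->] := part_addK xX pQ BQ; rewrite partition_part_add.
Qed.

Lemma sum_partition0 (V : nmodType) (f : {set {set T}} -> V) :
  \sum_(P | partition P set0) f P = f set0.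
Proof. by under eq_bigl do rewrite partition_set0; rewrite big_pred1_eq. Qed.

(* The coefficient of a splitting into [k] parts in the projection onto primitive
   elements, including [k = 1]. *)
Definition mobius (k : nat) : K := - ((-1) ^+ k * (k.-1)`!%:R).

Lemma mobius1 : mobius 1 = 1.
Proof. by rewrite /mobius fact0 expr1 mulr1 opprK. Qed.

(** The relation behind the collapse of the partition sums: one new block, weighted by
    [mobius k.+1], balances the k ways of joining an existing block. *)
Lemma mobiusS k : (0 < k)%N -> mobius k.+1 = - (k%:R * mobius k).
Proof.
case: k => // k _; rewrite /mobius /= factS natrM exprS.
by set a := _.+1%:R; set b := _`!%:R; ring.
Qed.

Definition fdiff (phi : nat -> K) (s : nat) : K := phi s.+1 - phi s.

Lemma iter_fdiffD (m : nat) (phi psi : nat -> K) (c : K) (s : nat) :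
  iter m fdiff (fun s => phi s + c * psi s) s =
  iter m fdiff phi s + c * iter m fdiff psi s.
Proof. by elim: m s => //= m IH s; rewrite /fdiff !IH; ring. Qed.

Lemma iter_fdiffZ (m : nat) (phi : nat -> K) (c : K) (s : nat) :
  iter m fdiff (fun s => c * phi s) s = c * iter m fdiff phi s.
Proof. by elim: m s => //= m IH s; rewrite /fdiff !IH; ring. Qed.

Lemma eq_iter_fdiff (m : nat) (phi psi : nat -> K) (s : nat) :
  (forall k, (k <= s + m)%N -> phi k = psi k) -> iter m fdiff phi s = iter m fdiff psi s.
Proof.
elim: m s => [|m IH] s H /=; first by apply: H; rewrite addn0.
rewrite /fdiff !IH // => k hk; apply: H; first by rewrite addnS leqW.
by rewrite addnS -addSn.
Qed.

Lemma notin0_partition X Q : partition Q X -> set0 \notin Q.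
Proof. by move/partition0 => ->. Qed.

(** Induction on [X], inserting one element [x]. Unchanged values cancel by [mobiusS]; what remains
    is [x] joining the block of [L], and this replaces [phi] by [fdiff phi]. The predecessor
    discounts [L] itself. *)
Lemma partition_sum_block L X (phi : nat -> K) : L \notin X ->
  \sum_(P | partition P (L |: X)) mobius #|P| * phi #|pblock P L|.-1 =
  iter #|X| fdiff phi 0%N.
Proof.
move: {2}#|X| (erefl #|X|) => m; elim: m X phi => [|m IH] X phi cX LX.
  have -> : X = set0 by apply/eqP; rewrite -cards_eq0 cX.
  rewrite sum_partitionU1 ?inE // sum_partition0 setU0 big_set1 cards0 /=.
  have p0 : partition (set0 : {set {set T}}) (set0 : {set T}) by rewrite partition_set0.
  rewrite (@card_part_add _ L set0) ?inE ?eqxx //.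
  rewrite (@pblock_part_add_new _ L set0) ?inE ?eqxx // setU0 cards1 cards0 /=.
  by rewrite mobius1 mul1r.
have /set0Pn[x xX] : X != set0 by rewrite -cards_eq0 cX.
have cY : #|X :\ x| = m by move: cX; rewrite (cardsD1 x) xX => -[].
set Y := X :\ x in cY *.
have LY : L \notin Y by apply: contra LX; rewrite inE => /andP[].
have xLY : x \notin L |: Y.
  by rewrite !inE eqxx /= orbF; apply: contraNneq LX => <-.
have eX : L |: X = x |: (L |: Y) by rewrite setUCA setD1K.
rewrite eX sum_partitionU1 // cX iterSr -cY -IH //.
apply: eq_bigr => Q pQ.
have LQ : L \in L |: Y by rewrite setU11.
have LcQ : L \in cover Q by rewrite (cover_partition pQ).
have BLQ := pblock_mem LcQ.
rewrite big_setU1 ?(notin0_partition pQ) //=.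
have step B : B \in set0 |: Q -> mobius #|part_add x Q B| *
    phi #|pblock (part_add x Q B) L|.-1 = mobius (#|Q| + (B == set0)) *
    (phi #|pblock Q L|.-1 + (if B == pblock Q L then fdiff phi #|pblock Q L|.-1 else 0)).
  move=> BQ; rewrite (card_part_add xLY pQ BQ) (pblock_part_add xLY pQ BQ LQ) eq_sym.
  congr (_ * _); case: (eqVneq B) => [->|_]; last by rewrite addr0.
  have xB : x \notin pblock Q L.
    by apply: contra xLY; apply: subsetP (partitionS pQ BLQ) x.
  have cB : (0 < #|pblock Q L|)%N by rewrite card_gt0 (partition_neq0 pQ).
  rewrite cardsU1 xB add1n /=; case: #|_| cB => //= c _.
  by rewrite /fdiff addrC subrK.
rewrite step ?setU11 // eqxx eq_sym (negPf (partition_neq0 pQ BLQ)) addr0 addn1.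
rewrite (eq_bigr (fun B => mobius #|Q| * (phi #|pblock Q L|.-1 +
   (if B == pblock Q L then fdiff phi #|pblock Q L|.-1 else 0)))); last first.
  move=> B BQ; rewrite step ?inE ?BQ ?orbT //.
  by rewrite (negPf (partition_neq0 pQ BQ)) addn0.
rewrite -mulr_sumr big_split /= sumr_const -big_mkcondr /=.
rewrite (big_pred1 (pblock Q L)); last first.
  by move=> B /=; case: eqVneq => [->|]; rewrite ?BLQ ?andbF.
(* The singleton block contributes minus #|Q| times the old value, which cancels the old values from
   all #|Q| blocks. *)
rewrite mobiusS; last by rewrite card_gt0; apply/set0Pn; exists (pblock Q L).
rewrite -mulr_natl; ring.
Qed.

(** If [L1] and [L2] share a block, a new element has one way to change the value; if they are apart
    it has two, with the same effect on the total size. This doubling gives the power of 2, and the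
    minus sign is [mobius 2]. The subtracted 2 discounts [L1] and [L2]. *)
Lemma partition_sum_two_blocks L1 L2 X (phi psi : nat -> K) :
  L1 != L2 -> L1 \notin X -> L2 \notin X ->
  \sum_(P | partition P (L1 |: (L2 |: X))) mobius #|P| *
     (if pblock P L1 == pblock P L2 then phi (#|pblock P L1| - 2)%N
      else psi (#|pblock P L1| + #|pblock P L2| - 2)%N) =
  iter #|X| fdiff phi 0%N - 2%:R ^+ #|X| * iter #|X| fdiff psi 0%N.
Proof.
move=> L12; move: {2}#|X| (erefl #|X|) => m.
elim: m X phi psi => [|m IH] X phi psi cX L1X L2X.
  have -> : X = set0 by apply/eqP; rewrite -cards_eq0 cX.
  have p0 : partition (set0 : {set {set T}}) (set0 : {set T}) by rewrite partition_set0.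
  have L20 : L2 \notin set0 by rewrite inE.
  rewrite setU0 sum_partitionU1 ?inE //.
  rewrite -[[set L2]]setU0 sum_partitionU1 ?inE // sum_partition0 setU0 big_set1 cards0 /=.
  set Q := part_add L2 set0 set0.
  have eQ : Q = [set [set L2]].
    rewrite /Q /part_add setU0 set0D; exact: setU0.
  have pQ : partition Q [set L2].
    by have := partition_part_add L20 p0 (setU11 _ _); rewrite setU0.
  have L1Q : L1 \notin [set L2] by rewrite inE.
  have tQ := partition_trivIset pQ.
  have Q2 : [set L2] \in Q by rewrite eQ set11.
  have bQ : pblock Q L2 = [set L2] by apply: def_pblock; rewrite ?set11.
  have b0 : set0 \in set0 |: Q by rewrite setU11.
  have b2 : [set L2] \in set0 |: Q by rewrite inE Q2 orbT.
  have L22 : L2 \in [set L2] by rewrite set11.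
  rewrite big_setU1 ?(notin0_partition pQ) //=.
  rewrite (big_pred1 [set L2]) => [|B]; last by rewrite eQ inE.
  rewrite (card_part_add L1Q pQ b0) (card_part_add L1Q pQ b2).
  rewrite (pblock_part_add_new L1Q pQ b0) (pblock_part_add_new L1Q pQ b2).
  rewrite (pblock_part_add L1Q pQ b0 L22) (pblock_part_add L1Q pQ b2 L22).
  have s20 : [set L2] != set0 by apply/set0Pn; exists L2; rewrite inE.
  rewrite bQ (negPf s20) !eqxx setU0.
  have -> : ([set L1] == [set L2]) = false.
    by apply/negbTE; apply: contraNneq L12 => /setP /(_ L1); rewrite !inE eqxx => /esym.
  rewrite eQ !cards1 (cardsU1 L1) inE (negPf L12) cards1 /= mobiusS // mobius1 !subnn expr0.
  by ring.
have /set0Pn[x xX] : X != set0 by rewrite -cards_eq0 cX.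
have cY : #|X :\ x| = m by move: cX; rewrite (cardsD1 x) xX => -[].
set Y := X :\ x in cY *.
have L1Y : L1 \notin Y by apply: contra L1X; rewrite inE => /andP[].
have L2Y : L2 \notin Y by apply: contra L2X; rewrite inE => /andP[].
set Z := L1 |: (L2 |: Y).
have xZ : x \notin Z.
  rewrite !inE eqxx /= orbF negb_or; apply/andP; split.
    by apply: contraNneq L1X => <-.
  by apply: contraNneq L2X => <-.
have eX : L1 |: (L2 |: X) = x |: Z.
  by rewrite /Z -{1}(setD1K xX) -/Y (setUCA [set L2]) (setUCA [set L1]).
rewrite eX sum_partitionU1 // cX !iterSr exprS.
(* The induction hypothesis is applied to [fdiff phi] and to [2 * fdiff psi], so one factor 2 moves
   inside the difference. *)
have -> : (2 : K) * 2 ^+ m * iter m fdiff (fdiff psi) 0%N =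
   2 ^+ m * iter m fdiff (fun s => 2 * fdiff psi s) 0%N.
  by rewrite iter_fdiffZ; ring.
rewrite -cY -IH //.
apply: eq_bigr => Q pQ.
have L1Z : L1 \in Z by rewrite setU11.
have L2Z : L2 \in Z by rewrite !inE eqxx orbT.
have cQ y : y \in Z -> y \in cover Q by rewrite (cover_partition pQ).
set B1 := pblock Q L1; set B2 := pblock Q L2.
have B1Q : B1 \in Q by rewrite pblock_mem ?cQ.
have B2Q : B2 \in Q by rewrite pblock_mem ?cQ.
have c1 : (0 < #|B1|)%N by rewrite card_gt0 (partition_neq0 pQ).
have c2 : (0 < #|B2|)%N by rewrite card_gt0 (partition_neq0 pQ).
have xN B : B \in Q -> x \notin B.
  by move=> BQ; apply: contra xZ; apply: subsetP (partitionS pQ BQ) x.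
rewrite big_setU1 ?(notin0_partition pQ) //=.
set v := (if B1 == B2 then phi (#|B1| - 2)%N else psi (#|B1| + #|B2| - 2)%N).
(* The increments for joining [B1] and [B2]. When the two blocks coincide the whole increment sits
   in [d1], so that it is not counted twice. *)
set d1 := (if B1 == B2 then fdiff phi (#|B1| - 2)%N else fdiff psi (#|B1| + #|B2| - 2)%N).
set d2 := (if B1 == B2 then 0 else fdiff psi (#|B1| + #|B2| - 2)%N).
(* A common block contains both marked elements, so the truncated subtraction of 2 is exact and
   commutes with adding one element. *)
have c12 : B1 = B2 -> (1 < #|B1|)%N.
  move=> e; have -> : 2%N = #|[set L1; L2]| by rewrite cards2 L12.
  apply: subset_leq_card; apply/subsetP => y; rewrite !inE => /orP[]/eqP->.
    by rewrite mem_pblock cQ.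
  by rewrite e mem_pblock cQ.
have step B : B \in set0 |: Q -> mobius #|part_add x Q B| *
    (if pblock (part_add x Q B) L1 == pblock (part_add x Q B) L2 then
      phi (#|pblock (part_add x Q B) L1| - 2)%N else
      psi (#|pblock (part_add x Q B) L1| + #|pblock (part_add x Q B) L2| - 2)%N) =
    mobius (#|Q| + (B == set0)) *
    (v + (if B == B1 then d1 else 0) + (if B == B2 then d2 else 0)).
  move=> BQ; rewrite (card_part_add xZ pQ BQ) !(pblock_part_add xZ pQ BQ) //.
  congr (_ * _); rewrite -/B1 -/B2 (eq_sym B B1) (eq_sym B B2) /v /d1 /d2 /fdiff.
  case: (eqVneq B1 B) => [e1|n1].
    case: (eqVneq B2 B) => [e2|n2].
      rewrite e1 e2 !eqxx cardsU1 -{1 2}e1 (xN _ B1Q).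
      have := c12 (etrans e1 (esym e2)); rewrite e1.
      case: #|B| => [|[|c]] //= _; rewrite add1n subn2 /= !subn2 /=; ring.
    have n12 : B1 == B2 = false by apply/negbTE; apply: contraNneq n2 => <-; apply/eqP.
    have -> : (x |: B == B2) = false.
      by apply/negbTE; apply: contraTneq B2Q => <-; apply: setU1_notin_partition pQ.
    rewrite n12 cardsU1 -{1}e1 (xN _ B1Q) -e1.
    case: #|B1| c1 => // a _; case: #|B2| c2 => // b _.
    rewrite add1n !addSn !addnS !subn2 /=; ring.
  case: (eqVneq B2 B) => [e2|n2].
    have n12 : B1 == B2 = false by apply/negbTE; apply: contraNneq n1 => ->; apply/eqP.
    have -> : (B1 == x |: B) = false.
      by apply/negbTE; apply: contraTneq B1Q => ->; apply: setU1_notin_partition pQ.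
    rewrite n12 cardsU1 -{1}e2 (xN _ B2Q) -e2.
    case: #|B1| c1 => // a _; case: #|B2| c2 => // b _.
    rewrite add1n !addSn !addnS !subn2 /=; ring.
  by rewrite !addr0.
rewrite step ?setU11 // eqxx !(eq_sym set0).
rewrite (negPf (partition_neq0 pQ B1Q)) (negPf (partition_neq0 pQ B2Q)) !addr0 addn1.
rewrite (eq_bigr (fun B => mobius #|Q| *
   (v + (if B == B1 then d1 else 0) + (if B == B2 then d2 else 0)))); last first.
  move=> B BQ; rewrite step ?inE ?BQ ?orbT //.
  by rewrite (negPf (partition_neq0 pQ BQ)) addn0.
rewrite -mulr_sumr !big_split /= sumr_const -!big_mkcondr /=.
rewrite (big_pred1 B1); last by move=> B /=; case: eqVneq => [->|]; rewrite ?B1Q ?andbF.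
rewrite (big_pred1 B2); last by move=> B /=; case: eqVneq => [->|]; rewrite ?B2Q ?andbF.
rewrite mobiusS; last by rewrite card_gt0; apply/set0Pn; exists B1.
rewrite -mulr_natl /d1 /d2.
by case: ifP => _; ring.
Qed.
End PartitionSums.

(** * The tensor algebra and the enveloping ideal *)

Section Tensors.
Variables (K : fieldType) (n : nat).
Implicit Types (t u v : tens K n) (w : seq 'I_n) (x y z : 'rV[K]_n).
Implicit Types (l r m : seq 'rV[K]_n).

Lemma tmul_nil t u : tmul t u [::] = t [::] * u [::].
Proof. by rewrite /tmul big_ord_recl big_ord0 addr0. Qed.

(** Splits the cuts of a word into the empty prefix and the others. It turns the convolution into a
    recursion on the word in which the left factor is replaced by its derivative along the first
    letter. *)
Lemma tmul_cons t u i w :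
  tmul t u (i :: w) = t [::] * u (i :: w) + tmul (fun w => t (i :: w)) u w.
Proof. by rewrite /tmul big_ord_recl. Qed.

Lemma eq_tmul t t' u u' : t =1 t' -> u =1 u' -> tmul t u =1 tmul t' u'.
Proof. by move=> et eu w; apply: eq_bigr => k _; rewrite et eu. Qed.

Lemma tmulDl (a : K) t t' u w :
  tmul (fun w => a * t w + t' w) u w = a * tmul t u w + tmul t' u w.
Proof.
by rewrite mulr_sumr -big_split; apply: eq_bigr => k _ /=; rewrite mulrDl mulrA.
Qed.

Lemma tmulDr (a : K) t u u' w :
  tmul t (fun w => a * u w + u' w) w = a * tmul t u w + tmul t u' w.
Proof.
by rewrite mulr_sumr -big_split; apply: eq_bigr => k _ /=; rewrite mulrDr mulrCA.
Qed.

Lemma tmul0l t u w : t =1 (fun _ => 0) -> tmul t u w = 0.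
Proof. by move=> t0; rewrite /tmul big1 // => k _; rewrite t0 mul0r. Qed.

Lemma tmulA t u v : tmul (tmul t u) v =1 tmul t (tmul u v).
Proof.
move=> w; elim: w t u v => [|i w IH] t u v; first by rewrite !tmul_nil mulrA.
rewrite !(tmul_cons _ _ i w) tmul_nil -IH.
rewrite (eq_tmul (t' := fun w => t [::] * u (i :: w) + tmul (fun w => t (i :: w)) u w)
  (u' := v) (tmul_cons _ _ _) (frefl _)) tmulDl.
ring.
Qed.

Lemma tmul1l t : tmul (@tone K n) t =1 t.
Proof.
case=> [|i w]; first by rewrite tmul_nil /tone eqxx mul1r.
by rewrite tmul_cons /tone eqxx mul1r tmul0l ?addr0.
Qed.

Lemma tmul1r t : tmul t (@tone K n) =1 t.
Proof.
move=> w; elim: w t => [|i w IH] t; first by rewrite tmul_nil /tone eqxx mulr1.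
by rewrite tmul_cons /tone mulr0 add0r IH.
Qed.

Definition tprod l : tens K n := \big[@tmul K n/@tone K n]_(x <- l) tvec x.

Lemma tprod_nil : tprod [::] = @tone K n.
Proof. by rewrite /tprod big_nil. Qed.

Lemma tprod_cons x l : tprod (x :: l) = tmul (tvec x) (tprod l).
Proof. by rewrite /tprod big_cons. Qed.

Lemma tprod_cat l r : tprod (l ++ r) =1 tmul (tprod l) (tprod r).
Proof.
elim: l => [|x l IH] w /=; first by rewrite tprod_nil tmul1l.
by rewrite !tprod_cons tmulA; apply: eq_tmul.
Qed.

Lemma tvecD (a : K) x y w : tvec (a *: x + y) w = a * tvec x w + tvec y w.
Proof. by case: w => [|i [|? ?]] /=; rewrite ?mulr0 ?addr0 // !mxE. Qed.

Lemma tprodD (a : K) l x y r w :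
  tprod (l ++ (a *: x + y) :: r) w = a * tprod (l ++ x :: r) w + tprod (l ++ y :: r) w.
Proof.
rewrite !tprod_cat -tmulDr; apply: eq_tmul => // {}w; rewrite !tprod_cons -tmulDl.
by apply: eq_tmul => // {}w; rewrite tvecD.
Qed.

Lemma tprodZ (a : K) l x r w : tprod (l ++ a *: x :: r) w = a * tprod (l ++ x :: r) w.
Proof.
have := tprodD 1 l 0 0 r w; rewrite scaler0 addr0 mul1r => /eqP.
rewrite -subr_eq subrr eq_sym => /eqP e0.
by have := tprodD a l x 0 r w; rewrite addr0 e0 addr0.
Qed.

Lemma tprod0 l r w : tprod (l ++ 0 :: r) w = 0.
Proof. by have := tprodZ 0 l 0 r w; rewrite scale0r mul0r. Qed.

Lemma tprod_add l x y r w : tprod (l ++ (x + y) :: r) w = tprod (l ++ x :: r) w + tprod (l ++ y :: r) w.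
Proof. by rewrite -{1}[x]scale1r tprodD mul1r. Qed.

Lemma tprodN l x r w : tprod (l ++ - x :: r) w = - tprod (l ++ x :: r) w.
Proof. by rewrite -scaleN1r tprodZ mulN1r. Qed.

Lemma tprod_sum (I : Type) (s : seq I) (P : pred I) (F : I -> 'rV[K]_n) l r w :
  tprod (l ++ (\sum_(i <- s | P i) F i) :: r) w = \sum_(i <- s | P i) tprod (l ++ F i :: r) w.
Proof. apply: (big_morph (fun x => tprod (l ++ x :: r) w)); [by move=> x y; exact: tprod_add | exact: tprod0]. Qed.

Lemma tprod_basis l x r w : tprod (l ++ x :: r) w = \sum_i x 0 i * tprod (l ++ sbas K i :: r) w.
Proof. by rewrite {1}[x]row_sum_delta tprod_sum; apply: eq_bigr => i _; rewrite tprodZ. Qed.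

Lemma tvec_sbas i : tvec (sbas K i) =1 @tword K n [:: i].
Proof.
case=> [|k [|? ?]] //=; rewrite /tword ?mxE ?eqxx //=.
  by rewrite eqseq_cons eqxx andbT.
by rewrite eqseq_cons andbF.
Qed.

Lemma tword_tp w0 : @tword K n w0 =1 tprod (map (@sbas K n) w0).
Proof.
elim: w0 => [|i w0 IH] w /=; first by rewrite tprod_nil.
rewrite tprod_cons -(eq_tmul (frefl _) IH) (eq_tmul (tvec_sbas i) (frefl _)).
case: w => [|k w]; first by rewrite tmul_nil /tword /= mul0r.
rewrite tmul_cons /tword mul0r add0r eqseq_cons.
have [->|nik] /= := eqVneq k i; last by rewrite tmul0l // => w'; rewrite eqseq_cons (negPf nik).
rewrite -[LHS](tmul1l (@tword K n w0)); apply: eq_tmul => // w'.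
by rewrite /tone eqseq_cons eqxx.
Qed.
End Tensors.

(** * Congruence modulo the ideal that defines the enveloping algebra *)

Section Ideal.
Variables (K : fieldType) (n : nat) (br : 'rV[K]_n -> 'rV[K]_n -> 'rV[K]_n).
Implicit Types (t u v : tens K n) (w : seq 'I_n) (x y z : 'rV[K]_n).
Implicit Types (l r m : seq 'rV[K]_n).

(* Equality in the enveloping algebra. *)
Definition tcong t u := in_uideal br (fun w => t w - u w).

Lemma in_uideal_ext t u : t =1 u -> in_uideal br t -> in_uideal br u.
Proof. by move=> e [s Hs]; exists s => w; rewrite -e. Qed.

Lemma in_uideal0 : in_uideal br (fun _ => 0).
Proof. by exists [::] => w; rewrite big_nil. Qed.

Lemma in_uidealD t u :
  in_uideal br t -> in_uideal br u -> in_uideal br (fun w => t w + u w).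
Proof. by move=> [s Hs] [s' Hs']; exists (s ++ s') => w; rewrite big_cat Hs Hs'. Qed.

Lemma in_uidealZ (a : K) t : in_uideal br t -> in_uideal br (fun w => a * t w).
Proof.
move=> [s Hs]; exists [seq let: (c, w1, i, k, w2) := q in (a * c, w1, i, k, w2) | q <- s] => w.
rewrite Hs mulr_sumr big_map; apply: eq_bigr => -[[[[c w1] i] k] w2] _.
by rewrite mulrA.
Qed.

Lemma in_uideal_sum (I : Type) (s : seq I) (P : pred I) (F : I -> tens K n) :
  (forall i, P i -> in_uideal br (F i)) ->
  in_uideal br (fun w => \sum_(i <- s | P i) F i w).
Proof.
move=> HF; elim: s => [|i s IH].
  by apply: in_uideal_ext in_uideal0 => w; rewrite big_nil.
case Pi: (P i); last by apply: in_uideal_ext IH => w; rewrite big_cons Pi.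
by apply: in_uideal_ext (in_uidealD (HF i Pi) IH) => w; rewrite big_cons Pi.
Qed.

Lemma tcong_eq t u : t =1 u -> tcong t u.
Proof. by move=> e; apply: in_uideal_ext in_uideal0 => w; rewrite e subrr. Qed.

Lemma tcong_ext t t' u u' : t =1 t' -> u =1 u' -> tcong t' u' -> tcong t u.
Proof. by move=> et eu; apply: in_uideal_ext => w; rewrite et eu. Qed.

Lemma tcong_refl t : tcong t t. Proof. exact: tcong_eq. Qed.

Lemma tcong_sym t u : tcong t u -> tcong u t.
Proof. by move/(in_uidealZ (-1)); apply: in_uideal_ext => w; rewrite mulN1r opprB. Qed.

Lemma tcong_trans t u v : tcong t u -> tcong u v -> tcong t v.
Proof.
by move=> tu uv; apply: in_uideal_ext (in_uidealD tu uv) => w; rewrite addrA subrK.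
Qed.

Lemma tcongD t t' u u' :
  tcong t t' -> tcong u u' -> tcong (fun w => t w + u w) (fun w => t' w + u' w).
Proof.
move=> tt uu; apply: in_uideal_ext (in_uidealD tt uu) => w; ring.
Qed.

Lemma tcongZ (a : K) t t' : tcong t t' -> tcong (fun w => a * t w) (fun w => a * t' w).
Proof. by move/(in_uidealZ a); apply: in_uideal_ext => w; rewrite mulrBr. Qed.

Lemma tcong_sum (I : Type) (s : seq I) (P : pred I) (F G : I -> tens K n) :
  (forall i, P i -> tcong (F i) (G i)) ->
  tcong (fun w => \sum_(i <- s | P i) F i w) (fun w => \sum_(i <- s | P i) G i w).
Proof. by move/(in_uideal_sum s); apply: in_uideal_ext => w; rewrite sumrB. Qed.

Hypothesis lieP : lie_axioms br.

Lemma br_sumr (I : Type) (s : seq I) (P : pred I) (F : I -> 'rV[K]_n) x :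
  br x (\sum_(i <- s | P i) F i) = \sum_(i <- s | P i) br x (F i).
Proof.
case: lieP => _ Hr _ _.
have H0 : br x 0 = 0.
  by have := Hr (-1) x 0 0; rewrite scaler0 addr0 scaleN1r addNr.
apply: (big_morph (br x)) => [y z|]; last exact: H0.
by have := Hr 1 x y z; rewrite !scale1r.
Qed.

Lemma br_suml (I : Type) (s : seq I) (P : pred I) (F : I -> 'rV[K]_n) x :
  br (\sum_(i <- s | P i) F i) x = \sum_(i <- s | P i) br (F i) x.
Proof.
case: lieP => Hl _ _ _.
have H0 : br 0 x = 0.
  by have := Hl (-1) 0 0 x; rewrite scaler0 addr0 scaleN1r addNr.
apply: (big_morph (fun y => br y x)) => [y z|]; last exact: H0.
by have := Hl 1 y z x; rewrite !scale1r.
Qed.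

Lemma brZl (a : K) x y : br (a *: x) y = a *: br x y.
Proof.
case: lieP => Hl _ _ _; rewrite -[a *: x]addr0 Hl.
by have := Hl (-1) 0 0 y; rewrite scaler0 addr0 scaleN1r addNr => ->; rewrite addr0.
Qed.

Lemma brZr (a : K) x y : br x (a *: y) = a *: br x y.
Proof.
case: lieP => _ Hr _ _; rewrite -[a *: y]addr0 Hr.
by have := Hr (-1) x 0 0; rewrite scaler0 addr0 scaleN1r addNr => ->; rewrite addr0.
Qed.

Lemma brDl x y z : br (x + y) z = br x z + br y z.
Proof. by case: lieP => Hl _ _ _; rewrite -{1}[x]scale1r Hl scale1r. Qed.

Lemma brDr x y z : br x (y + z) = br x y + br x z.
Proof. by case: lieP => _ Hr _ _; rewrite -{1}[y]scale1r Hr scale1r. Qed.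

Lemma brC x y : br x y = - br y x.
Proof.
case: lieP => _ _ H0 _; apply/eqP; rewrite -addr_eq0; apply/eqP.
by have := H0 (x + y); rewrite brDl !brDr !H0 add0r addr0.
Qed.

Lemma brNr x y : br x (- y) = - br x y.
Proof. by rewrite -scaleN1r brZr scaleN1r. Qed.

Lemma br_jacobi x y z : br (br x y) z = br x (br y z) - br y (br x z).
Proof.
case: lieP => _ _ _ J; have := J x y z.
rewrite [br z (br x y)]brC [br z x]brC brNr => /eqP.
by rewrite subr_eq0 => /eqP <-.
Qed.

Definition urel_word l x y r : tens K n := fun w =>
  tprod (l ++ x :: y :: r) w - tprod (l ++ y :: x :: r) w - tprod (l ++ br x y :: r) w.

Lemma urel_word_basis w1 a b w2 :
  in_uideal br (urel_word (map (@sbas K n) w1) (sbas K a) (sbas K b) (map (@sbas K n) w2)).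
Proof.
(* Between words of basis vectors the relation is a single generator, with coefficient 1. *)
exists [:: (1, w1, a, b, w2)] => w; rewrite big_seq1 mul1r /urel_word.
set l := map _ w1; set r := map _ w2.
have tp1 z : tprod [:: z] =1 tvec z by move=> w'; rewrite tprod_cons tprod_nil tmul1r.
have eu : urel br a b =1 (fun w => -1 * tprod [:: br (sbas K a) (sbas K b)] w +
    (fun w => -1 * tprod [:: sbas K b; sbas K a] w + tprod [:: sbas K a; sbas K b] w) w).
  move=> w'; rewrite /urel tp1 !(tprod_cons _ [:: _]).
  rewrite !(eq_tmul (frefl _) (tp1 _)); ring.
have eL m : tmul (tmul (tprod l) (tprod m)) (tprod r) w = tprod (l ++ m ++ r) w.
  by rewrite tmulA (eq_tmul (frefl _) (fsym (tprod_cat _ _))) -tprod_cat.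
rewrite (eq_tmul (eq_tmul (tword_tp K w1) eu) (tword_tp K w2)) -/l -/r.
rewrite (eq_tmul (t' := fun w => -1 * tmul (tprod l) (tprod [:: br (sbas K a) (sbas K b)]) w +
   (-1 * tmul (tprod l) (tprod [:: sbas K b; sbas K a]) w +
    tmul (tprod l) (tprod [:: sbas K a; sbas K b]) w)) (u' := tprod r)) //; last first.
  by move=> w'; rewrite !tmulDr.
by rewrite !tmulDl !eL /=; ring.
Qed.

(** The ideal is spanned by relations placed between basis words. Multilinearity extends this to
    arbitrary vectors: [step1] expands the two vectors being commuted, [step2] the right context,
    [step3] the left context. *)
Lemma urel_word_in_uideal l x y r : in_uideal br (urel_word l x y r).
Proof.
pose S := map (@sbas K n).
have step1 w1 w2 : in_uideal br (urel_word (S w1) x y (S w2)).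
  apply: (@in_uideal_ext (fun w => \sum_a x 0 a * (\sum_b y 0 b *
     urel_word (S w1) (sbas K a) (sbas K b) (S w2) w))); last first.
    apply: in_uideal_sum => a _; apply: in_uidealZ; apply: in_uideal_sum => b _.
    by apply: in_uidealZ; apply: urel_word_basis.
  move=> w; rewrite /urel_word.
  transitivity (\sum_a \sum_b x 0 a * y 0 b * tprod (S w1 ++ sbas K a :: sbas K b :: S w2) w -
    \sum_a \sum_b x 0 a * y 0 b * tprod (S w1 ++ sbas K b :: sbas K a :: S w2) w -
    \sum_a \sum_b x 0 a * y 0 b * tprod (S w1 ++ br (sbas K a) (sbas K b) :: S w2) w).
    rewrite -!sumrB; apply: eq_bigr => a _; rewrite -!sumrB mulr_sumr.
    by apply: eq_bigr => b _; ring.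
  congr (_ - _ - _).
  - rewrite tprod_basis; apply: eq_bigr => a _; rewrite -cat_rcons tprod_basis mulr_sumr.
    by apply: eq_bigr => b _; rewrite mulrA cat_rcons.
  - rewrite -cat_rcons tprod_basis; apply: eq_bigr => a _; rewrite cat_rcons tprod_basis mulr_sumr.
    by apply: eq_bigr => b _; rewrite mulrA.
  - rewrite {2}[x]row_sum_delta br_suml tprod_sum; apply: eq_bigr => a _.
    rewrite brZl tprodZ {2}[y]row_sum_delta br_sumr tprod_sum mulr_sumr.
    by apply: eq_bigr => b _; rewrite brZr tprodZ mulrA.
(* [S w2] collects the letters of the right context that are already expanded; each induction step
   expands one more. *)
have step2 w1 w2 : in_uideal br (urel_word (S w1) x y (S w2 ++ r)).
  elim: r w2 => [|z r' IH] w2; first by rewrite cats0.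
  apply: (@in_uideal_ext (fun w => \sum_a z 0 a *
     urel_word (S w1) x y (S (rcons w2 a) ++ r') w)); last first.
    by apply: in_uideal_sum => a _; apply: in_uidealZ.
  move=> w; rewrite /urel_word.
  have e m : tprod (S w1 ++ m ++ S w2 ++ z :: r') w =
      \sum_a z 0 a * tprod (S w1 ++ m ++ S (rcons w2 a) ++ r') w.
    rewrite !catA tprod_basis; apply: eq_bigr => a _.
    by rewrite /S map_rcons -!catA cat_rcons.
  have /= -> := e [:: x; y]; have /= -> := e [:: y; x]; have /= -> := e [:: br x y].
  by rewrite -!sumrB; apply: eq_bigr => a _; rewrite !mulrBr.
suff step3 w1 : in_uideal br (urel_word (S w1 ++ l) x y r) by exact: (step3 [::]).
elim: l w1 => [|z l' IH] w1; first by rewrite cats0; apply: (step2 w1 [::]).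
apply: (@in_uideal_ext (fun w => \sum_a z 0 a *
   urel_word (S (rcons w1 a) ++ l') x y r w)); last first.
  by apply: in_uideal_sum => a _; apply: in_uidealZ.
move=> w; rewrite /urel_word -!catA !cat_cons !(tprod_basis _ z) -!sumrB.
by apply: eq_bigr => a _; rewrite /S map_rcons -!cats1 -!catA /= !mulrBr.
Qed.

Lemma tprod_swap l x y r :
  tcong (tprod (l ++ x :: y :: r))
        (fun w => tprod (l ++ y :: x :: r) w + tprod (l ++ br x y :: r) w).
Proof. by apply: in_uideal_ext (urel_word_in_uideal l x y r) => w; rewrite opprD addrA. Qed.
End Ideal.

(** * Casimir identities *)

Section Casimir.
Variables (K : fieldType) (n : nat) (br : 'rV[K]_n -> 'rV[K]_n -> 'rV[K]_n).
Variables (lam : K) (E Ed : 'M[K]_n).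
Hypothesis lieP : lie_axioms br.
Hypothesis E_unit : E \in unitmx.
Hypothesis dualP :
  forall a b : 'I_n, lam * killing br (row a E) (row b Ed) = (a == b)%:R.
Hypothesis lam_neq0 : lam != 0.
Hypothesis two_neq0 : (2 : K) != 0.
Implicit Types (x y z v : 'rV[K]_n) (l r : seq 'rV[K]_n) (w : seq 'I_n).

Let form x y : K := lam * killing br x y.
Let e a : 'rV[K]_n := row a E.
Let f a : 'rV[K]_n := row a Ed.

Definition lin (phi : 'rV[K]_n -> K) :=
  forall (a : K) x y, phi (a *: x + y) = a * phi x + phi y.
Definition bilin (B : 'rV[K]_n -> 'rV[K]_n -> K) :=
  (forall y, lin (B^~ y)) /\ (forall x, lin (B x)).

Lemma lin0 phi : lin phi -> phi 0 = 0.
Proof. by move=> Hl; have := Hl (-1) 0 0; rewrite scaler0 addr0 mulN1r addNr. Qed.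

Lemma linZ phi (a : K) x : lin phi -> phi (a *: x) = a * phi x.
Proof. by move=> Hl; have := Hl a x 0; rewrite !addr0 (lin0 Hl) addr0. Qed.

Lemma linN phi x : lin phi -> phi (- x) = - phi x.
Proof. by move=> Hl; rewrite -scaleN1r linZ // mulN1r. Qed.

Lemma linD phi x y : lin phi -> phi (x + y) = phi x + phi y.
Proof. by move=> Hl; have := Hl 1 x y; rewrite scale1r mul1r. Qed.

Lemma lin_sum (phi : 'rV[K]_n -> K) (c : 'I_n -> K) (F : 'I_n -> 'rV[K]_n) :
  lin phi -> phi (\sum_a c a *: F a) = \sum_a c a * phi (F a).
Proof.
move=> Hl; rewrite (big_morph phi (fun x y => linD x y Hl) (lin0 Hl)).
by apply: eq_bigr => a _; rewrite linZ.
Qed.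

Lemma mul_ad_mx x v : v *m ad_mx br x = br x v.
Proof.
rewrite [in RHS](row_sum_delta v) (br_sumr lieP) mulmx_sum_row.
apply: eq_bigr => i _; rewrite (brZr lieP); congr (_ *: _).
by apply/rowP => k; rewrite !mxE.
Qed.

Lemma row_mulmx_inj (A B : 'M[K]_n) : (forall v : 'rV[K]_n, v *m A = v *m B) -> A = B.
Proof. by move=> H; apply/row_matrixP => i; rewrite !rowE H. Qed.

Lemma ad_mxD (a : K) x y : ad_mx br (a *: x + y) = a *: ad_mx br x + ad_mx br y.
Proof.
apply: row_mulmx_inj => v.
by rewrite mulmxDr -scalemxAr !mul_ad_mx (brDl lieP) (brZl lieP).
Qed.

(** Matrices act on row vectors from the right, so the composite ad x after ad y is the product
    [ad_mx br y *m ad_mx br x]; this reverses the commutator. *)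
Lemma ad_mx_br x y :
  ad_mx br (br x y) = ad_mx br y *m ad_mx br x - ad_mx br x *m ad_mx br y.
Proof.
apply: row_mulmx_inj => v.
by rewrite mulmxBr !mulmxA !mul_ad_mx (br_jacobi lieP).
Qed.

Lemma formC x y : form x y = form y x.
Proof. by rewrite /form /killing mxtrace_mulC. Qed.

Lemma form_linl y : lin (form^~ y).
Proof.
move=> a x z; rewrite /form /killing ad_mxD mulmxDl -scalemxAl mxtraceD mxtraceZ.
by rewrite mulrDr mulrCA.
Qed.

Lemma form_linr x : lin (form x).
Proof. by move=> a y z; rewrite !(formC x) form_linl. Qed.

(** Invariance of the Killing form: expand both brackets as commutators and use cyclicity of the
    trace. *)
Lemma form_br x y z : form (br x y) z = form x (br y z).
Proof.
rewrite /form /killing !ad_mx_br mulmxBl mulmxBr !raddfB /=; congr (_ * (_ - _)).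
  by rewrite -mulmxA mxtrace_mulC -mulmxA.
by rewrite mulmxA.
Qed.

(** By [dualP], pairing with [f a] reads off the coordinate along [e a]. Completeness of the dual
    bases and nondegeneracy of the form follow from this. *)
Lemma form_coord v a : form v (f a) = (v *m invmx E) 0 a.
Proof.
rewrite -{1}[v](mulmxKV E_unit) mulmx_sum_row (lin_sum _ _ (form_linl _)).
rewrite (bigD1 a) //= big1 => [|b nba]; first by rewrite /form dualP eqxx mulr1 addr0.
by rewrite /form dualP (negPf nba) mulr0.
Qed.

Lemma form_sum_e v : \sum_a form v (f a) *: e a = v.
Proof.
rewrite -[RHS](mulmxKV E_unit) mulmx_sum_row.
by apply: eq_bigr => a _; rewrite form_coord.
Qed.

Lemma form_nondeg v v' : (forall z, form v z = form v' z) -> v = v'.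
Proof.
by move=> H; rewrite -(form_sum_e v) -(form_sum_e v'); apply: eq_bigr => a _; rewrite H.
Qed.

Lemma form_sum_f v : \sum_a form v (e a) *: f a = v.
Proof.
apply: form_nondeg => z; rewrite (lin_sum _ _ (form_linl _)).
rewrite formC -[z in RHS]form_sum_e (lin_sum _ _ (form_linl _)).
by apply: eq_bigr => a _; rewrite mulrC (formC (f a)) (formC v).
Qed.

Lemma contract_e phi v : lin phi -> \sum_a form v (f a) * phi (e a) = phi v.
Proof. by move=> Hl; rewrite -(lin_sum _ _ Hl) form_sum_e. Qed.

Lemma contract_f phi v : lin phi -> \sum_a form v (e a) * phi (f a) = phi v.
Proof. by move=> Hl; rewrite -(lin_sum _ _ Hl) form_sum_f. Qed.

(** The canonical tensor, the sum of [e a] tensor [f a], is symmetric because its coefficients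
    [form (e a) (e b)] over the [f]'s are. Bilinear maps stand in for the tensor product
    throughout. *)
Lemma casimir_sym B : bilin B -> \sum_a B (e a) (f a) = \sum_a B (f a) (e a).
Proof.
case=> Bl Br.
transitivity (\sum_a \sum_b form (e a) (e b) * B (f b) (f a)).
  by apply: eq_bigr => a _; rewrite (contract_f _ (Bl _)).
rewrite exchange_big /=; apply: eq_bigr => b _.
rewrite -[in RHS](contract_f (e b) (Br _)).
by apply: eq_bigr => a _; rewrite formC.
Qed.

(** Invariance of the canonical tensor under ad x. Expanded in the bases, the coefficient
    [form (br x (e a)) (f b)] is minus the one of [br x (f b)] along [f a], by invariance of the
    form. *)
Lemma casimir_inv B x : bilin B ->
  \sum_a B (br x (e a)) (f a) = - \sum_a B (e a) (br x (f a)).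
Proof.
case=> Bl Br; rewrite -sumrN.
transitivity (\sum_a \sum_b form (br x (e a)) (f b) * B (e b) (f a)).
  by apply: eq_bigr => a _; rewrite (contract_e _ (Bl _)).
rewrite exchange_big /=; apply: eq_bigr => b _.
rewrite -(contract_f (br x (f b)) (Br _)) -sumrN.
apply: eq_bigr => a _; rewrite -mulNr; congr (_ * _).
by rewrite !form_br (brC lieP (e a)) (linN _ (form_linr _)).
Qed.

(** The diagonal entries of [A] in the basis [E] are the pairings of [e a *m A] with the dual
    vectors. *)
Lemma trace_form (A : 'M[K]_n) : \sum_a form (e a *m A) (f a) = \tr A.
Proof.
have -> : \tr A = \tr (E *m A *m invmx E) by rewrite mxtrace_mulC mulmxA mulVmx // mul1mx.
rewrite /mxtrace; apply: eq_bigr => a _.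
by rewrite form_coord /e -!row_mul [LHS]mxE.
Qed.

(** Paired with [y], the left side becomes the trace of the product of ad x and ad y, that is the
    Killing form, which is [lam^-1] times the chosen form. This is the origin of the constant in the
    theorem. *)
Lemma casimir_ad x : \sum_a br (f a) (br (e a) x) = lam^-1 *: x.
Proof.
apply: form_nondeg => y.
have -> : \sum_a br (f a) (br (e a) x) = \sum_a 1 *: br (f a) (br (e a) x).
  by apply: eq_bigr => a _; rewrite scale1r.
rewrite (lin_sum _ _ (form_linl _)) (linZ _ _ (form_linl _)).
rewrite {2}/form mulKf // /killing -trace_form.
apply: eq_bigr => a _; rewrite mul1r form_br formC mulmxA !mul_ad_mx.
by rewrite (brC lieP _ y) (brC lieP _ x) (brNr lieP) opprK.
Qed.

Lemma tprod_bilin l r w : bilin (fun x y => tprod (l ++ x :: y :: r) w).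
Proof.
split=> [y|x] a z z'; first by rewrite tprodD.
by have := tprodD a (rcons l x) z z' r w; rewrite !cat_rcons.
Qed.

(** Let A' be the sum with the two factors interchanged. Invariance and symmetry of the canonical
    tensor give A = - A' as tensors, while commuting the factors in the enveloping algebra gives A =
    A' - x / lam by [casimir_ad]. Averaging the two yields half the Casimir eigenvalue. *)
Lemma tprod_leg_casimir l x r :
  tcong br (fun w => \sum_a tprod (l ++ br (e a) x :: f a :: r) w)
           (fun w => - (2 * lam)^-1 * tprod (l ++ x :: r) w).
Proof.
set A := (fun w => \sum_a _).
pose A' w := \sum_a tprod (l ++ f a :: br (e a) x :: r) w.
have eA : A =1 (fun w => - A' w).
  move=> w; have [Bl Br] := tprod_bilin l r w.
  transitivity (- \sum_a tprod (l ++ br x (e a) :: f a :: r) w).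
    by rewrite -sumrN; apply: eq_bigr => a _; rewrite (brC lieP) tprodN.
  rewrite (casimir_inv x (tprod_bilin l r w)) opprK /A'.
  have bB : bilin (fun y z => tprod (l ++ y :: br x z :: r) w).
    split=> [z|y] a u u' /=; first exact: Bl.
    by rewrite (brDr lieP) (brZr lieP) Br.
  rewrite (casimir_sym bB) -sumrN; apply: eq_bigr => a _.
  by rewrite (brC lieP); have := tprodN (rcons l (f a)) (br (e a) x) r w; rewrite !cat_rcons.
have cA : tcong br A (fun w => A' w + - lam^-1 * tprod (l ++ x :: r) w).
  apply: tcong_trans (tcong_sum _ (fun a _ => tprod_swap lieP l _ _ r)) _.
  apply: tcong_eq => w; rewrite big_split /=; congr (_ + _).
  rewrite -tprod_sum (eq_bigr (fun a => - br (f a) (br (e a) x))); last first.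
    by move=> a _; rewrite (brC lieP).
  by rewrite sumrN casimir_ad tprodN tprodZ mulNr.
(* One copy of [A] is rewritten by the congruence and the other by the exact equality, so [A']
   cancels. *)
have {}cA : tcong br (fun w => 2^-1 * (A w + A w))
    (fun w => 2^-1 * (A' w + - lam^-1 * tprod (l ++ x :: r) w + - A' w)).
  by apply: tcongZ; apply: tcongD cA _; apply: tcong_eq.
apply: tcong_trans (tcong_trans cA _); apply: tcong_eq => w.
  by apply: (mulfI two_neq0); rewrite mulVKf //; ring.
by rewrite addrAC subrr add0r invfM; ring.
Qed.

(** Moving [x] past both ends of the chord produces two bracket terms, which cancel by invariance of
    the canonical tensor. This is the centrality of the Casimir element. *)
Lemma tprod_chord_swap l x r :
  tcong br (fun w => \sum_a tprod (l ++ x :: e a :: f a :: r) w)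
           (fun w => \sum_a tprod (l ++ e a :: f a :: x :: r) w).
Proof.
have step1 := tcong_sum (index_enum 'I_n) (P := xpredT)
  (fun a _ => tprod_swap lieP l x (e a) (f a :: r)).
have step2 := tcong_sum (index_enum 'I_n) (P := xpredT)
  (fun a _ => tprod_swap lieP (rcons l (e a)) x (f a) r).
apply: tcong_trans step1 _.
have {}step2 := tcongD step2 (tcong_refl br (fun w => \sum_a tprod (l ++ br x (e a) :: f a :: r) w)).
apply: tcong_trans (tcong_trans _ step2) _; apply: tcong_eq => w.
  by rewrite big_split; congr (_ + _); apply: eq_bigr => a _; rewrite cat_rcons.
rewrite (casimir_inv x (tprod_bilin l r w)) big_split /= -addrA.
rewrite [X in _ + X](_ : _ = 0).
  by rewrite addr0; apply: eq_bigr => a _; rewrite cat_rcons.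
rewrite (eq_bigr (fun a => tprod (l ++ e a :: br x (f a) :: r) w)) ?subrr // => a _.
by rewrite cat_rcons.
Qed.

Lemma tprod_chord_central l m r :
  tcong br (fun w => \sum_a tprod (l ++ m ++ e a :: f a :: r) w)
           (fun w => \sum_a tprod (l ++ e a :: f a :: m ++ r) w).
Proof.
elim: m l => [|x m IH] l; first exact: tcong_refl.
apply: tcong_trans (tcong_trans _ (IH (rcons l x))) _.
  by apply: tcong_eq => w; apply: eq_bigr => a _; rewrite cat_rcons.
apply: tcong_trans (tcong_trans _ (tprod_chord_swap l x (m ++ r))) _; last exact: tcong_refl.
by apply: tcong_eq => w; apply: eq_bigr => a _; rewrite cat_rcons.
Qed.
End Casimir.

(** * Ladders crossed by chords *)

Section Ladders.
Variables (K : fieldType) (n : nat) (br : 'rV[K]_n -> 'rV[K]_n -> 'rV[K]_n).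
Variables (lam : K) (E Ed : 'M[K]_n).
Implicit Types (x y z v : 'rV[K]_n) (l r : seq 'rV[K]_n) (w : seq 'I_n).
Implicit Types (g h : seq 'I_n).

Let e a : 'rV[K]_n := row a E.
Let f a : 'rV[K]_n := row a Ed.

(** Sums over label words are taken by recursion on the length, so that the label of a single chord
    can be split off and summed separately. *)
Fixpoint sumseq (k : nat) (G : seq 'I_n -> K) : K :=
  if k is k'.+1 then \sum_c sumseq k' (fun g => G (c :: g)) else G [::].

Lemma eq_sumseq k G G' : (forall g, size g = k -> G g = G' g) -> sumseq k G = sumseq k G'.
Proof.
elim: k G G' => [|k IH] G G' H /=; first exact: H.
by apply: eq_bigr => c _; apply: IH => g sg; apply: H; rewrite /= sg.
Qed.

Lemma sumseqD k G G' (a : K) :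
  sumseq k (fun g => a * G g + G' g) = a * sumseq k G + sumseq k G'.
Proof.
elim: k G G' => [|k IH] G G' //=; rewrite mulr_sumr -big_split /=.
by apply: eq_bigr => c _; rewrite -IH.
Qed.

Lemma sumseq_sum k (G : 'I_n -> seq 'I_n -> K) :
  sumseq k (fun g => \sum_c G c g) = \sum_c sumseq k (G c).
Proof.
elim: k G => [|k IH] G //=; rewrite exchange_big /=.
by apply: eq_bigr => c _; rewrite IH.
Qed.

Lemma sumseq_cat k k' G :
  sumseq (k + k') G = sumseq k (fun g => sumseq k' (fun h => G (g ++ h))).
Proof.
elim: k G => [|k IH] G //=.
by apply: eq_bigr => c _; rewrite IH.
Qed.

Lemma lin_ext phi psi : (phi : 'rV[K]_n -> K) =1 psi -> lin phi -> lin psi.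
Proof. by move=> H Hl a x y; rewrite -!H. Qed.

Lemma lin_sumseq k (G : 'rV[K]_n -> seq 'I_n -> K) :
  (forall g, lin (G^~ g)) -> lin (fun x => sumseq k (G x)).
Proof.
by move=> H a x y; rewrite -sumseqD; apply: eq_sumseq => g _; apply: H.
Qed.

Lemma lin_bigsum (I : finType) (G : I -> 'rV[K]_n -> K) :
  (forall i, lin (G i)) -> lin (fun x => \sum_i G i x).
Proof.
by move=> H a x y; rewrite mulr_sumr -big_split; apply: eq_bigr => i _; apply: H.
Qed.

Lemma lin_tprod l r w : lin (fun x => tprod (l ++ x :: r) w).
Proof. by move=> a x y; apply: tprodD. Qed.

(* [k] rungs inserted between two rails carrying [x] and [y], starting from the
   legs p2, p3 and ending at the legs p1, p4. *)
Fixpoint ladder (k : nat) x y (F : 'rV[K]_n -> 'rV[K]_n -> K) : K :=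
  if k is k'.+1 then \sum_c ladder k' (br x (e c)) (br (f c) y) F else F x y.

(** The labels [a] and [b] belong to the edges at p2 and p3: their ends [e a], [e b] start the two
    rails and their ends [f a], [f b] lie on the loop. The arguments of [F] are the vectors at p1,
    p2, p3, p4. For [i = 0] the rails are the chords p1p2 and p3p4. *)
Definition ladder4 (i : nat) (F : 'rV[K]_n -> 'rV[K]_n -> 'rV[K]_n -> 'rV[K]_n -> K) : K :=
  \sum_a \sum_b ladder i (e a) (e b) (fun x y => F x (f a) (f b) y).

Lemma eq_ladder k x y F G : (forall x y, F x y = G x y) -> ladder k x y F = ladder k x y G.
Proof.
by move=> H; elim: k x y => [|k IH] x y //=; apply: eq_bigr => c _; apply: IH.
Qed.

Lemma ladderD k x y F G (a : K) :
  ladder k x y (fun x y => a * F x y + G x y) = a * ladder k x y F + ladder k x y G.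
Proof.
elim: k x y => [|k IH] x y //=; rewrite mulr_sumr -big_split /=.
by apply: eq_bigr => c _; rewrite IH.
Qed.

Lemma ladder_sum k x y (F : 'I_n -> 'rV[K]_n -> 'rV[K]_n -> K) :
  ladder k x y (fun x y => \sum_c F c x y) = \sum_c ladder k x y (F c).
Proof.
elim: k x y => [|k IH] x y //=; rewrite exchange_big /=.
by apply: eq_bigr => c _; rewrite IH.
Qed.

Lemma eq_ladder4 i F G :
  (forall x y z v, F x y z v = G x y z v) -> ladder4 i F = ladder4 i G.
Proof. by move=> H; do 2!apply: eq_bigr => ? _; apply: eq_ladder => x y; apply: H. Qed.

Lemma ladder4D i F G (a : K) :
  ladder4 i (fun x y z v => a * F x y z v + G x y z v) = a * ladder4 i F + ladder4 i G.
Proof.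
rewrite /ladder4 mulr_sumr -big_split; apply: eq_bigr => b _.
by rewrite mulr_sumr -big_split; apply: eq_bigr => c _; rewrite ladderD.
Qed.

Definition quadrilin (F : 'rV[K]_n -> 'rV[K]_n -> 'rV[K]_n -> 'rV[K]_n -> K) :=
  [/\ (forall y z v, lin (fun x => F x y z v)), (forall x z v, lin (fun y => F x y z v)),
      (forall x y v, lin (fun z => F x y z v)) & (forall x y z, lin (fun v => F x y z v))].

Definition chords h : seq 'rV[K]_n := flatten [seq [:: e c; f c] | c <- h].

(** The head of [g] labels the innermost chord, next to [x2] and [x3], so that the recursion acts on
    the head; hence the [rev] on the arc from p1 to p2. The pairs labelled by [h] are chords already
    isolated, i.e. a power of C. *)
Definition ladder_word h g x1 x2 x3 x4 : seq 'rV[K]_n :=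
  chords h ++ x1 :: map e (rev g) ++ x2 :: x3 :: map f g ++ [:: x4].

(* The ladder with [i] rungs, crossed by [s] parallel chords, times the [t]-th
   power of the one-chord diagram. *)
Definition ladder_val (i s t : nat) : tens K n := fun w =>
  ladder4 i (fun x1 x2 x3 x4 =>
    sumseq t (fun h => sumseq s (fun g => tprod (ladder_word h g x1 x2 x3 x4) w))).

Lemma ladder_val_quadrilin s t w : quadrilin (fun x1 x2 x3 x4 =>
    sumseq t (fun h => sumseq s (fun g => tprod (ladder_word h g x1 x2 x3 x4) w))).
Proof.
split=> x y z; apply: lin_sumseq => h; apply: lin_sumseq => g; rewrite /ladder_word.
- exact: lin_tprod.
- apply: lin_ext (lin_tprod (chords h ++ x :: map e (rev g)) _ w) => u.
  by rewrite -catA /=.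
- apply: lin_ext (lin_tprod (chords h ++ x :: map e (rev g) ++ [:: y]) _ w) => u.
  by rewrite -catA /= -catA.
apply: lin_ext (lin_tprod (chords h ++ x :: map e (rev g) ++ y :: z :: map f g) _ w) => u.
by rewrite -catA /= -catA.
Qed.

Lemma in_uideal_sumseq k (A : seq 'I_n -> tens K n) :
  (forall g, in_uideal br (A g)) -> in_uideal br (fun w => sumseq k (fun g => A g w)).
Proof.
elim: k A => [|k IH] A H //=; apply: in_uideal_sum => c _.
exact: (IH (fun g => A (c :: g))).
Qed.

Lemma tcong_sumseq k (A B : seq 'I_n -> tens K n) :
  (forall g, tcong br (A g) (B g)) ->
  tcong br (fun w => sumseq k (fun g => A g w)) (fun w => sumseq k (fun g => B g w)).
Proof.
move/(in_uideal_sumseq k); apply: in_uideal_ext => w.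
have := sumseqD k (fun g => B g w) (fun g => A g w) (-1); rewrite mulN1r addrC => <-.
by apply: eq_sumseq => g _; rewrite mulN1r addrC.
Qed.

Lemma in_uideal_ladder k x y (A : 'rV[K]_n -> 'rV[K]_n -> tens K n) :
  (forall x y, in_uideal br (A x y)) ->
  in_uideal br (fun w => ladder k x y (fun x y => A x y w)).
Proof.
move=> H; elim: k x y => [|k IH] x y //=; apply: in_uideal_sum => c _.
exact: IH.
Qed.

Lemma tcong_ladder4 i (A B : 'rV[K]_n -> 'rV[K]_n -> 'rV[K]_n -> 'rV[K]_n -> tens K n) :
  (forall x y z v, tcong br (A x y z v) (B x y z v)) ->
  tcong br (fun w => ladder4 i (fun x y z v => A x y z v w))
           (fun w => ladder4 i (fun x y z v => B x y z v w)).
Proof.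
move=> H.
have : in_uideal br (fun w => \sum_a \sum_b ladder i (e a) (e b)
    (fun x y => A x (f a) (f b) y w - B x (f a) (f b) y w)).
  by do 2!apply: in_uideal_sum => ? _; apply: in_uideal_ladder => x y; apply: H.
apply: in_uideal_ext => w.
have := ladder4D i (fun x y z v => B x y z v w) (fun x y z v => A x y z v w) (-1).
rewrite mulN1r addrC => <-.
apply: (@eq_ladder4 i (fun x y z v => A x y z v w - B x y z v w)) => x y z v.
by rewrite mulN1r addrC.
Qed.

Hypothesis lieP : lie_axioms br.
Hypothesis E_unit : E \in unitmx.
Hypothesis dualP :
  forall a b : 'I_n, lam * killing br (row a E) (row b Ed) = (a == b)%:R.
Hypothesis lam_neq0 : lam != 0.
Hypothesis two_neq0 : (2 : K) != 0.

Lemma ladder_bilin k F : bilin F -> bilin (fun x y => ladder k x y F).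
Proof.
case=> Fl Fr; elim: k => [|k [IHl IHr]] //=; split=> [y|x]; apply: lin_bigsum => c a z z'.
  by rewrite (brDl lieP) (brZl lieP) IHl.
by rewrite (brDr lieP) (brZr lieP) IHr.
Qed.

(** The rung nearest to p2 and p3 is pushed from the rails to the loop ends of these two legs. It
    then has the shape of the doubly bracketed term produced by commuting a chord past both legs. *)
Lemma ladder4S i F : quadrilin F ->
  ladder4 i.+1 F =
  ladder4 i (fun x1 x2 x3 x4 => \sum_c F x1 (br (e c) x2) (br x3 (f c)) x4).
Proof.
case=> F1 F2 F3 F4; rewrite /ladder4 /=.
have bF y z : bilin (fun x v => F x y z v) by split=> *; [apply: F1 | apply: F4].
transitivity (\sum_c \sum_a \sum_b ladder i (br (e a) (e c)) (br (f c) (e b))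
    (fun x y => F x (f a) (f b) y)).
  rewrite [RHS]exchange_big; apply: eq_bigr => a _.
  by rewrite [RHS]exchange_big; apply: eq_bigr.
transitivity (\sum_c \sum_a \sum_b ladder i (e a) (e b)
    (fun x y => F x (br (e c) (f a)) (br (f b) (f c)) y)); last first.
  rewrite [LHS]exchange_big; apply: eq_bigr => a _.
  by rewrite [LHS]exchange_big; apply: eq_bigr => b _; rewrite ladder_sum.
apply: eq_bigr => c _.
pose B u v := \sum_b ladder i u (br (f c) (e b)) (fun x y => F x v (f b) y).
have bB : bilin B.
  split=> [v|u]; apply: lin_bigsum => b.
    by case: (ladder_bilin i (bF v (f b))) => H _ a z z'; apply: H.
  move=> a z z'; rewrite -ladderD; apply: eq_ladder => x y; exact: F2.
transitivity (\sum_a B (e a) (br (e c) (f a))).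
  apply: oppr_inj; rewrite -(casimir_inv lieP E_unit dualP _ bB) -sumrN.
  case: bB => Bl _; apply: eq_bigr => a _.
  by rewrite (brC lieP (row c E)) (linN _ (Bl _)).
apply: eq_bigr => a _; rewrite /B.
pose B' u v := ladder i (e a) u (fun x y => F x (br (e c) (f a)) v y).
have bB' : bilin B'.
  split=> [v|u] b z z'; rewrite /B'.
    by case: (ladder_bilin i (bF (br (e c) (f a)) v)) => _ H; apply: H.
  by rewrite -ladderD; apply: eq_ladder => x y; apply: F3.
have := casimir_inv lieP E_unit dualP (f c) bB'; rewrite /B' => ->.
rewrite -sumrN; case: bB' => _ Br'.
by apply: eq_bigr => b _; rewrite -[LHS](linN _ (Br' _)) /B' -(brC lieP).
Qed.

(** Commuting [e c] past [y] leaves a chord with adjacent ends, which is central and moves to the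
    front, and a bracket term evaluated by [tprod_leg_casimir]. *)
Lemma tprod_chord_cross l y r :
  tcong br (fun w => \sum_c tprod (l ++ e c :: y :: f c :: r) w)
    (fun w => \sum_c tprod (e c :: f c :: l ++ y :: r) w + - (2 * lam)^-1 * tprod (l ++ y :: r) w).
Proof.
apply: tcong_trans (tcong_sum _ (fun c _ => tprod_swap lieP l (e c) y (f c :: r))) _.
apply: tcong_trans; first by apply: tcong_eq => w; rewrite big_split; reflexivity.
apply: tcongD; last exact: (tprod_leg_casimir lieP E_unit dualP).
have := tprod_chord_central lieP E_unit dualP [::] (rcons l y) r.
by apply: tcong_ext => w; apply: eq_bigr => c _; rewrite cat_rcons.
Qed.

(** The first end is commuted past [y]. In the bracket term ([H1]) the second end is commuted past
    [z]; the remaining term ([H2]) has a chord around [z] only. Each of them yields one Casimir term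
    [- (2 * lam)^-1], and together they give [- lam^-1]. *)
Lemma tprod_chord_cross2 l y z r :
  tcong br (fun w => \sum_c tprod (l ++ e c :: y :: z :: f c :: r) w)
    (fun w => \sum_c tprod (l ++ br (e c) y :: br z (f c) :: r) w
       + (- lam^-1 * tprod (l ++ y :: z :: r) w + \sum_c tprod (e c :: f c :: l ++ y :: z :: r) w)).
Proof.
apply: tcong_trans (tcong_sum _ (fun c _ => tprod_swap lieP l (e c) y (z :: f c :: r))) _.
have H1 : tcong br (fun w => \sum_c tprod (l ++ br (e c) y :: z :: f c :: r) w)
   (fun w => - (2 * lam)^-1 * tprod (l ++ y :: z :: r) w +
     \sum_c tprod (l ++ br (e c) y :: br z (f c) :: r) w).
  have := tcong_sum (index_enum 'I_n) (P := xpredT)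
    (fun c _ => tprod_swap lieP (rcons l (br (e c) y)) z (f c) r).
  move=> H; apply: tcong_trans (tcong_trans _ H) _.
    by apply: tcong_eq => w; apply: eq_bigr => c _; rewrite cat_rcons.
  have H' := tcongD (tprod_leg_casimir lieP E_unit dualP lam_neq0 two_neq0 l y (z :: r))
    (tcong_refl br (fun w => \sum_c tprod (l ++ br (e c) y :: br z (f c) :: r) w)).
  apply: tcong_trans H'; apply: tcong_eq => w; rewrite big_split.
  by congr (_ + _); apply: eq_bigr => c _; rewrite cat_rcons.
have H2 : tcong br (fun w => \sum_c tprod (l ++ y :: e c :: z :: f c :: r) w)
   (fun w => \sum_c tprod (e c :: f c :: l ++ y :: z :: r) w +
             - (2 * lam)^-1 * tprod (l ++ y :: z :: r) w).
  have := tprod_chord_cross (rcons l y) z r => H; apply: tcong_trans (tcong_trans _ H) _.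
    by apply: tcong_eq => w; apply: eq_bigr => c _; rewrite cat_rcons.
  apply: tcong_eq => w; congr (_ + _ * _); last by rewrite cat_rcons.
  by apply: eq_bigr => c _; rewrite cat_rcons.
apply: tcong_trans; first by apply: tcong_eq => w; rewrite big_split; reflexivity.
apply: tcong_trans (tcongD H2 H1) _; apply: tcong_eq => w.
have -> : lam^-1 = (2 * lam)^-1 * 2 by rewrite invfM mulrAC mulVf // mul1r.
by set a := (2 * lam)^-1; ring.
Qed.

(** [tprod_chord_cross2] is applied to the innermost chord, labelled by the head of the word of
    length [s.+1]. The doubly bracketed terms are reassembled into a longer ladder by [ladder4S]. *)
Lemma ladder_val_recursion i s t :
  tcong br (ladder_val i s.+1 t)
    (fun w => ladder_val i.+1 s t w + (- lam^-1 * ladder_val i s t w + ladder_val i s t.+1 w)).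
Proof.
pose W h g x1 x2 x3 x4 w := tprod (ladder_word h g x1 x2 x3 x4) w.
pose A h g x1 x2 x3 x4 w := \sum_c tprod (ladder_word h (c :: g) x1 x2 x3 x4) w.
pose B h g x1 x2 x3 x4 w :=
  \sum_c tprod (ladder_word h g x1 (br (e c) x2) (br x3 (f c)) x4) w.
pose C h g x1 x2 x3 x4 w := \sum_c tprod (ladder_word (c :: h) g x1 x2 x3 x4) w.
have H h g x1 x2 x3 x4 : tcong br (A h g x1 x2 x3 x4)
   (fun w => 1 * B h g x1 x2 x3 x4 w +
             (- lam^-1 * W h g x1 x2 x3 x4 w + C h g x1 x2 x3 x4 w)).
  have := tprod_chord_cross2 (chords h ++ x1 :: map e (rev g)) x2 x3 (map f g ++ [:: x4]).
  move=> H; apply: tcong_trans (tcong_trans _ H) _; apply: tcong_eq => w.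
    by apply: eq_bigr => c _; rewrite /ladder_word rev_cons map_rcons -cats1 -!catA.
  by rewrite mul1r /B /W /C /ladder_word; congr (_ + (_ * _ + _)); do ?apply: eq_bigr => c _;
     rewrite -?catA.
have {}H := tcong_ladder4 i (fun x1 x2 x3 x4 => tcong_sumseq t (fun h =>
   tcong_sumseq s (fun g => H h g x1 x2 x3 x4))).
apply: tcong_trans (tcong_trans _ H) _; apply: tcong_eq => w.
  rewrite /ladder_val; apply: eq_ladder4 => x1 x2 x3 x4; apply: eq_sumseq => h _ /=.
  by rewrite -sumseq_sum.
rewrite [ladder_val i.+1 s t w]/ladder_val (ladder4S _ (ladder_val_quadrilin s t w)).
rewrite /ladder_val -ladder4D -[X in X + _]mul1r -ladder4D.
apply: eq_ladder4 => x1 x2 x3 x4 /=.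
under eq_sumseq => h _ do rewrite !sumseqD.
rewrite !sumseqD; congr (_ * _ + (_ + _)).
  rewrite -sumseq_sum; apply: eq_sumseq => h _; exact: sumseq_sum.
rewrite -sumseq_sum; apply: eq_sumseq => h _; exact: sumseq_sum.
Qed.

(* The chords p1p2 and p3p4 in different factors and crossed by [m] chords in
   total, times the [t]-th power of the one-chord diagram. *)
Fixpoint star_val (m t : nat) : tens K n :=
  if m is m'.+1 then fun w => star_val m' t.+1 w + - (2 * lam)^-1 * star_val m' t w
  else ladder_val 0 0 t.
End Ladders.

(** * State sums of diagrams *)

Section StateSums.
Variables (K : fieldType) (n : nat) (br : 'rV[K]_n -> 'rV[K]_n -> 'rV[K]_n).
Variables (lam : K) (E Ed : 'M[K]_n).
Hypothesis lieP : lie_axioms br.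
Hypothesis E_unit : E \in unitmx.
Hypothesis dualP :
  forall a b : 'I_n, lam * killing br (row a E) (row b Ed) = (a == b)%:R.
Implicit Types (x y : 'rV[K]_n) (w : seq 'I_n) (rho : dend -> 'rV[K]_n).
Implicit Types (phi : nat -> 'rV[K]_n) (es : seq (dend * dend)).

Let form x y : K := lam * killing br x y.
Let e a : 'rV[K]_n := row a E.
Let f a : 'rV[K]_n := row a Ed.

(** Labels are added, not overwritten, as in [end_label]; therefore updates commute and the edges
    may be summed in any order. *)
Definition set_edge rho (p : dend * dend) c : dend -> 'rV[K]_n := fun z =>
  rho z + ((if p.1 == z then e c else 0) + (if p.2 == z then f c else 0)).

(* Sum of [H] over the labellings of the edges [es]; [rho] collects the labels of
   the ends met so far. *)
Fixpoint edge_sum es rho (H : (dend -> 'rV[K]_n) -> K) : K :=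
  if es is p :: es' then \sum_c edge_sum es' (set_edge rho p c) H else H rho.

Lemma sum_ffun_ordS (m : nat) (G : {ffun 'I_m.+1 -> 'I_n} -> K) :
  \sum_lab G lab = \sum_c \sum_(lab : {ffun 'I_m -> 'I_n})
     G [ffun i => oapp lab c (unlift ord0 i)].
Proof.
rewrite pair_big /=.
rewrite (reindex (fun p : 'I_n * {ffun 'I_m -> 'I_n} =>
   [ffun i => oapp p.2 p.1 (unlift ord0 i)])) //=.
exists (fun lab => (lab ord0, [ffun i => lab (lift ord0 i)])) => [[c lab]|lab] _ /=.
  congr pair; first by rewrite ffunE unlift_none.
  by apply/ffunP => i; rewrite !ffunE liftK.
by apply/ffunP => i; rewrite !ffunE; case: unliftP => [k ->|->] /=; rewrite ?ffunE.
Qed.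

Lemma edge_sum_ffun es rho H :
  \sum_(lab : {ffun 'I_(size es) -> 'I_n}) H (fun z => rho z + \sum_(q < size es)
     ((if (nth dedge0 es q).1 == z then e (lab q) else 0)
      + (if (nth dedge0 es q).2 == z then f (lab q) else 0))) = edge_sum es rho H.
Proof.
elim: es rho => [|p es IH] rho /=.
  rewrite (eq_bigr (fun _ => H rho)) => [|lab _].
    by rewrite sumr_const card_ffun !card_ord expn0.
  by congr H; apply: functional_extensionality => z; rewrite big_ord0 addr0.
rewrite sum_ffun_ordS; apply: eq_bigr => c _; rewrite -IH.
apply: eq_bigr => lab _; congr H; apply: functional_extensionality => z.
rewrite big_ord_recl /= !ffunE unlift_none /= addrA; congr (_ + _).
by apply: eq_bigr => q _; rewrite !ffunE liftK.
Qed.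

Definition vert rho (v : nat) : K :=
  form (br (rho (v, Some s0)) (rho (v, Some s1))) (rho (v, Some s2)).

Definition pts rho (p : nat) : 'rV[K]_n := rho (p, None).

(** Replaces the sum over functions, whose domain depends on the edge list of [D], by a recursion on
    that list, which can be permuted and split. *)
Lemma wsys_edge_sum D w :
  wsys br form E Ed D w = edge_sum (dedges D) (fun _ => 0) (fun rho =>
    \prod_(v <- dverts D) vert rho v * tprod [seq pts rho p | p <- dpts D] w).
Proof.
rewrite -edge_sum_ffun; apply: eq_bigr => lab _; rewrite /tprod big_map.
congr (_ * _); first by apply: eq_bigr => v _; rewrite /vert !add0r.
by congr (_ w); apply: eq_bigr => p _; rewrite /pts add0r.
Qed.

Lemma set_edgeC rho p q c d :
  set_edge (set_edge rho p c) q d = set_edge (set_edge rho q d) p c.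
Proof. by apply: functional_extensionality => z; rewrite /set_edge addrAC. Qed.

Lemma perm_edge_sum es es' rho H : perm_eq es es' -> edge_sum es rho H = edge_sum es' rho H.
Proof.
have front p s1 s2 rho' : edge_sum (s1 ++ p :: s2) rho' H = edge_sum (p :: s1 ++ s2) rho' H.
  elim: s1 rho' => [|q s1 IH] rho' //=.
  under eq_bigr do rewrite IH /=.
  rewrite exchange_big /=; apply: eq_bigr => c _; apply: eq_bigr => d _.
  by rewrite set_edgeC.
elim: es es' rho => [|p es IH] es' rho pe; first by move: pe; rewrite perm_sym => /perm_nilP ->.
have : p \in es' by rewrite -(perm_mem pe) mem_head.
move=> /path.splitPr pes; case: pes pe => s1 s2 pe; rewrite front /=.
apply: eq_bigr => c _; apply: IH.
by move: pe; rewrite perm_sym (perm_catCA s1 [:: p] s2) /= perm_cons perm_sym.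
Qed.

Lemma edge_sum_cat es es' rho H :
  edge_sum (es ++ es') rho H = edge_sum es rho (fun rho' => edge_sum es' rho' H).
Proof. by elim: es rho => [|p es IH] rho //=; apply: eq_bigr => c _. Qed.

Definition edge_has (z : dend) (p : dend * dend) := (p.1 == z) || (p.2 == z).

(** Allows factors that depend only on ends untouched by [es] to be frozen at [rho] and taken out of
    the sum. *)
Lemma eq_edge_sum es rho H H' :
  (forall rho', (forall z, ~~ has (edge_has z) es -> rho' z = rho z) -> H rho' = H' rho') ->
  edge_sum es rho H = edge_sum es rho H'.
Proof.
elim: es rho => [|p es IH] rho HH /=; first by apply: HH.
apply: eq_bigr => c _; apply: IH => rho' Hr; apply: HH => z /=.
rewrite negb_or /edge_has negb_or => /andP[/andP[n1 n2] /Hr ->].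
by rewrite /set_edge (negPf n1) (negPf n2) !addr0.
Qed.

Lemma edge_sumZ es rho (a : K) H : edge_sum es rho (fun rho => a * H rho) = a * edge_sum es rho H.
Proof.
elim: es rho => [|p es IH] rho //=; rewrite mulr_sumr.
by apply: eq_bigr => c _; rewrite IH.
Qed.

Definition add_pt phi (p : nat) x : nat -> 'rV[K]_n :=
  fun q => (if p == q then x else 0) + phi q.

Lemma add_ptC phi p q x y : add_pt (add_pt phi p x) q y = add_pt (add_pt phi q y) p x.
Proof. by apply: functional_extensionality => k; rewrite /add_pt addrCA. Qed.

(** Contracts the two outgoing rail edges at the vertices of a rung labelled [c]. Invariance brings
    each vertex factor to the form of a bracket paired with a basis vector, and the result is one
    step of [ladder]. *)
Lemma ladder_step_sum x y c G : bilin G ->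
  \sum_a \sum_b form (br (e a) x) (e c) * form (br (e b) (f c)) y * G (f a) (f b) =
  G (br x (e c)) (br (f c) y).
Proof.
case=> Gl Gr.
transitivity (\sum_a form (br x (e c)) (e a) * G (f a) (br (f c) y)); last first.
  exact: (contract_f lieP E_unit dualP (br x (e c)) (Gl (br (f c) y))).
apply: eq_bigr => a _.
rewrite -(contract_f lieP E_unit dualP (br (f c) y) (Gr (f a))) mulr_sumr.
apply: eq_bigr => b _; rewrite mulrA; congr (_ * _ * _).
  by rewrite [RHS](formC br lam) -[RHS](form_br lam lieP).
by rewrite [RHS](formC br lam) -[RHS](form_br lam lieP).
Qed.

(** * Contraction of a ladder rung by rung *)

Section Peel.
Variables (u v : nat -> nat) (p1 p4 : nat).

Definition upper_out (ms : seq nat) : dend := if ms is m :: _ then (u m, Some s1) else (p1, None).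
Definition lower_out (ms : seq nat) : dend := if ms is m :: _ then (v m, Some s2) else (p4, None).

(** The edges are grouped by rung, each rung followed by its two outgoing rail edges: after these
    three labels, every half-edge at both vertices of the rung is known. *)
Fixpoint ladder_edges (ms : seq nat) : seq (dend * dend) :=
  if ms is m :: ms' then
    [:: ((u m, Some s2), (v m, Some s1)); ((u m, Some s0), upper_out ms');
        ((v m, Some s0), lower_out ms')] ++ ladder_edges ms'
  else [::].

Lemma ladder_edges_has (k : nat) (s : 'I_3) ms :
  has (edge_has (k, Some s)) (ladder_edges ms) -> (k \in map u ms) || (k \in map v ms).
Proof.
elim: ms => //= m ms IH; rewrite /edge_has /= !xpair_eqE /= !inE.
have oU : (upper_out ms == (k, Some s)) -> k \in map u ms.
  by case: (ms) => [|m' ms'] /= /eqP; [case | case=> <- _; rewrite inE eqxx].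
have oV : (lower_out ms == (k, Some s)) -> k \in map v ms.
  by case: (ms) => [|m' ms'] /= /eqP; [case | case=> <- _; rewrite inE eqxx].
rewrite !(eq_sym k).
case/or4P => [/orP[]/andP[-> _]|/orP[/andP[-> _]|/oU ->]|/orP[/andP[-> _]|/oV ->]|/IH/orP[]->];
  by rewrite ?orbT.
Qed.

Lemma uniq_map_cons2 m ms : uniq (map u (m :: ms) ++ map v (m :: ms)) ->
  [/\ u m \notin map u ms, u m \notin map v ms,
    [/\ v m \notin map u ms, v m \notin map v ms & u m != v m]
    & uniq (map u ms ++ map v ms)].
Proof.
rewrite (map_cons u m) (map_cons v m) cat_cons cons_uniq.
rewrite mem_cat inE !negb_or => /andP[/and3P[-> -> ->]].
rewrite -(perm_uniq (permEl (perm_catCA [:: v m] (map u ms) (map v ms)))) cat1s cons_uniq.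
by rewrite mem_cat negb_or => /andP[/andP[-> ->] ->].
Qed.

(** Induction on the rungs. Slots not yet labelled must be 0 because labels are added. The factors
    of the first two vertices leave the sum, and [ladder_step_sum] passes the brackets to the
    incoming slots of the next rung or, at the end, to the loop points [p1] and [p4]. *)
Lemma ladder_edges_eval m ms rho (T : (nat -> 'rV[K]_n) -> K) :
  uniq (map u (m :: ms) ++ map v (m :: ms)) ->
  rho (u m, Some s0) = 0 -> rho (u m, Some s2) = 0 ->
  rho (v m, Some s0) = 0 -> rho (v m, Some s1) = 0 ->
  (forall m' s, m' \in ms -> rho (u m', Some s) = 0 /\ rho (v m', Some s) = 0) ->
  bilin (fun x y => T (add_pt (add_pt (pts rho) p1 x) p4 y)) ->
  edge_sum (ladder_edges (m :: ms)) rho (fun rho =>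
     \prod_(k <- m :: ms) (vert rho (u k) * vert rho (v k)) * T (pts rho)) =
  ladder br E Ed (size ms).+1 (rho (u m, Some s1)) (rho (v m, Some s2))
     (fun x y => T (add_pt (add_pt (pts rho) p1 x) p4 y)).
Proof.
elim: ms m rho => [|m' ms' IH] m rho uq z1 z2 z3 z4 zms bT.
  move: uq => /= /andP[umv _].
  have {}umv : (u m == v m) = false by move: umv; rewrite inE => /negPf.
  rewrite /=; apply: eq_bigr => c _.
  rewrite -(ladder_step_sum _ _ _ bT); apply: eq_bigr => a _; apply: eq_bigr => b _.
  rewrite big_seq1 /vert /set_edge !xpair_eqE /= !eqxx (eq_sym (v m)) umv /=.
  have nS s : (None == Some s :> option 'I_3) = false by [].
  have Sn s : (Some s == None :> option 'I_3) = false by [].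
  rewrite !nS !andbF z1 z2 z3 z4 !add0r !addr0; congr (_ * T _).
  apply: functional_extensionality => q; rewrite /pts /add_pt /= !xpair_eqE /= !Sn !andbF !andbT.
  by rewrite !addr0 !add0r [RHS]addrC; congr (_ + _); rewrite addrC.
set ms := m' :: ms' in uq zms *.
have [uU uV [vU vV umv] uq'] := uniq_map_cons2 uq.
have neqP (A : seq nat) p q : p \notin A -> q \in A -> (p == q) = false.
  by move=> pA qA; apply/negbTE; apply: contraNneq pA => ->.
set F := fun x y => T _.
have bG : bilin (fun x y => ladder br E Ed (size ms) x y F) by apply: ladder_bilin.
pose rho3 c a b := set_edge (set_edge (set_edge rho ((u m, Some s2), (v m, Some s1)) c)
   ((u m, Some s0), upper_out ms) a) ((v m, Some s0), lower_out ms) b.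
set x := rho (u m, Some s1); set y := rho (v m, Some s2).
transitivity (\sum_c \sum_a \sum_b edge_sum (ladder_edges ms) (rho3 c a b) (fun rho =>
   \prod_(k <- m :: ms) (vert rho (u k) * vert rho (v k)) * T (pts rho))); first by [].
transitivity (\sum_c ladder br E Ed (size ms) (br x (e c)) (br (f c) y) F); last by [].
apply: eq_bigr => c _.
rewrite -(ladder_step_sum _ _ _ bG); apply: eq_bigr => a _; apply: eq_bigr => b _.
have hu s : ~~ has (edge_has (u m, Some s)) (ladder_edges ms).
  by apply/negP => /ladder_edges_has; rewrite (negPf uU) (negPf uV).
have hv s : ~~ has (edge_has (v m, Some s)) (ladder_edges ms).
  by apply/negP => /ladder_edges_has; rewrite (negPf vU) (negPf vV).
(* No later edge meets [u m] or [v m], so their vertex factors already have their final value in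
   [rho3]. *)
transitivity (edge_sum (ladder_edges ms) (rho3 c a b) (fun rho =>
   (vert (rho3 c a b) (u m) * vert (rho3 c a b) (v m)) *
   (\prod_(k <- ms) (vert rho (u k) * vert rho (v k)) * T (pts rho)))).
  apply: eq_edge_sum => rho' Hr; rewrite big_cons -mulrA; congr (_ * _).
  by rewrite /vert !Hr.
have um' : u m' \in map u ms by rewrite inE eqxx.
have vm' : v m' \in map v ms by rewrite inE eqxx.
rewrite edge_sumZ; congr (_ * _ * _).
- rewrite /vert /rho3 /set_edge /= !xpair_eqE /= !eqxx (eq_sym (v m)) (negPf umv) /=.
  rewrite ![_ == u m]eq_sym (neqP _ _ _ uU um') (neqP _ _ _ uV vm') /=.
  by rewrite z1 z2 !add0r !addr0.
- rewrite /vert /rho3 /set_edge /= !xpair_eqE /= !eqxx (negPf umv) /=.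
  rewrite ![_ == v m]eq_sym (neqP _ _ _ vU um') (neqP _ _ _ vV vm') /=.
  by rewrite z3 z4 !add0r !addr0.
have r3 k s : u m != k -> v m != k -> rho3 c a b (k, Some s) =
    rho (k, Some s) + (if (u m', Some s1) == (k, Some s) then f a else 0)
                    + (if (v m', Some s2) == (k, Some s) then f b else 0).
  move=> /negPf nu /negPf nv; rewrite /rho3 /set_edge /= !(xpair_eqE (u m)) !(xpair_eqE (v m)).
  by rewrite nu nv /= !addr0 !add0r.
have p3 : pts (rho3 c a b) = pts rho.
  apply: functional_extensionality => q; rewrite /pts /rho3 /set_edge /= !xpair_eqE /=.
  have Sn s : (Some s == None :> option 'I_3) = false by [].
  by rewrite !Sn !andbF !addr0.
have um k : k \in ms -> (u m != u k) && (v m != u k).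
  move=> km; have ku : u k \in map u ms by apply: map_f.
  by rewrite (neqP _ _ _ uU ku) (neqP _ _ _ vU ku).
have vm k : k \in ms -> (u m != v k) && (v m != v k).
  move=> km; have ku : v k \in map v ms by apply: map_f.
  by rewrite (neqP _ _ _ uV ku) (neqP _ _ _ vV ku).
have m'ms : m' \in ms by rewrite inE eqxx.
have [/andP[n1 n2] /andP[n3 n4]] := (um _ m'ms, vm _ m'ms).
have u'v k : k \in ms -> (u m' == v k) = false.
  move=> km; apply/negbTE; have := uq'; rewrite cat_uniq => /and3P[_ /hasPn H _].
  have := H (v k) (map_f v km); apply: contra => /eqP <-; exact: um'.
have uv' k : k \in ms -> (v m' == u k) = false.
  move=> km; apply/negbTE; have := uq'; rewrite cat_uniq => /and3P[_ /hasPn H _].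
  have := H (v m') vm'; apply: contra => /eqP ->; exact: map_f.
have uu k : k \in ms' -> (u m' == u k) = false.
  move=> km; move: uq'; rewrite cat_uniq /= => /andP[/andP[H _] _].
  by apply: neqP H _; apply: map_f.
have vv k : k \in ms' -> (v m' == v k) = false.
  move=> km; move: uq'; rewrite cat_uniq /= => /and3P[_ _ /andP[H _]].
  by apply: neqP H _; apply: map_f.
have [zm1 zm2] : (forall s, rho (u m', Some s) = 0) /\ (forall s, rho (v m', Some s) = 0).
  by split=> s; case: (zms m' s m'ms).
rewrite (IH m' (rho3 c a b)) //.
- rewrite p3 !r3 // !xpair_eqE /= !eqxx zm1 zm2 (u'v _ m'ms) (uv' _ m'ms) /= !add0r addr0.
  by [].
- by rewrite r3 // !xpair_eqE /= zm1 (uv' _ m'ms) /= !andbF !addr0.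
- by rewrite r3 // !xpair_eqE /= zm1 (uv' _ m'ms) /= !andbF !addr0.
- by rewrite r3 // !xpair_eqE /= zm2 (u'v _ m'ms) /= !andbF !addr0.
- by rewrite r3 // !xpair_eqE /= zm2 (u'v _ m'ms) /= !andbF !addr0.
- move=> k s km; have kms : k \in ms by rewrite inE km orbT.
  have [/andP[k1 k2] /andP[k3 k4]] := (um _ kms, vm _ kms).
  have [zk1 zk2] := zms k s kms.
  by rewrite !r3 // !xpair_eqE /= zk1 zk2 (u'v _ kms) (uv' _ kms) (uu _ km) (vv _ km) /= !addr0.
by rewrite p3.
Qed.
End Peel.
End StateSums.

(** * Evaluation of diagrams with the loop points in an arbitrary order *)

Section JacobiEval.
Variables (K : fieldType) (n : nat) (br : 'rV[K]_n -> 'rV[K]_n -> 'rV[K]_n).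
Variables (lam : K) (E Ed : 'M[K]_n) (j : nat).
Implicit Types (x y : 'rV[K]_n) (w : seq 'I_n) (ks ps : seq nat).
Implicit Types (phi : nat -> 'rV[K]_n).

Let form x y : K := lam * killing br x y.
Let e a : 'rV[K]_n := row a E.
Let f a : 'rV[K]_n := row a Ed.
Let N := (2 * j + 3)%N.

Definition chord_edges ks : seq (dend * dend) := [seq ((k, None), ((N - k)%N, None)) | k <- ks].

Definition set_chord phi (k : nat) c : nat -> 'rV[K]_n := fun p =>
  phi p + ((if k == p then e c else 0) + (if (N - k)%N == p then f c else 0)).

Fixpoint chord_sum ks phi (H : (nat -> 'rV[K]_n) -> K) : K :=
  if ks is k :: ks' then \sum_c chord_sum ks' (set_chord phi k c) H else H phi.

Lemma edge_sum_chords ks (rho : dend -> 'rV[K]_n) H :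
  edge_sum E Ed (chord_edges ks) rho (fun rho => H (pts rho)) = chord_sum ks (pts rho) H.
Proof.
elim: ks rho => [|k ks IH] rho //=; apply: eq_bigr => c _; rewrite IH; congr chord_sum.
apply: functional_extensionality => p.
by rewrite /pts /set_edge /set_chord /= !xpair_eqE /= !andbT.
Qed.

Lemma perm_chord_sum ks ks' phi H : perm_eq ks ks' -> chord_sum ks phi H = chord_sum ks' phi H.
Proof.
move=> pk; have := edge_sum_chords _ (fun z => phi z.1) H => eH.
by rewrite -[LHS]eH -[RHS]eH; apply: perm_edge_sum; apply: perm_map.
Qed.

Definition legs x1 x2 x3 x4 : nat -> 'rV[K]_n :=
  add_pt (add_pt (add_pt (add_pt (fun _ => 0) j.+2 x3) j.+1 x2) 0 x1) N x4.

Lemma lin_tprod_map p phi ps w : p \in ps -> uniq ps -> phi p = 0 ->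
  lin (fun x => tprod (map (add_pt phi p x) ps) w).
Proof.
move=> /path.splitPr[l r] uq p0.
have nl : p \notin l.
  by move: uq; rewrite cat_uniq => /and3P[_ /norP[]].
have nr : p \notin r.
  by move: uq; rewrite cat_uniq => /and3P[_ _ /andP[]].
have em s x : p \notin s -> map (add_pt phi p x) s = map phi s.
  move=> ns; apply/eq_in_map => q qs; rewrite /add_pt ifF ?add0r //.
  by apply: contraNF ns => /eqP ->.
apply: lin_ext (lin_tprod (map phi l) (map phi r) w) => x.
by rewrite map_cat /= !em // /add_pt eqxx p0 addr0.
Qed.

Lemma lin_chord_sum p phi ks ps w : p \in ps -> uniq ps -> phi p = 0 ->
  (forall k, k \in ks -> (k != p) && ((N - k)%N != p)) ->
  lin (fun x => chord_sum ks (add_pt phi p x) (fun phi => tprod (map phi ps) w)).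
Proof.
move=> pp uq; elim: ks phi => [|k ks IH] phi p0 Hk /=; first exact: lin_tprod_map.
apply: lin_bigsum => c.
have /andP[/negPf k1 /negPf k2] := Hk k (mem_head _ _).
apply: lin_ext (IH (set_chord phi k c) _ _) => [x||k' k'ks].
- congr chord_sum; apply: functional_extensionality => q.
  by rewrite /set_chord /add_pt addrA.
- by rewrite /set_chord p0 k1 k2 !addr0.
by apply: Hk; rewrite inE k'ks orbT.
Qed.

Definition chord_range ks := forall k, k \in ks -> (0 < k <= j)%N.

Lemma legs_quadrilin ks ps w : chord_range ks -> uniq ps ->
  [/\ 0%N \in ps, j.+1 \in ps, j.+2 \in ps & N \in ps] ->
  quadrilin (fun x1 x2 x3 x4 =>
    chord_sum ks (legs x1 x2 x3 x4) (fun phi => tprod (map phi ps) w)).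
Proof.
move=> rk uq [h1 h2 h3 h4].
split=> a b c.
- apply: lin_ext (@lin_chord_sum 0%N
    (add_pt (add_pt (add_pt (fun _ => 0) j.+2 b) j.+1 a) N c) ks ps w h1 uq _ _) => [x||k kk].
  + by rewrite add_ptC.
  + by rewrite /add_pt /= !addr0 ifF //; apply/negbTE; rewrite /N; lia.
  + by have := rk k kk; rewrite /N; lia.
- apply: lin_ext (@lin_chord_sum j.+1%N
    (add_pt (add_pt (add_pt (fun _ => 0) j.+2 b) 0 a) N c) ks ps w h2 uq _ _) => [x||k kk].
  + by rewrite /legs [in RHS](add_ptC _ j.+1) (add_ptC _ _ j.+1) .
  + by rewrite /add_pt /= !ifF ?addr0 //; apply/negbTE; rewrite /N; lia.
  + by have := rk k kk; rewrite /N; lia.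
- apply: lin_ext (@lin_chord_sum j.+2%N
    (add_pt (add_pt (add_pt (fun _ => 0) j.+1 b) 0 a) N c) ks ps w h3 uq _ _) => [x||k kk].
  + by rewrite /legs (add_ptC _ j.+2) (add_ptC _ j.+2) (add_ptC _ j.+2).
  + by rewrite /add_pt /= !ifF ?addr0 //; apply/negbTE; rewrite /N; lia.
  + by have := rk k kk; rewrite /N; lia.
apply: lin_chord_sum => [|||k kk] //.
  by rewrite /add_pt /= !ifF ?addr0 //; apply/negbTE; rewrite /N; lia.
by have := rk k kk; rewrite /N; lia.
Qed.

(* The ladder with [i] rungs and the chords joining [k] to [2j+3-k] for [k] in
   [ks], the loop points being multiplied in the order [ps]. *)
Definition named_val i ks ps : tens K n := fun w =>
  ladder4 br E Ed i (fun x1 x2 x3 x4 =>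
    chord_sum ks (legs x1 x2 x3 x4) (fun phi => tprod (map phi ps) w)).

Lemma ladder_edges_perm (u v : nat -> nat) p1 p4 m k :
  perm_eq (ladder_edges u v p1 p4 (iota m k.+1))
   ([:: ((u (m + k)%N, Some s0), (p1, None)); ((v (m + k)%N, Some s0), (p4, None))]
    ++ [seq ((u q, Some s0), (u q.+1, Some s1)) | q <- iota m k]
    ++ [seq ((v q, Some s0), (v q.+1, Some s2)) | q <- iota m k]
    ++ [seq ((u q, Some s2), (v q, Some s1)) | q <- iota m k.+1]).
Proof.
elim: k m => [|k IH] m; apply/permP => a; first by rewrite addn0 /=; ring.
have := permP (IH m.+1) a; rewrite !count_cat addSnnS /= => H.
by rewrite H; ring.
Qed.

Lemma iota1_map (T : Type) (F : nat -> T) r :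
  [seq F k | k <- iota 1 r] = [seq F k.+1 | k <- iota 0 r].
Proof. by rewrite (iotaDl 1 0) -map_comp. Qed.

Lemma Jdiag_edges_perm i : perm_eq (dedges (Jdiag i.+1 j))
  ([:: ((0%N, Some s1), (j.+1, None)); ((i.+1, Some s2), (j.+2, None))] ++
   ladder_edges id (addn i.+1) 0 N (iota 0 i.+1) ++ chord_edges (iota 1 j)).
Proof.
apply/permP => a.
have := permP (ladder_edges_perm id (addn i.+1) 0 N 0 i) a.
rewrite !count_cat => ->.
have e1 : [seq (((k - 1)%N, Some s0), (k, Some s1)) | k <- iota 1 (i.+1 - 1)] =
   [seq ((id q, Some s0), (id q.+1, Some s1)) | q <- iota 0 i].
  by rewrite subn1 iota1_map; apply: eq_map => k; rewrite subn1.
have e2 : [seq (((i.+1 + k - 1)%N, Some s0), ((i.+1 + k)%N, Some s2)) | k <- iota 1 (i.+1 - 1)] =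
   [seq (((i.+1 + q)%N, Some s0), ((i.+1 + q.+1)%N, Some s2)) | q <- iota 0 i].
  rewrite subn1 iota1_map; apply: eq_map => k.
  by have -> : (i.+1 + k.+1 - 1 = i.+1 + k)%N by lia.
have e3 : [seq (((k - 1)%N, Some s2), ((i.+1 + k - 1)%N, Some s1)) | k <- iota 1 i.+1] =
   [seq ((id q, Some s2), ((i.+1 + q)%N, Some s1)) | q <- iota 0 i.+1].
  rewrite iota1_map; apply: eq_map => k.
  have -> : (i.+1 + k.+1 - 1 = i.+1 + k)%N by lia.
  by rewrite subn1.
rewrite e1 e2 e3 -/(chord_edges (iota 1 j)) add0n.
have -> : (2 * i.+1 - 1 = i.+1 + i)%N by lia.
rewrite subn1 -/N [count a [:: _; _; _; _]]/= [count a [:: _; _]]/= [count a [:: _; _]]/=.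
by set c := count a (chord_edges _); ring.
Qed.

Implicit Types (l r s : seq nat) (g h : seq 'I_n).
Let opp k := (N - k)%N.

Lemma chord_sum_cat ks ks' phi H :
  chord_sum (ks ++ ks') phi H = chord_sum ks phi (fun phi' => chord_sum ks' phi' H).
Proof. by elim: ks phi => [|k ks IH] phi //=; apply: eq_bigr => c _; apply: IH. Qed.

Definition touches (p k : nat) := (k == p) || (opp k == p).

Lemma tcong_chord_sum ks phi (A B : (nat -> 'rV[K]_n) -> tens K n) :
  (forall phi', (forall p, ~~ has (touches p) ks -> phi' p = phi p) ->
     tcong br (A phi') (B phi')) ->
  tcong br (fun w => chord_sum ks phi (fun phi => A phi w))
           (fun w => chord_sum ks phi (fun phi => B phi w)).
Proof.
elim: ks phi => [|k ks IH] phi H /=; first by apply: H.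
apply: tcong_sum => c _; apply: IH => phi' Hp; apply: H => p /=.
rewrite negb_or => /andP[nk /Hp ->]; move: nk; rewrite /touches negb_or => /andP[n1 n2].
by rewrite /set_chord (negPf n1) (negPf n2) !addr0.
Qed.

Lemma chord_sumD ks phi (a : K) H H' :
  chord_sum ks phi (fun phi => a * H phi + H' phi) = a * chord_sum ks phi H + chord_sum ks phi H'.
Proof.
elim: ks phi => [|k ks IH] phi //=; rewrite mulr_sumr -big_split /=.
by apply: eq_bigr => c _; apply: IH.
Qed.

Lemma set_chord_map phi k c s : k \notin s -> opp k \notin s ->
  map (set_chord phi k c) s = map phi s.
Proof.
move=> k1 k2; apply/eq_in_map => p ps; rewrite /set_chord.
have -> : (k == p) = false by apply: contraNF k1 => /eqP ->.
have -> : ((N - k)%N == p) = false by apply: contraNF k2 => /eqP ek; rewrite /opp ek.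
by rewrite !addr0.
Qed.

Lemma set_chordl phi k c : (0 < k <= j)%N -> phi k = 0 -> set_chord phi k c k = e c.
Proof.
move=> kj p0; rewrite /set_chord p0 eqxx.
have -> : ((N - k)%N == k) = false by rewrite /N; lia.
by rewrite addr0 add0r.
Qed.

Lemma set_chordr phi k c : (0 < k <= j)%N -> phi (opp k) = 0 ->
  set_chord phi k c (opp k) = f c.
Proof.
move=> kj p0; rewrite /set_chord p0 eqxx.
have -> : (k == opp k) = false by rewrite /opp /N; lia.
by rewrite !add0r.
Qed.

Lemma legs_chord x1 x2 x3 x4 k : (0 < k <= j)%N ->
  legs x1 x2 x3 x4 k = 0 /\ legs x1 x2 x3 x4 (opp k) = 0.
Proof.
move=> kj; rewrite /legs /add_pt /opp /N.
by split; rewrite !ifF ?addr0 //; apply/negbTE; lia.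
Qed.

(** Each pair consists of the two ends of one chord, adjacent on the loop, and so contributes one
    central factor C. *)
Definition npairs s : seq nat := flatten [seq [:: k; opp k] | k <- s].
(* The end points of the nested chords [s], with [l] in the middle. *)
Definition arc s l : seq nat := s ++ l ++ map opp (rev s).

Lemma perm_npairs s l : perm_eq (npairs s ++ l) (arc s l).
Proof.
rewrite /arc map_rev; elim: s => [|k s IH] /=; first by rewrite cats0.
apply/permP => a; have := permP IH a.
rewrite /npairs /= -/(npairs s) rev_cons -cats1 => ->; rewrite !count_cat /=; ring.
Qed.

Lemma named_chord_split i ks k ps : uniq ks -> k \in ks ->
  named_val i ks ps =1 fun w => ladder4 br E Ed i (fun x1 x2 x3 x4 =>
    chord_sum (rem k ks) (legs x1 x2 x3 x4) (fun phi =>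
      \sum_c tprod (map (set_chord phi k c) ps) w)).
Proof.
move=> uk kk w; apply: eq_ladder4 => x1 x2 x3 x4.
rewrite (perm_chord_sum (ks' := rem k ks ++ [:: k])); last first.
  by rewrite cats1 perm_sym perm_rcons perm_sym perm_to_rem.
by rewrite chord_sum_cat.
Qed.

Lemma named_chord_zero ks k phi x1 x2 x3 x4 : uniq ks -> chord_range ks -> k \in ks ->
  (forall p, ~~ has (touches p) (rem k ks) -> phi p = legs x1 x2 x3 x4 p) ->
  phi k = 0 /\ phi (opp k) = 0.
Proof.
move=> uk rk kk Hp; have kj := rk k kk.
have nt p : p = k \/ p = opp k -> ~~ has (touches p) (rem k ks).
  move=> ep; apply/hasPn => q; rewrite (mem_rem_uniq _ uk) inE => /andP[qk /rk qj].
  by rewrite /touches /opp /N; case: ep => ->; rewrite /opp /N; move: qk => /eqP; lia.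
have [l1 l2] := legs_chord x1 x2 x3 x4 kj.
by rewrite (Hp k (nt _ (or_introl erefl))) (Hp _ (nt _ (or_intror erefl))).
Qed.


Lemma uniq_pair_notin l k k' r : uniq (l ++ k :: k' :: r) ->
  [/\ k \notin l, k' \notin l, k \notin r & k' \notin r].
Proof.
rewrite cat_uniq /= !inE !negb_or => /and5P[_ /and3P[-> -> _] /andP[_ ->] -> _] //.
Qed.

Lemma arc_cons k s l : arc (k :: s) l = k :: arc s l ++ [:: opp k].
Proof. by rewrite /arc rev_cons map_rcons -cats1 /= -!catA. Qed.

Lemma arc_rcons k s l : arc (rcons s k) l = arc s (k :: l ++ [:: opp k]).
Proof. by rewrite /arc rev_rcons cat_rcons /= -!catA. Qed.

Fixpoint set_chords phi ks g : nat -> 'rV[K]_n :=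
  match ks, g with
  | k :: ks', c :: g' => set_chords (set_chord phi k c) ks' g'
  | _, _ => phi
  end.

Lemma chord_sum_sumseq ks phi H :
  chord_sum ks phi H = sumseq (size ks) (fun g => H (set_chords phi ks g)).
Proof. by elim: ks phi => [|k ks IH] phi //=; apply: eq_bigr => c _; apply: IH. Qed.

Lemma set_chords_notin phi ks g p : ~~ has (touches p) ks -> set_chords phi ks g p = phi p.
Proof.
elim: ks phi g => [|k ks IH] phi [|c g] //=; rewrite negb_or => /andP[nk nks].
rewrite IH //; move: nk; rewrite /touches negb_or => /andP[/negPf n1 /negPf n2].
by rewrite /set_chord n1 n2 !addr0.
Qed.

Lemma touches_uniq k ks p : uniq (k :: ks) -> chord_range (k :: ks) ->
  p = k \/ p = opp k -> ~~ has (touches p) ks.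
Proof.
move=> /= /andP[kks _] rk ep; apply/hasPn => q qks.
have := rk q; have := rk k; rewrite !inE qks eqxx orbT => /(_ isT) kj /(_ isT) qj.
have qk : q != k by apply: contraNneq kks => <-.
by rewrite /touches; case: ep => ->; rewrite /opp /N; move: qk => /eqP; lia.
Qed.

Lemma set_chords_eval phi ks g : uniq ks -> chord_range ks -> size g = size ks ->
  (forall k, k \in ks -> phi k = 0 /\ phi (opp k) = 0) ->
  map (set_chords phi ks g) ks = map e g /\
  map (set_chords phi ks g) (map opp ks) = map f g.
Proof.
elim: ks phi g => [|k ks IH] phi [|c g] // uk rk [sg] p0.
have kj : (0 < k <= j)%N by apply: rk; rewrite mem_head.
have [pk1 pk2] := p0 k (mem_head _ _).
have nt := touches_uniq uk rk.
have n1 := nt k (or_introl erefl); have n2 := nt (opp k) (or_intror erefl).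
have [||q qks|H1 H2] := IH (set_chord phi k c) g _ _ sg.
- by case/andP: uk.
- by move=> q qks; apply: rk; rewrite inE qks orbT.
- have [q1 q2] : phi q = 0 /\ phi (opp q) = 0 by apply: p0; rewrite inE qks orbT.
  have := rk q; rewrite inE qks orbT => /(_ isT) qj.
  have qk : q != k by move: uk => /= /andP[kks _]; apply: contraNneq kks => <-.
  rewrite /set_chord q1 q2 !ifF ?addr0 //; rewrite /opp /N; move: qk => /eqP; lia.
by rewrite /= H1 H2 !set_chords_notin // set_chordl // set_chordr.
Qed.

Lemma map_npairs phi ks g : size g = size ks ->
  map phi ks = map e g -> map phi (map opp ks) = map f g ->
  map phi (npairs ks) = chords E Ed g.
Proof.
elim: ks g => [|k ks IH] [|c g] // [sg] [ek H1] [ek' H2].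
rewrite /npairs /chords /= ek ek'; congr [:: _, _ & _]; exact: IH.
Qed.

Lemma legsE x1 x2 x3 x4 : [/\ legs x1 x2 x3 x4 0 = x1, legs x1 x2 x3 x4 j.+1 = x2,
  legs x1 x2 x3 x4 j.+2 = x3 & legs x1 x2 x3 x4 N = x4].
Proof.
rewrite /legs /add_pt !eqxx !eqSS /=.
have -> : (N == 0)%N = false by rewrite /N; lia.
have -> : (0 == N)%N = false by rewrite /N; lia.
have -> : (N == j.+1) = false by rewrite /N; lia.
have -> : (j.+1 == N) = false by rewrite /N; lia.
have -> : (N == j.+2) = false by rewrite /N; lia.
have -> : (j.+2 == N) = false by rewrite /N; lia.
have -> : (j == j.+1) = false by lia.
have -> : (j.+1 == j) = false by lia.
by rewrite !addr0 !add0r.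
Qed.

(** The normal form: isolated chords first, then the ladder crossed by nested chords. Only the
    numbers of chords of the two kinds matter, their names do not. *)
Lemma named_val_eval i ks kh kg :
  uniq ks -> chord_range ks -> perm_eq ks (kh ++ kg) ->
  named_val i ks (npairs kh ++ 0%N :: arc kg [:: j.+1; j.+2] ++ [:: N])
  =1 ladder_val br E Ed i (size kg) (size kh).
Proof.
move=> uk rk pk w; apply: eq_ladder4 => x1 x2 x3 x4.
(* [arc] lists the nested chords from the outside in, whereas [ladder_word] takes their labels from
   the inside out. *)
have pk' : perm_eq ks (kh ++ rev kg).
  by apply: perm_trans pk _; rewrite perm_cat2l perm_sym perm_rev.
rewrite (perm_chord_sum _ _ pk') chord_sum_sumseq size_cat size_rev sumseq_cat.
apply: eq_sumseq => h sh; apply: eq_sumseq => g sg; congr (tprod _ w).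
have uk' : uniq (kh ++ rev kg) by rewrite -(perm_uniq pk').
have rk' : chord_range (kh ++ rev kg) by move=> k; rewrite -(perm_mem pk'); apply: rk.
set phi := legs x1 x2 x3 x4.
have p0 k : k \in kh ++ rev kg -> phi k = 0 /\ phi (opp k) = 0.
  by move=> /rk' kj; apply: legs_chord.
have shg : size (h ++ g) = size (kh ++ rev kg) by rewrite !size_cat sh sg size_rev.
have [H1 H2] := set_chords_eval uk' rk' shg p0.
set psi := set_chords phi (kh ++ rev kg) (h ++ g) in H1 H2 *.
rewrite !map_cat in H1 H2.
have [Hh1 Hg1] : map psi kh = map e h /\ map psi (rev kg) = map e g.
  by move/eqP: H1; rewrite eqseq_cat ?size_map // => /andP[/eqP-> /eqP->].
have [Hh2 Hg2] : map psi (map opp kh) = map f h /\ map psi (map opp (rev kg)) = map f g.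
  by move/eqP: H2; rewrite eqseq_cat ?size_map // => /andP[/eqP-> /eqP->].
have np p : (forall k, (0 < k <= j)%N -> (k != p) && (opp k != p)) -> psi p = phi p.
  move=> Hp; apply: set_chords_notin; apply/hasPn => k /rk' /Hp.
  by rewrite /touches negb_or.
have [E1 E2 E3 E4] := legsE x1 x2 x3 x4.
have q1 : psi 0%N = x1 by rewrite np ?E1 // => k; rewrite /opp /N; lia.
have q2 : psi j.+1 = x2 by rewrite np ?E2 // => k; rewrite /opp /N; lia.
have q3 : psi j.+2 = x3 by rewrite np ?E3 // => k; rewrite /opp /N; lia.
have q4 : psi N = x4 by rewrite np ?E4 // => k; rewrite /opp /N; lia.
rewrite map_cat (map_npairs sh Hh1 Hh2) /ladder_word; congr (_ ++ _).
rewrite /= q1 /arc !map_cat /= q2 q3 q4 Hg2 map_rev -Hg1 -map_rev revK.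
by rewrite -!catA.
Qed.

Lemma named_val_perm i ks ks' ps : perm_eq ks ks' -> named_val i ks ps =1 named_val i ks' ps.
Proof. by move=> pk w; apply: eq_ladder4 => *; apply: perm_chord_sum. Qed.

Hypothesis lieP : lie_axioms br.
Hypothesis E_unit : E \in unitmx.
Hypothesis dualP :
  forall a b : 'I_n, lam * killing br (row a E) (row b Ed) = (a == b)%:R.

(** The loop order of [D] is left free because [D] will be a product of blocks of a partition, which
    has the edges and vertices of [Jdiag] but its loop points in another order. The edges at p2 and
    p3 are labelled first, then the ladder, then the chords. *)
Lemma wsys_Jdiag i D w :
  perm_eq (dedges D) (dedges (Jdiag i j)) -> perm_eq (dverts D) (dverts (Jdiag i j)) ->
  perm_eq (dpts D) (iota 0 (2 * j + 4)) ->
  wsys br form E Ed D w = named_val i (iota 1 j) (dpts D) w.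
Proof.
move=> pe pv pp; set ps := dpts D in pp *.
have uq : uniq ps by rewrite (perm_uniq pp) iota_uniq.
have mp k : (k <= N)%N -> k \in ps by rewrite (perm_mem pp) mem_iota /N; lia.
have rk : chord_range (iota 1 j) by move=> k; rewrite mem_iota; lia.
have qF := legs_quadrilin w rk uq.
have {}qF : quadrilin (fun x1 x2 x3 x4 =>
    chord_sum (iota 1 j) (legs x1 x2 x3 x4) (fun phi => tprod (map phi ps) w)).
  by apply: qF; split; apply: mp; rewrite /N; lia.
rewrite wsys_edge_sum (perm_edge_sum _ _ _ _ pe) -/ps /named_val.
case: i pe pv => [|i] pe pv.
  rewrite /ladder4 /=; move: pv; rewrite /= => /perm_nilP ->.
  apply: eq_bigr => a _.
  case: qF => _ _ F3 F4.
  have bB : bilin (fun x3 x4 => chord_sum (iota 1 j) (legs (e a) (f a) x3 x4)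
     (fun phi => tprod (map phi ps) w)) by split=> *; [apply: F3 | apply: F4].
  (* The edge p3p4 carries [e b] at p3 and [f b] at p4, the opposite of the convention of
     [ladder4]. *)
  rewrite -[RHS](casimir_sym lieP E_unit dualP bB); apply: eq_bigr => b _.
  under eq_edge_sum => rho _ do rewrite big_nil mul1r.
  rewrite (edge_sum_chords _ _ (fun phi => tprod (map phi ps) w)); congr chord_sum.
  apply: functional_extensionality => p.
  rewrite /pts /set_edge /legs /add_pt /= !xpair_eqE /= !andbT !add0r addr0.
  by rewrite [RHS]addrC !addrA.
rewrite (perm_edge_sum _ _ _ _ (Jdiag_edges_perm i)) /ladder4.
pose rho a b := set_edge E Ed (set_edge E Ed (fun _ => 0)
  ((0%N, Some s1), (j.+1, None)) a) ((i.+1, Some s2), (j.+2, None)) b.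
set H := (X in edge_sum _ _ _ _ X).
set lads := ladder_edges _ _ _ _ _; set chs := chord_edges _.
transitivity (\sum_a \sum_b edge_sum E Ed (lads ++ chs) (rho a b) H); first by [].
apply: eq_bigr => a _; apply: eq_bigr => b _.
pose T phi := chord_sum (iota 1 j) phi (fun phi => tprod (map phi ps) w).
rewrite edge_sum_cat.
transitivity (edge_sum E Ed lads (rho a b) (fun rho => \prod_(k <- iota 0 i.+1)
   (vert br lam rho (id k) * vert br lam rho (i.+1 + k)%N) * T (pts rho))).
  apply: eq_edge_sum => rho' _.
  (* Chords have both ends on the loop, so labelling them leaves every vertex factor unchanged. *)
  transitivity (edge_sum E Ed chs rho' (fun rho =>
    \prod_(v <- dverts D) vert br lam rho' v * tprod [seq pts rho p | p <- ps] w)).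
    apply: eq_edge_sum => rho'' Hr; congr (_ * _); apply: eq_bigr => v _.
    have nh (s : 'I_3) : ~~ has (edge_has (v, Some s)) chs.
      apply/hasPn => z /mapP[k _ ->]; rewrite /edge_has /= !xpair_eqE /=.
      by rewrite !andbF.
    by rewrite /vert !Hr.
  rewrite edge_sumZ (edge_sum_chords _ _ (fun phi => tprod (map phi ps) w)); congr (_ * _).
  rewrite (perm_big _ pv) [dverts _](_ : _ = iota 0 i.+1 ++ iota i.+1 i.+1); last first.
    by rewrite /dverts /Jdiag mul2n -addnn iotaD.
  have -> : iota i.+1 i.+1 = map (addn i.+1) (iota 0 i.+1) by rewrite -iotaDl addn0.
  by rewrite big_cat big_map [RHS]big_split.
have Sn (s : 'I_3) : (Some s == None :> option 'I_3) = false by [].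
have nS (s : 'I_3) : (None == Some s :> option 'I_3) = false by [].
have rV k (s : 'I_3) : rho a b (k, Some s) =
    (if (0%N == k) && (Some s1 == Some s) then e a else 0) +
    (if (i.+1 == k) && (Some s2 == Some s) then e b else 0).
  by rewrite /rho /set_edge !xpair_eqE !nS !andbF !addr0 !add0r.
rewrite /lads; change (iota 0 i.+1) with (0%N :: iota 1 i).
rewrite (ladder_edges_eval lieP E_unit dualP).
- rewrite size_iota addn0; set y0 := rho a b (0%N, _); set y1 := rho a b (i.+1, _).
  have -> : y0 = e a.
    by rewrite /y0 rV /= addr0.
  have -> : y1 = e b.
    by rewrite /y1 rV eqxx /= add0r.
  apply: eq_ladder => x y; rewrite /T; congr chord_sum.
  apply: functional_extensionality => p.
  rewrite /legs /add_pt /pts /rho /set_edge /= !xpair_eqE /= !Sn !andbF !andbT.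
  by rewrite !add0r !addr0.
- change (0%N :: iota 1 i) with (iota 0 i.+1).
  by rewrite map_id -iotaDl addn0 -iotaD iota_uniq.
- by rewrite rV /= ?eqxx ?andbF /= !addr0.
- by rewrite rV /= ?eqxx ?andbF /= !addr0.
- by rewrite rV /= ?eqxx ?andbF /= !addr0.
- by rewrite rV /= ?eqxx ?andbF /= !addr0.
- move=> m s; rewrite mem_iota => /andP[m0 mi].
  rewrite !rV.
  have -> : (0%N == m) = false by lia.
  have -> : (i.+1 == m) = false by lia.
  have -> : (i.+1 == i.+1 + m)%N = false by lia.
  by rewrite /= !addr0.
case: qF => F1 _ _ F4.
have ep x y : add_pt (add_pt (pts (rho a b)) 0 x) N y = legs x (f a) (f b) y.
  apply: functional_extensionality => p.
  rewrite /legs /add_pt /pts /rho /set_edge /= !xpair_eqE /= !Sn !andbF !andbT.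
  by rewrite !add0r !addr0.
split=> [y|x]; rewrite /T.
  by apply: lin_ext (F1 (f a) (f b) y) => x; rewrite ep.
by apply: lin_ext (F4 x (f a) (f b)) => y; rewrite ep.
Qed.

(** * Bringing words of loop points to normal form *)

Lemma named_chord_front i ks k l r :
  uniq ks -> chord_range ks -> k \in ks -> uniq (l ++ k :: opp k :: r) ->
  tcong br (named_val i ks (l ++ k :: opp k :: r))
           (named_val i ks (k :: opp k :: l ++ r)).
Proof.
move=> uk rk kk uq; have kj := rk k kk.
have [k1 k2 k3 k4] := uniq_pair_notin uq.
apply: tcong_ext (named_chord_split _ _ uk kk) (named_chord_split _ _ uk kk) _.
apply: tcong_ladder4 => x1 x2 x3 x4; apply: tcong_chord_sum => phi Hp.
have [p1 p2] := named_chord_zero uk rk kk Hp.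
have := tprod_chord_central lieP E_unit dualP [::] (map phi l) (map phi r).
apply: tcong_ext => w; apply: eq_bigr => c _; congr (tprod _ w).
  by rewrite map_cat /= set_chordl // set_chordr // !set_chord_map.
by rewrite /= map_cat set_chordl // set_chordr // !set_chord_map.
Qed.

(** Nested chords with nothing in the middle unwind from the inside: the innermost has adjacent ends
    and is central, and once it is moved away the next one has adjacent ends. *)
Lemma named_seg i ks s l r :
  uniq ks -> chord_range ks -> {subset s <= ks} -> uniq (l ++ arc s [::] ++ r) ->
  tcong br (named_val i ks (l ++ arc s [::] ++ r)) (named_val i ks (npairs s ++ l ++ r)).
Proof.
move=> uk rk; elim: s l r => [|k s IH] l r sub uq; first exact: tcong_refl.
have ew : l ++ arc (k :: s) [::] ++ r = rcons l k ++ arc s [::] ++ opp k :: r.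
  by rewrite arc_cons /= -catA cat_rcons.
rewrite ew in uq *.
have ew' : npairs s ++ rcons l k ++ opp k :: r = (npairs s ++ l) ++ k :: opp k :: r.
  by rewrite cat_rcons catA.
apply: tcong_trans (IH _ _ _ uq) _.
  by move=> q qs; apply: sub; rewrite inE qs orbT.
rewrite ew'; have -> : npairs (k :: s) ++ l ++ r = k :: opp k :: (npairs s ++ l) ++ r.
  by rewrite /npairs /= catA.
apply: named_chord_front => //; first by apply: sub; rewrite mem_head.
rewrite -ew' -(perm_uniq (_ : perm_eq (rcons l k ++ arc s [::] ++ opp k :: r) _)) //.
rewrite perm_catCA perm_cat2r perm_sym.
by have := perm_npairs s [::]; rewrite cats0.
Qed.

(** Each segment is pulled in front of those treated before it, which explains the [rev]. *)
Lemma named_segs i ks (ss : seq (seq nat)) l r :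
  uniq ks -> chord_range ks -> {subset flatten ss <= ks} ->
  uniq (l ++ flatten [seq arc s [::] | s <- ss] ++ r) ->
  tcong br (named_val i ks (l ++ flatten [seq arc s [::] | s <- ss] ++ r))
           (named_val i ks (npairs (flatten (rev ss)) ++ l ++ r)).
Proof.
move=> uk rk; elim: ss l => [|s ss IH] l sub uq; first exact: tcong_refl.
rewrite /= -catA in uq *.
apply: tcong_trans (named_seg _ uk rk _ uq) _.
  by move=> q qs; apply: sub; rewrite /= mem_cat qs.
rewrite rev_cons -cats1 flatten_cat /= cats0 /npairs map_cat flatten_cat -/(npairs _) -/(npairs _).
rewrite -!catA (catA (npairs s) l) (catA (npairs s) l r).
apply: IH; first by move=> q qs; apply: sub; rewrite /= mem_cat qs orbT.
rewrite -catA -(perm_uniq (_ : perm_eq (l ++ arc s [::] ++ flatten [seq arc s [::] | s <- ss] ++ r) _)) //.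
rewrite perm_catCA perm_cat2r perm_sym.
by have := perm_npairs s [::]; rewrite cats0.
Qed.

Hypothesis lam_neq0 : lam != 0.
Hypothesis two_neq0 : (2 : K) != 0.

Lemma named_cross i ks k p l r :
  uniq ks -> chord_range ks -> k \in ks -> uniq (l ++ k :: p :: opp k :: r) ->
  tcong br (named_val i ks (l ++ k :: p :: opp k :: r))
    (fun w => named_val i ks (k :: opp k :: l ++ p :: r) w +
              - (2 * lam)^-1 * named_val i (rem k ks) (l ++ p :: r) w).
Proof.
move=> uk rk kk uq; have kj := rk k kk.
have {}uq : uniq (k :: opp k :: l ++ p :: r).
  rewrite -(perm_uniq (_ : perm_eq (l ++ k :: p :: opp k :: r) _)) //.
  by apply/permP => a; rewrite /= !count_cat /=; ring.
have /andP[k1 /andP[k2 _]] : (k \notin l ++ p :: r) && ((opp k \notin l ++ p :: r) && true).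
  by move: uq; rewrite /= inE negb_or => /and3P[/andP[_ ->] ->].
have nl q : q \notin l ++ p :: r -> [/\ q \notin l, q \notin r & q \notin [:: p]].
  by rewrite mem_cat !inE !negb_or => /and3P[-> -> ->].
have [k1l k1r k1p] := nl _ k1; have [k2l k2r k2p] := nl _ k2.
apply: (@tcong_trans _ _ _ _ (fun w => ladder4 br E Ed i (fun x1 x2 x3 x4 =>
    chord_sum (rem k ks) (legs x1 x2 x3 x4) (fun phi =>
      \sum_c tprod (map (set_chord phi k c) (k :: opp k :: l ++ p :: r)) w +
      - (2 * lam)^-1 * tprod (map phi (l ++ p :: r)) w)))); last first.
  apply: tcong_eq => w; rewrite (named_chord_split i _ uk kk) addrC /named_val -ladder4D.
  by apply: eq_ladder4 => x1 x2 x3 x4; rewrite -chord_sumD; congr chord_sum;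
     apply: functional_extensionality => phi; rewrite addrC.
apply: tcong_ext (named_chord_split _ _ uk kk) (frefl _) _.
apply: tcong_ladder4 => x1 x2 x3 x4; apply: tcong_chord_sum => phi Hp.
have [p1 p2] := named_chord_zero uk rk kk Hp.
have mp c : set_chord phi k c p = phi p.
  by have := set_chord_map phi c k1p k2p => -[].
have := tprod_chord_cross lieP E_unit dualP lam_neq0 two_neq0 (map phi l) (phi p) (map phi r).
apply: tcong_ext => w.
  apply: eq_bigr => c _; congr (tprod _ w).
  by rewrite map_cat /= set_chordl // set_chordr // !set_chord_map // mp.
rewrite map_cat /=; congr (_ + _); apply: eq_bigr => c _; congr (tprod _ w).
by rewrite set_chordl // set_chordr // map_cat /= !set_chord_map // mp.
Qed.

Lemma named_star_step ks ks' k q L R m t :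
  uniq ks -> chord_range ks -> perm_eq ks (k :: ks') ->
  uniq (L ++ k :: q :: opp k :: R) ->
  tcong br (named_val 0 (k :: ks') (k :: opp k :: L ++ q :: R)) (star_val br lam E Ed m t.+1) ->
  tcong br (named_val 0 ks' (L ++ q :: R)) (star_val br lam E Ed m t) ->
  tcong br (named_val 0 ks (L ++ k :: q :: opp k :: R)) (star_val br lam E Ed m.+1 t).
Proof.
move=> uk rk pk uq H1 H2.
have kk : k \in ks by rewrite (perm_mem pk) mem_head.
have pk' : perm_eq (rem k ks) ks'.
  by rewrite -(perm_cons k) (perm_trans _ pk) // perm_sym perm_to_rem.
apply: tcong_trans (named_cross 0 uk rk kk uq) _; apply: tcongD; last apply: tcongZ.
  by apply: tcong_ext H1 => // w; apply: named_val_perm.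
by apply: tcong_ext H2 => // w; apply: named_val_perm.
Qed.

(** Induction on the number of chords around [p] and [q]. The innermost one encloses a single point,
    so [named_cross] either isolates it or deletes it at the cost of the Casimir constant, as in the
    definition of [star_val]. The word without crossing chords is left to the hypothesis, since it
    depends on the order of the two factors. *)
Lemma named_star p q l0 l1 l2 kt s1 s2 :
  (forall kt, uniq kt -> chord_range kt ->
     tcong br (named_val 0 kt (npairs kt ++ l0 ++ p :: l1 ++ q :: l2))
              (ladder_val br E Ed 0 0 (size kt))) ->
  uniq (kt ++ s1 ++ s2) -> chord_range (kt ++ s1 ++ s2) ->
  uniq (npairs kt ++ l0 ++ arc s1 [:: p] ++ l1 ++ arc s2 [:: q] ++ l2) ->
  tcong br
    (named_val 0 (kt ++ s1 ++ s2) (npairs kt ++ l0 ++ arc s1 [:: p] ++ l1 ++ arc s2 [:: q] ++ l2))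
    (star_val br lam E Ed (size s1 + size s2) (size kt)).
Proof.
move=> base; move: {2}(size s1 + size s2)%N (erefl (size s1 + size s2)%N) => m.
elim: m kt s1 s2 => [|m IH] kt s1 s2 sz uk rk uq.
  move: sz uk rk uq; case: s1 => [|? ?] //; case: s2 => [|? ?] // _.
  by rewrite !cats0 => uk rk uq; apply: base.
pose W kt s1 s2 := npairs kt ++ l0 ++ arc s1 [:: p] ++ l1 ++ arc s2 [:: q] ++ l2.
have pW k kt' s s' : perm_eq (W (k :: kt') s s') (W kt' (rcons s k) s') /\
    perm_eq (W (k :: kt') s s') (W kt' s (rcons s' k)).
  by split; apply/permP => a; rewrite /W /npairs /= -/(npairs kt') arc_rcons /arc
     /= !(count_cat, =^~ catA) /= ?count_cat /=; ring.
have pWk k kt' s s' : subseq (W kt' s s') (W (k :: kt') s s').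
  exact: (suffix_subseq [:: k; opp k]).
(* The last element of [s2] is the innermost chord around [q]; when there is none, the chords around
   [p] are treated instead. *)
case/lastP: s2 sz uk rk uq => [|s k] sz uk rk uq.
  case/lastP: s1 sz uk rk uq => [|s k] sz uk rk uq; first by [].
  rewrite size_rcons addn0 in sz *; case: sz => sz.
  have [pw _] := pW k kt s [::].
  have pk : perm_eq (kt ++ rcons s k ++ [::]) (k :: kt ++ s ++ [::]).
    by apply/permP => a; rewrite -cats1 /= !count_cat /=; ring.
  have uk' : uniq (k :: kt ++ s ++ [::]) by rewrite -(perm_uniq pk).
  have rk' : chord_range (k :: kt ++ s ++ [::]) by move=> c; rewrite -(perm_mem pk); apply: rk.
  have uW : uniq (W (k :: kt) s [::]) by rewrite (perm_uniq pw).
  have eW : W kt (rcons s k) [::] = (npairs kt ++ l0 ++ s) ++ k :: p :: opp k ::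
       (map opp (rev s) ++ l1 ++ q :: l2).
    by rewrite /W arc_rcons /arc /= -?catA /= -?catA.
  have eW' : (npairs kt ++ l0 ++ s) ++ p :: (map opp (rev s) ++ l1 ++ q :: l2) = W kt s [::].
    by rewrite /W /arc /= -?catA /= -?catA.
  rewrite -/(W kt _ _) eW; apply: named_star_step uk rk pk _ _ _.
  - by rewrite -eW.
  - rewrite eW' -[k :: opp k :: _]/(W (k :: kt) s [::]).
    by have := IH (k :: kt) s [::]; rewrite addn0; apply.
  rewrite eW'; have := IH kt s [::]; rewrite addn0; apply=> //.
  - by case/andP: uk'.
  - by move=> c cc; apply: rk'; rewrite inE cc orbT.
  exact: subseq_uniq (pWk k _ _ _) uW.
rewrite size_rcons addnS in sz *; case: sz => sz.
have [_ pw] := pW k kt s1 s.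
have pk : perm_eq (kt ++ s1 ++ rcons s k) (k :: kt ++ s1 ++ s).
  by apply/permP => a; rewrite -cats1 /= !count_cat /=; ring.
have uk' : uniq (k :: kt ++ s1 ++ s) by rewrite -(perm_uniq pk).
have rk' : chord_range (k :: kt ++ s1 ++ s) by move=> c; rewrite -(perm_mem pk); apply: rk.
have uW : uniq (W (k :: kt) s1 s) by rewrite (perm_uniq pw).
have eW : W kt s1 (rcons s k) = (npairs kt ++ l0 ++ arc s1 [:: p] ++ l1 ++ s) ++ k :: q :: opp k ::
     (map opp (rev s) ++ l2).
  by rewrite /W arc_rcons /arc /= -?catA /= -?catA.
have eW' : (npairs kt ++ l0 ++ arc s1 [:: p] ++ l1 ++ s) ++ q :: (map opp (rev s) ++ l2) = W kt s1 s.
  by rewrite /W /arc /= -?catA /= -?catA.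
rewrite -/(W kt _ _) eW; apply: named_star_step uk rk pk _ _ _.
- by rewrite -eW.
- rewrite eW' -[k :: opp k :: _]/(W (k :: kt) s1 s).
  exact: (IH (k :: kt) s1 s).
rewrite eW'; apply: (IH kt s1 s) => //.
- by case/andP: uk'.
- by move=> c cc; apply: rk'; rewrite inE cc orbT.
exact: subseq_uniq (pWk k _ _ _) uW.
Qed.

Lemma named_star12 kt s1 s2 :
  uniq (kt ++ s1 ++ s2) -> chord_range (kt ++ s1 ++ s2) ->
  let ps := npairs kt ++ (0%N :: arc s1 [:: j.+1]) ++ (arc s2 [:: j.+2] ++ [:: N]) in
  uniq ps ->
  tcong br (named_val 0 (kt ++ s1 ++ s2) ps)
    (star_val br lam E Ed (size s1 + size s2) (size kt)).
Proof.
move=> uk rk ps uq.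
apply: (@named_star j.+1 j.+2 [:: 0%N] [::] [:: N]) => // kt' uk' rk'.
apply: tcong_eq => w.
rewrite -(@named_val_eval 0 kt' kt' [::] uk' rk') ?cats0 //.
Qed.

Lemma named_star21 kt s1 s2 :
  uniq (kt ++ s2 ++ s1) -> chord_range (kt ++ s2 ++ s1) ->
  let ps := npairs kt ++ (arc s2 [:: j.+2] ++ [:: N]) ++ (0%N :: arc s1 [:: j.+1]) in
  uniq ps ->
  tcong br (named_val 0 (kt ++ s2 ++ s1) ps)
    (star_val br lam E Ed (size s2 + size s1) (size kt)).
Proof.
move=> uk rk ps uq.
have := @named_star j.+2 j.+1 [::] [:: N; 0%N] [::] kt s2 s1.
rewrite cats0 /= => H.
have eps : ps = npairs kt ++ arc s2 [:: j.+2] ++ N :: 0%N :: arc s1 [:: j.+1].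
  by rewrite /ps -catA.
rewrite eps in uq *; apply: H => // kt' uk' rk'.
apply: (@tcong_trans _ _ _ _ (fun w => \sum_b sumseq (size kt') (fun h =>
   \sum_a tprod (chords E Ed h ++ [:: f b; e b] ++ [:: e a; f a]) w))).
  apply: tcong_eq => w; rewrite /named_val /ladder4 exchange_big; apply: eq_bigr => b _.
  rewrite sumseq_sum; apply: eq_bigr => a _ /=; rewrite chord_sum_sumseq; apply: eq_sumseq => h sh.
  congr (tprod _ w).
  have p0 k : k \in kt' -> legs (e a) (f a) (f b) (e b) k = 0 /\
      legs (e a) (f a) (f b) (e b) (opp k) = 0.
    by move=> /rk' kj; apply: legs_chord.
  have [H1 H2] := set_chords_eval uk' rk' sh p0.
  have [E1 E2 E3 E4] := legsE (e a) (f a) (f b) (e b).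
  rewrite map_cat (map_npairs sh H1 H2) /=; congr (_ ++ _).
  have np p : (forall k, (0 < k <= j)%N -> (k != p) && (opp k != p)) ->
      set_chords (legs (e a) (f a) (f b) (e b)) kt' h p = legs (e a) (f a) (f b) (e b) p.
    move=> Hp; apply: set_chords_notin; apply/hasPn => k /rk' /Hp.
    by rewrite /touches negb_or.
  by rewrite !np ?E1 ?E2 ?E3 ?E4 // => k; rewrite /opp /N; lia.
(* With the factor of p3p4 first, the chord p1p2 has adjacent ends; moving it forward past the other
   chord restores the order used in [ladder_val]. *)
apply: (@tcong_trans _ _ _ _ (fun w => \sum_b sumseq (size kt') (fun h =>
   \sum_a tprod (chords E Ed h ++ [:: e a; f a] ++ [:: f b; e b]) w))).
  apply: tcong_sum => b _; apply: tcong_sumseq => h.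
  by have := tprod_chord_central lieP E_unit dualP (chords E Ed h) [:: f b; e b] [::].
apply: tcong_eq => w; rewrite /ladder_val /ladder4 exchange_big; apply: eq_bigr => b _.
by rewrite sumseq_sum.
Qed.
End JacobiEval.

(** * Components of the diagrams *)

Section DiagComponents.
Variable D : diag.
Let m := size (dedges D).
Let edge (q : 'I_m) := nth dedge0 (dedges D) q.
Implicit Types (q r : 'I_m) (B : {set {set 'I_m}}) (P : {set {set {set 'I_m}}}).

Lemma vendC x y : vend x y = vend y x.
Proof. by rewrite /vend (eq_sym x.1) andbCA. Qed.

Lemma dadj_sym : symmetric (dadj D).
Proof.
move=> q r; rewrite /dadj /eadj ![vend (nth _ _ r).1 _]vendC ![vend (nth _ _ r).2 _]vendC.
by do 4!case: vend.
Qed.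

Lemma connect_dadjC : connect_sym (dadj D).
Proof. exact: sym_connect_sym dadj_sym. Qed.

Lemma mem_dcomp q : q \in dcomp D q.
Proof. by rewrite inE connect0. Qed.

Lemma dcomp_connect q r : connect (dadj D) q r -> dcomp D q = dcomp D r.
Proof. by move=> qr; apply/setP => x; rewrite !inE (same_connect connect_dadjC qr). Qed.

Lemma dcomp_in_dcomps q : dcomp D q \in dcomps D.
Proof. exact: imset_f. Qed.

Lemma mem_cover_dcomps B q : B \subset dcomps D -> (q \in cover B) = (dcomp D q \in B).
Proof.
move=> /subsetP sB; apply/bigcupP/idP => [[C CB qC]|qB]; last by exists (dcomp D q); rewrite ?mem_dcomp.
have /imsetP[r _ eC] := sB C CB; move: qC; rewrite eC inE => rq.
by rewrite -(dcomp_connect rq) -eC.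
Qed.

(** Stated for an abstract predicate [a] in order to serve both loop points and vertices: an item
    all of whose edges lie in one component survives in a subdiagram exactly when that component is
    chosen. *)
Lemma has_subdiag B (a : pred (dend * dend)) (o : {set 'I_m}) :
  B \subset dcomps D -> (exists q, a (edge q)) -> (forall q, a (edge q) -> dcomp D q = o) ->
  has a [seq edge q | q <- enum (cover B)] = (o \in B).
Proof.
move=> sB [q0 aq0] Ho; rewrite has_map; apply/hasP/idP => [[q qB /= aq]|oB].
  by rewrite -(Ho q aq) -mem_cover_dcomps // -mem_enum.
by exists q0 => //; rewrite mem_enum mem_cover_dcomps // (Ho q0 aq0).
Qed.
End DiagComponents.

(** Each element of [s] passes exactly one filter, that of the block containing its owner, so
    sorting by blocks only permutes [s]. *)
Lemma flatten_filter_perm (T : eqType) (U : finType) (s : seq T) (own : T -> U)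
    (P : {set {set U}}) (X : {set U}) :
  partition P X -> (forall x, x \in s -> own x \in X) ->
  perm_eq (flatten [seq [seq x <- s | own x \in B] | B : {set U} <- enum P]) s.
Proof.
move=> pP oX; apply/allP => x _ /=; apply/eqP.
rewrite count_flatten -map_comp sumnE big_map big_enum /=.
have [xs|xs] := boolP (x \in s); last first.
  rewrite (count_memPn xs) big1 // => B _ /=.
  by apply/count_memPn; rewrite mem_filter (negPf xs) andbF.
have xc : own x \in cover P by rewrite (cover_partition pP) oX.
rewrite (bigD1 (pblock P (own x))) ?pblock_mem //= big1 ?addn0 => [|B /andP[BP nB]].
  rewrite count_filter; apply: eq_count => y /=.
  by case: eqVneq => //= ->; rewrite mem_pblock.
apply/count_memPn; rewrite mem_filter negb_and; apply/orP; left.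
by apply: contraNN nB => xB; rewrite (def_pblock (partition_trivIset pP) BP xB).
Qed.

Lemma big_dmul (T : Type) (s : seq T) (F : T -> diag) :
  \big[dmul/dunit]_(B <- s) F B =
  Diag (flatten [seq dpts (F B) | B <- s]) (flatten [seq dverts (F B) | B <- s])
       (flatten [seq dedges (F B) | B <- s]).
Proof.
elim: s => [|B s IH]; first by rewrite big_nil.
by rewrite big_cons IH.
Qed.

Definition touch_pt (p : nat) (x : dend * dend) := (x.1 == (p, None)) || (x.2 == (p, None)).
Definition touch_vert (v : nat) (x : dend * dend) :=
  vend (v, Some ord0) x.1 || vend (v, Some ord0) x.2.

Lemma eadj_touch_vert v x y : touch_vert v x -> touch_vert v y -> eadj x y.
Proof.
rewrite /touch_vert /eadj /vend /=.
by case/orP=> /andP[-> /eqP <-] /orP[] /andP[-> /eqP <-]; rewrite eqxx ?orbT.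
Qed.

(** * The product of the blocks of a partition *)

Section PartitionProduct.
Variables (D : diag) (own : nat -> {set 'I_(size (dedges D))}).
Let edge (q : 'I_(size (dedges D))) := nth dedge0 (dedges D) q.
Hypothesis ownP : forall p, p \in dpts D ->
  (exists q : 'I_(size (dedges D)), touch_pt p (edge q)) /\
  (forall q : 'I_(size (dedges D)), touch_pt p (edge q) -> dcomp D q = own p).
Hypothesis vertP : forall v, v \in dverts D ->
  exists q : 'I_(size (dedges D)), touch_vert v (edge q).

Definition part_diag (P : {set {set {set 'I_(size (dedges D))}}}) : diag :=
  \big[dmul/dunit]_(B <- enum P) subdiag D (cover B).

Lemma part_diag_pts P : partition P (dcomps D) ->
  dpts (part_diag P) = flatten [seq [seq p <- dpts D | own p \in B] | B : {set {set 'I_(size (dedges D))}} <- enum P].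
Proof.
move=> pP; rewrite /part_diag big_dmul /=; congr flatten; apply/eq_in_map => B.
rewrite mem_enum => BP; apply: eq_in_filter => p pD.
have [H1 H2] := ownP pD; apply: (has_subdiag (partitionS pP BP) H1 H2).
Qed.

Lemma own_dcomps p : p \in dpts D -> own p \in dcomps D.
Proof. by move=> /ownP[[q tq] H]; rewrite -(H q tq) dcomp_in_dcomps. Qed.

(** Cutting a diagram into blocks and gluing them merely rearranges its data. The weight of the
    product thus differs from that of [D] only through the order of the loop points. *)
Lemma part_diag_perm P : partition P (dcomps D) ->
  [/\ perm_eq (dpts (part_diag P)) (dpts D), perm_eq (dverts (part_diag P)) (dverts D)
    & perm_eq (dedges (part_diag P)) (dedges D)].
Proof.
move=> pP; split.
- rewrite part_diag_pts //; apply: flatten_filter_perm pP _ => p; exact: own_dcomps.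
(* The component of a vertex is that of any edge meeting it, since such edges are adjacent to each
   other. On vertices of [D] the default [set0] is never reached, by [vertP]. *)
- pose vo v := odflt set0 (omap (dcomp D)
     [pick q : 'I_(size (dedges D)) | touch_vert v (edge q)]).
  have voP v : v \in dverts D -> (exists q : 'I_(size (dedges D)), touch_vert v (edge q)) /\
      (forall q : 'I_(size (dedges D)), touch_vert v (edge q) -> dcomp D q = vo v).
    move=> vD; split=> [|q tq]; first by have [q tq] := vertP vD; exists q.
    rewrite /vo; case: pickP => [r tr|/(_ q)]; last by rewrite tq.
    by apply: dcomp_connect; apply: connect1; apply: eadj_touch_vert tq tr.
  have -> : dverts (part_diag P) =
      flatten [seq [seq v <- dverts D | vo v \in B] | B : {set {set 'I_(size (dedges D))}} <- enum P].
    rewrite /part_diag big_dmul /=; congr flatten; apply/eq_in_map => B.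
    rewrite mem_enum => BP; apply: eq_in_filter => v vD.
    have [_ H2] := voP v vD; exact: (has_subdiag (partitionS pP BP) (vertP vD) H2).
  apply: flatten_filter_perm pP _ => v vD; have [[q tq] H] := voP v vD.
  by rewrite -(H _ tq) dcomp_in_dcomps.
rewrite /part_diag big_dmul /=.
have -> : [seq dedges (subdiag D (cover B)) | B <- enum P] =
   [seq map edge s | s <- [seq [seq q <- enum 'I_(size (dedges D)) | dcomp D q \in B] | B : {set {set 'I_(size (dedges D))}} <- enum P]].
  rewrite -map_comp; apply/eq_in_map => B; rewrite mem_enum => BP /=.
  congr map; rewrite {1}enumT; apply: eq_filter => q.
  exact: mem_cover_dcomps (partitionS pP BP).
rewrite -map_flatten.
have eD : [seq edge q | q <- enum 'I_(size (dedges D))] = dedges D.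
  by rewrite -[RHS](mkseq_nth dedge0) /mkseq -val_enum_ord -map_comp.
rewrite -[X in perm_eq _ X]eD; apply: perm_map; apply: flatten_filter_perm pP _ => q _; exact: dcomp_in_dcomps.
Qed.
End PartitionProduct.

Lemma partition_card_le1 (T : finType) (X : {set T}) (P : {set {set T}}) : X != set0 ->
  partition P X && ~~ (1 < #|P|)%N = (P == [set X]).
Proof.
move=> X0; apply/andP/eqP => [[pP]|->].
  rewrite -leqNgt; case: (set_0Vmem P) => [P0|[B BP]].
    by move: X0; rewrite -(cover_partition pP) P0 /cover big_set0 eqxx.
  move=> c1; have /cards1P[C eP] : #|P| == 1%N.
    by rewrite eqn_leq c1 card_gt0; apply/set0Pn; exists B.
  by rewrite -(cover_partition pP) eP /cover big_set1.
by rewrite cards1 /partition /cover big_set1 eqxx trivIset1 inE eq_sym X0.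
Qed.

(** The leading term of the projection is the missing summand for the partition into one block,
    whose coefficient [mobius 1] is 1. Nonemptiness excludes the partition without blocks. *)
Lemma wbar_mobius (K : fieldType) (n : nat) (br : 'rV[K]_n -> 'rV[K]_n -> 'rV[K]_n)
    (form : 'rV[K]_n -> 'rV[K]_n -> K) (E Ed : 'M[K]_n) (D : diag) (w : seq 'I_n) :
  dcomps D != set0 ->
  wsys br form E Ed (part_diag [set dcomps D]) w = wsys br form E Ed D w ->
  wbar br form E Ed D w = \sum_(P | partition P (dcomps D))
     mobius K #|P| * wsys br form E Ed (part_diag P) w.
Proof.
move=> X0 eD; rewrite (bigID (fun P : {set {set {set _}}} => (1 < #|P|)%N)) /=.
rewrite [X in _ + X](big_pred1 [set dcomps D]) => [|P]; last exact: partition_card_le1.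
rewrite cards1 mobius1 mul1r eD addrC; congr (_ + _); rewrite -sumrN.
by apply: eq_bigr => P _; rewrite mulNr.
Qed.

(** * The components of [Jdiag] and the loop points of its blocks *)

Section JacobiComponents.
Variables (i j : nat).
Let N := (2 * j + 3)%N.
Let D := Jdiag i j.
Let m := size (dedges D).
Let edge (q : 'I_m) := nth dedge0 (dedges D) q.
Implicit Types (p k : nat) (q r : 'I_m).

Definition chord_edge k : dend * dend := ((k, None), ((N - k)%N, None)).

Lemma touch_chord_edge p k : touch_pt p (chord_edge k) = (k == p) || ((N - k)%N == p).
Proof. by rewrite /touch_pt /= !xpair_eqE !andbT. Qed.

Lemma count_touch_chords p : (p <= N)%N -> count (touch_pt p) (map chord_edge (iota 1 j)) =
  ((0 < p <= j)%N || (j.+2 < p < N)%N).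
Proof.
move=> pN; rewrite count_map.
have cm k : count (pred1 k) (iota 1 j) = (0 < k <= j)%N.
  by rewrite count_uniq_mem ?iota_uniq // mem_iota; congr nat_of_bool; lia.
have [hp|hp] := boolP ((0 < p <= j)%N).
  rewrite (eq_in_count (a2 := pred1 p)) ?cm ?hp // => k; rewrite mem_iota => hk /=.
  by rewrite touch_chord_edge; move: hk hp; rewrite /N; lia.
have [hq|hq] := boolP ((j.+2 < p < N)%N).
  rewrite (eq_in_count (a2 := pred1 (N - p)%N)) ?cm => [|k]; last first.
    rewrite mem_iota => hk /=; rewrite touch_chord_edge; move: hk hp hq pN; rewrite /N; lia.
  by congr nat_of_bool; move: hq; rewrite /N; lia.
rewrite (eq_in_count (a2 := pred0)) ?count_pred0 // => k; rewrite mem_iota => hk /=.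
rewrite touch_chord_edge; move: hk hp hq pN; rewrite /N; lia.
Qed.

Lemma Jdiag_edges_perm2 i' : perm_eq (dedges (Jdiag i'.+1 j))
  ([:: ((0%N, Some s1), (j.+1, None)); ((i'.+1, Some s2), (j.+2, None));
       ((i', Some s0), (0%N, None)); (((i'.+1 + i')%N, Some s0), (N, None))] ++
   [seq ((k, Some s0), (k.+1, Some s1)) | k <- iota 0 i'] ++
   [seq (((i'.+1 + k)%N, Some s0), ((i'.+1 + k.+1)%N, Some s2)) | k <- iota 0 i'] ++
   [seq ((k, Some s2), ((i'.+1 + k)%N, Some s1)) | k <- iota 0 i'.+1] ++
   map chord_edge (iota 1 j)).
Proof.
apply: perm_trans (Jdiag_edges_perm j i') _.
rewrite -[X in perm_eq _ (X ++ _)]/([:: _; _] ++ [:: _; _]) -!catA perm_cat2l.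
rewrite !(catA [:: _; _]) !catA perm_cat2r -!catA.
exact: ladder_edges_perm.
Qed.

(** Exactly one edge ends at each loop point; this makes the component of a loop point well
    defined. *)
Lemma count_touch p : (p <= N)%N -> count (touch_pt p) (dedges D) = 1%N.
Proof.
move=> pN; rewrite /D; case: i => [|i'].
  rewrite [dedges _]/= /= -/(N) -[map _ _]/(map chord_edge (iota 1 j)) count_touch_chords //.
  rewrite /touch_pt /= !xpair_eqE !andbT; move: pN; rewrite /N; lia.
have nS s : (Some s == None :> option 'I_3) = false by [].
have z (F : nat -> dend * dend) s :
    (forall k, touch_pt p (F k) = false) -> count (touch_pt p) (map F s) = 0%N.
  by move=> H; rewrite count_map (eq_count (a2 := pred0)) ?count_pred0.
rewrite (permP (Jdiag_edges_perm2 i')) !count_cat count_touch_chords // !z; first last.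
- by move=> k; rewrite /touch_pt /= !xpair_eqE !nS !andbF.
- by move=> k; rewrite /touch_pt /= !xpair_eqE !nS !andbF.
- by move=> k; rewrite /touch_pt /= !xpair_eqE !nS !andbF.
rewrite /= /touch_pt !xpair_eqE !nS !andbF !andbT /=; move: pN; rewrite /N; lia.
Qed.

Lemma nth_edge x : x \in dedges D -> exists q, edge q = x.
Proof. by move=> /(nthP dedge0)[q qm <-]; exists (Ordinal qm). Qed.

Lemma count1_nth (T : Type) (x0 : T) (a : pred T) (s : seq T) (q r : nat) :
  count a s = 1%N -> (q < size s)%N -> (r < size s)%N ->
  a (nth x0 s q) -> a (nth x0 s r) -> q = r.
Proof.
elim: s q r => [|x s IH] [|q] [|r] //= c; rewrite ?ltnS => qs rs.
- move=> ax ar; move: c; rewrite ax => -[] /eqP; rewrite -leqn0 leqNgt -has_count.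
  by case/negP; apply/(has_nthP x0); exists r.
- move=> aq ax; move: c; rewrite ax => -[] /eqP; rewrite -leqn0 leqNgt -has_count.
  by case/negP; apply/(has_nthP x0); exists q.
move=> aq ar; congr S; apply: IH => //.
case ax: (a x) c => //; rewrite add1n => -[] /eqP; rewrite -leqn0 leqNgt -has_count.
by case/negP; apply/(has_nthP x0); exists q.
Qed.

Lemma touch_inj p q r : (p <= N)%N -> touch_pt p (edge q) -> touch_pt p (edge r) -> q = r.
Proof. by move=> pN tq tr; apply: val_inj; apply: count1_nth (count_touch pN) _ _ tq tr. Qed.

(* The component of the loop point [p]. *)
Definition Jown p : {set 'I_m} :=
  odflt set0 (omap (dcomp D) [pick q | touch_pt p (edge q)]).

Lemma JownE p q : (p <= N)%N -> touch_pt p (edge q) -> Jown p = dcomp D q.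
Proof.
move=> pN tq; rewrite /Jown; case: pickP => [r tr|/(_ q)]; last by rewrite tq.
by rewrite (touch_inj pN tr tq).
Qed.

Lemma JownP p : (p <= N)%N -> (exists q, touch_pt p (edge q)) /\
  (forall q, touch_pt p (edge q) -> dcomp D q = Jown p).
Proof.
move=> pN; split=> [|q tq]; last by rewrite (JownE pN tq).
have : has (touch_pt p) (dedges D) by rewrite has_count count_touch.
by case/(has_nthP dedge0) => q qm tq; exists (Ordinal qm).
Qed.

Lemma Jown_eq p p' x : (p <= N)%N -> (p' <= N)%N -> x \in dedges D ->
  touch_pt p x -> touch_pt p' x -> Jown p = Jown p'.
Proof.
move=> pN pN' /nth_edge[q eq] t t'.
by rewrite (JownE (q := q) pN) ?eq // (JownE (q := q) pN') ?eq.
Qed.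

Lemma chord_edge_in k : (0 < k <= j)%N -> chord_edge k \in dedges D.
Proof.
move=> kj; have kc : chord_edge k \in map chord_edge (iota 1 j).
  by apply: map_f; rewrite mem_iota; lia.
rewrite /D; case: i => [|i'].
  by rewrite [dedges _]/= !inE -/N -[map _ _]/(map chord_edge (iota 1 j)) kc !orbT.
by rewrite (perm_mem (Jdiag_edges_perm2 i')) !mem_cat kc !orbT.
Qed.

Lemma dcomp_isolated q : (edge q).1.2 = None -> (edge q).2.2 = None -> dcomp D q = [set q].
Proof.
move=> e1 e2; apply/setP => r; rewrite !inE; apply/connectP/eqP => [[[|x s] /=]|->].
- by move=> _ ->.
- by rewrite /dadj /eadj -/(edge q) /vend e1 e2.
by exists [::].
Qed.

Lemma Jown_chord k : (0 < k <= j)%N -> exists2 q, edge q = chord_edge k & Jown k = [set q].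
Proof.
move=> kj; have [q eq] := nth_edge (chord_edge_in kj); exists q => //.
rewrite (JownE (q := q)); last by rewrite eq touch_chord_edge eqxx.
  by rewrite dcomp_isolated ?eq.
by rewrite /N; lia.
Qed.

Lemma Jown_opp k : (0 < k <= j)%N -> Jown (N - k) = Jown k.
Proof.
move=> kj; apply: Jown_eq (chord_edge_in kj) _ _; rewrite ?touch_chord_edge ?eqxx ?orbT //.
  by rewrite /N; lia.
by rewrite /N; lia.
Qed.

Lemma Jown_sep k p : (0 < k <= j)%N -> (p <= N)%N -> Jown p = Jown k -> (p == k) || (p == N - k)%N.
Proof.
move=> kj pN; have [q eq ->] := Jown_chord kj; have [[r tr] H] := JownP pN.
rewrite -(H r tr) => er; have := mem_dcomp r; rewrite er inE => /eqP erq.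
by move: tr; rewrite erq eq touch_chord_edge !(eq_sym p).
Qed.

Lemma touch_vert_l v s y : touch_vert v ((v, Some s), y).
Proof. by rewrite /touch_vert /vend /= eqxx. Qed.

Lemma touch_vert_r v s x : touch_vert v (x, (v, Some s)).
Proof. by rewrite /touch_vert /vend /= eqxx orbT. Qed.

Lemma touch_vert_dcomp v q r :
  touch_vert v (edge q) -> touch_vert v (edge r) -> dcomp D q = dcomp D r.
Proof. by move=> tq tr; apply: dcomp_connect; apply: connect1; apply: eadj_touch_vert tq tr. Qed.

Lemma mem_Jdiag_edgesS i' x : i = i'.+1 -> (x \in dedges D) =
  (x \in [:: ((0%N, Some s1), (j.+1, None)); ((i'.+1, Some s2), (j.+2, None));
       ((i', Some s0), (0%N, None)); (((i'.+1 + i')%N, Some s0), (N, None))] ++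
   [seq ((k, Some s0), (k.+1, Some s1)) | k <- iota 0 i'] ++
   [seq (((i'.+1 + k)%N, Some s0), ((i'.+1 + k.+1)%N, Some s2)) | k <- iota 0 i'] ++
   [seq ((k, Some s2), ((i'.+1 + k)%N, Some s1)) | k <- iota 0 i'.+1] ++
   map chord_edge (iota 1 j)).
Proof. by move=> ei; rewrite /D ei; apply: perm_mem; apply: Jdiag_edges_perm2. Qed.

Lemma rung_in i' k : i = i'.+1 -> (k <= i')%N ->
  ((k, Some s2), ((i'.+1 + k)%N, Some s1)) \in dedges D.
Proof.
move=> ei ki; rewrite (mem_Jdiag_edgesS _ ei) !mem_cat; apply/orP; right.
apply/orP; right; apply/orP; right; apply/orP; left.
by apply/mapP; exists k; rewrite ?mem_iota.
Qed.

Lemma rail_in i' k : i = i'.+1 -> (k < i')%N ->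
  ((k, Some s0), (k.+1, Some s1)) \in dedges D.
Proof.
move=> ei ki; rewrite (mem_Jdiag_edgesS _ ei) !mem_cat; apply/orP; right.
apply/orP; left; by apply/mapP; exists k; rewrite ?mem_iota.
Qed.

(** From an upper vertex one walks right along the rail to the leg at p1, which is loop point 0; [t]
    is the remaining distance. A lower vertex is first joined to the upper rail by its rung. *)
Lemma dcomp_ladder i' v q : i = i'.+1 -> (v < i'.+1 + i'.+1)%N ->
  touch_vert v (edge q) -> dcomp D q = Jown 0.
Proof.
move=> ei.
have upper t r : (t <= i')%N -> touch_vert (i' - t)%N (edge r) -> dcomp D r = Jown 0.
  elim: t r => [|t IH] r ti tr.
    have /nth_edge[q0 eq0] : ((i', Some s0), (0%N, None)) \in dedges D.
      by rewrite (mem_Jdiag_edgesS _ ei) !inE eqxx !orbT.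
    have t0 : touch_pt 0 (edge q0) by rewrite eq0 /touch_pt eqxx orbT.
    rewrite (JownE (leq0n N) t0); apply: touch_vert_dcomp tr _.
    by rewrite eq0 subn0 touch_vert_l.
  have ti' : (i' - t.+1 < i')%N by lia.
  have [q1 eq1] := nth_edge (rail_in ei ti').
  have et : (i' - t.+1).+1 = (i' - t)%N by lia.
  rewrite (touch_vert_dcomp (r := q1) tr) ?eq1 ?touch_vert_l //.
  by apply: IH; [lia | rewrite eq1 et touch_vert_r].
have {}upper k r : (k <= i')%N -> touch_vert k (edge r) -> dcomp D r = Jown 0.
  move=> ki; have -> : k = (i' - (i' - k))%N by lia.
  by apply: upper; lia.
move=> vi tv; have [vi'|vi'] := leqP v i'; first exact: upper tv.
have hk : (v - i'.+1 <= i')%N by lia.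
have [q1 eq1] := nth_edge (rung_in ei hk).
rewrite (touch_vert_dcomp (r := q1) tv) ?eq1.
  by apply: (upper (v - i'.+1)%N) => //; rewrite eq1 touch_vert_l.
by rewrite subnKC // touch_vert_r.
Qed.

Lemma Jown_ladder i' : i = i'.+1 ->
  [/\ Jown j.+1 = Jown 0, Jown j.+2 = Jown 0 & Jown N = Jown 0].
Proof.
move=> ei.
have H p v s : (p <= N)%N -> (v < i'.+1 + i'.+1)%N ->
    ((v, Some s), (p, None)) \in dedges D -> Jown p = Jown 0.
  move=> pN vi /nth_edge[q eq]; rewrite (JownE (q := q)) ?eq /touch_pt ?eqxx ?orbT //.
  by apply: dcomp_ladder ei vi _; rewrite eq touch_vert_l.
split.
- apply: (H _ 0%N s1); rewrite ?(mem_Jdiag_edgesS _ ei) ?inE ?eqxx ?orbT //; rewrite /N; lia.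
- apply: (H _ i'.+1 s2); rewrite ?(mem_Jdiag_edgesS _ ei) ?inE ?eqxx ?orbT //; rewrite /N; lia.
apply: (H _ (i'.+1 + i')%N s0); rewrite ?(mem_Jdiag_edgesS _ ei) ?inE ?eqxx ?orbT //; rewrite /N; lia.
Qed.

Lemma mem_Jdiag_edges0 x : i = 0%N -> (x \in dedges D) =
  (x \in [:: ((0%N, None), (j.+1, None)); ((j.+2, None), (N, None))] ++ map chord_edge (iota 1 j)).
Proof. by move=> ei; rewrite /D ei. Qed.

Lemma Jown_pairs : Jown j.+1 = Jown 0 /\ Jown N = Jown j.+2.
Proof.
case ei: i => [|i']; last by have [-> -> ->] := Jown_ladder ei.
split.
  apply: (@Jown_eq _ _ ((0%N, None), (j.+1, None))); rewrite ?(mem_Jdiag_edges0 _ ei) //.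
  - by rewrite /N; lia.
  - by rewrite inE eqxx.
  by rewrite /touch_pt eqxx orbT.
apply: (@Jown_eq _ _ ((j.+2, None), (N, None))); rewrite ?(mem_Jdiag_edges0 _ ei) //.
- by rewrite /N; lia.
- by rewrite !inE eqxx !orbT.
- by rewrite /touch_pt eqxx orbT.
by rewrite /touch_pt eqxx.
Qed.

Lemma Jown_apart : i = 0%N -> Jown 0 != Jown j.+2.
Proof.
move=> ei.
have /nth_edge[q eq] : ((0%N, None), (j.+1, None)) \in dedges D.
  by rewrite (mem_Jdiag_edges0 _ ei) inE eqxx.
have /nth_edge[r er] : ((j.+2, None), (N, None)) \in dedges D.
  by rewrite (mem_Jdiag_edges0 _ ei) !inE eqxx orbT.
rewrite (JownE (q := q)) ?eq // (JownE (q := r)) ?er /touch_pt ?eqxx //; last by rewrite /N; lia.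
rewrite !dcomp_isolated ?eq ?er //; apply/eqP => /setP /(_ q); rewrite !inE eqxx => /esym/eqP qr.
by move: er; rewrite -qr eq.
Qed.

Lemma dcomp_Jown q : exists2 p, (p \in [:: 0%N; j.+2] ++ iota 1 j) & dcomp D q = Jown p.
Proof.
have edge_in : edge q \in dedges D by apply: mem_nth.
have chordP : edge q \in map chord_edge (iota 1 j) ->
    exists2 p, (p \in [:: 0%N; j.+2] ++ iota 1 j) & dcomp D q = Jown p.
  case/mapP => k kj eq; exists k; first by rewrite mem_cat kj orbT.
  rewrite (JownE (q := q)) ?eq ?touch_chord_edge ?eqxx //.
  by move: kj; rewrite mem_iota /N; lia.
case ei: i => [|i'].
  move: edge_in; rewrite (mem_Jdiag_edges0 _ ei) mem_cat => /orP[|/chordP //].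
  rewrite !inE => /orP[] /eqP eq.
    by exists 0%N; rewrite ?inE // (JownE (q := q)) ?eq.
  exists j.+2; rewrite ?inE ?eqxx ?orbT // (JownE (q := q)) ?eq /touch_pt ?eqxx //.
  by rewrite /N; lia.
have ladderP v s y : (v < i'.+1 + i'.+1)%N -> edge q = ((v, Some s), y) ->
    exists2 p, (p \in [:: 0%N; j.+2] ++ iota 1 j) & dcomp D q = Jown p.
  move=> vi eq; exists 0%N; rewrite ?inE //.
  by apply: dcomp_ladder ei vi _; rewrite eq touch_vert_l.
move: edge_in; rewrite (mem_Jdiag_edgesS _ ei) !mem_cat.
case/orP => [|/orP[/mapP[k]|/orP[/mapP[k]|/orP[/mapP[k]|/chordP //]]]].
- rewrite !inE => /or4P[] /eqP eq; apply: (ladderP _ _ _ _ eq); lia.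
- by rewrite mem_iota => ki eq; apply: (ladderP _ _ _ _ eq); lia.
- by rewrite mem_iota => ki eq; apply: (ladderP _ _ _ _ eq); lia.
by rewrite mem_iota => ki eq; apply: (ladderP _ _ _ _ eq); lia.
Qed.

Lemma Jdiag_vertP v : v \in dverts D -> exists q, touch_vert v (edge q).
Proof.
have -> : dverts D = iota 0 (2 * i) by rewrite /D; case: i.
rewrite mem_iota => /andP[_ vi]; case ei: i => [|i']; first by move: vi; rewrite ei.
rewrite ei in vi; have hk : (v <= i')%N || (v - i'.+1 <= i')%N && (i'.+1 <= v)%N by lia.
case/orP: hk => [hv|/andP[hv hv']].
  by have [q eq] := nth_edge (rung_in ei hv); exists q; rewrite eq touch_vert_l.
have [q eq] := nth_edge (rung_in ei hv); exists q; rewrite eq.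
by rewrite subnKC // touch_vert_r.
Qed.

Definition Jchords : {set {set 'I_m}} := [set x in map Jown (iota 1 j)].

Lemma Jown_inj : {in iota 1 j &, injective Jown}.
Proof.
move=> k k'; rewrite !mem_iota => hk hk' ek.
have kj : (0 < k' <= j)%N by lia.
have kN : (k <= N)%N by rewrite /N; lia.
by have := Jown_sep kj kN ek; rewrite /N; lia.
Qed.

Lemma uniq_Jown : uniq (map Jown (iota 1 j)).
Proof. by rewrite map_inj_in_uniq ?iota_uniq //; apply: Jown_inj. Qed.

Lemma card_Jchords : #|Jchords| = j.
Proof. by rewrite cardsE (card_uniqP uniq_Jown) size_map size_iota. Qed.

Lemma Jown_notin p : p = 0%N \/ p = j.+2 -> Jown p \notin Jchords.
Proof.
move=> hp; rewrite inE; apply/mapP => -[k]; rewrite mem_iota => hk ek.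
have kj : (0 < k <= j)%N by lia.
have pN : (p <= N)%N by rewrite /N; case: hp => ->; lia.
by have := Jown_sep kj pN ek; rewrite /N; case: hp => ->; lia.
Qed.

(** The description is uniform in [i]: the first two components coincide for a ladder with rungs and
    are distinct when [i = 0]. *)
Lemma dcomps_Jdiag : dcomps D = Jown 0 |: (Jown j.+2 |: Jchords).
Proof.
have inD p : (p <= N)%N -> Jown p \in dcomps D.
  by move=> /JownP[[q tq] H]; rewrite -(H q tq) dcomp_in_dcomps.
apply/setP => x; apply/idP/idP => [/imsetP[q _ ->]|].
  have [p] := dcomp_Jown q; rewrite !inE => /or3P[/eqP->|/eqP->|hp] ->.
  - by rewrite eqxx.
  - by rewrite eqxx orbT.
  by rewrite map_f ?orbT.
rewrite !inE => /or3P[/eqP->|/eqP->|/mapP[k hk ->]]; apply: inD => //.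
  by rewrite /N; lia.
by move: hk; rewrite mem_iota /N; lia.
Qed.

Definition block_chords (B : {set {set 'I_m}}) := [seq k <- iota 1 j | Jown k \in B].

Lemma size_block_chords B : size (block_chords B) = #|B :&: Jchords|.
Proof.
rewrite -(size_map Jown) -filter_map.
rewrite -(card_uniqP (filter_uniq _ uniq_Jown)); apply: eq_card => x.
by rewrite mem_filter !inE.
Qed.

Lemma iota_Jpts : iota 0 (2 * j + 4) = 0%N :: iota 1 j ++ [:: j.+1; j.+2] ++
   map (subn N) (rev (iota 1 j)) ++ [:: N].
Proof.
have -> : (2 * j + 4 = 1 + (j + (2 + (j + 1))))%N by lia.
rewrite !iotaD add0n add1n /=; congr (_ :: _ ++ [:: _, _ & _ ++ _]); last first.
  by congr [:: _]; rewrite /N; lia.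
apply: (@eq_from_nth _ 0%N); first by rewrite size_map size_rev !size_iota.
move=> t; rewrite size_iota => tj.
rewrite nth_iota // (nth_map 0%N) ?size_rev ?size_iota // nth_rev ?size_iota //.
by rewrite nth_iota /N; lia.
Qed.

Definition leg_if (b : bool) (l : seq nat) := if b then l else [::].

(** Every block is again of the same shape, nested chords around whichever of the legs it contains;
    this is why only the number of its chords enters its weight. *)
Lemma block_pts (B : {set {set 'I_m}}) : [seq p <- dpts D | Jown p \in B] =
  leg_if (Jown 0 \in B) [:: 0%N] ++
  arc j (block_chords B) (leg_if (Jown 0 \in B) [:: j.+1] ++ leg_if (Jown j.+2 \in B) [:: j.+2])
  ++ leg_if (Jown j.+2 \in B) [:: N].
Proof.
have -> : dpts D = iota 0 (2 * j + 4) by rewrite /D; case: i.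
have [e1 e2] := Jown_pairs.
rewrite iota_Jpts -cat1s !filter_cat /arc -!catA filter_map.
congr (_ ++ _ ++ _).
rewrite [X in _ ++ X ++ _ = _](_ : _ = map (subn N) (rev (block_chords B))).
  by rewrite /= e1 e2; case: (Jown 0 \in B); case: (Jown j.+2 \in B).
congr map; rewrite /block_chords -filter_rev; apply: eq_in_filter => k.
by rewrite mem_rev mem_iota /= => hk; rewrite Jown_opp //; lia.
Qed.
End JacobiComponents.

(** * The projected weight system *)

Lemma mem_split (T : eqType) (x : T) (s : seq T) :
  x \in s -> exists s1 s2, s = s1 ++ x :: s2.
Proof. by case/path.splitPr => s1 s2; exists s1, s2. Qed.

Section Assembly.
Variables (K : fieldType) (n : nat) (br : 'rV[K]_n -> 'rV[K]_n -> 'rV[K]_n).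
Variables (lam : K) (E Ed : 'M[K]_n).
Hypothesis lieP : lie_axioms br.
Hypothesis E_unit : E \in unitmx.
Hypothesis dualP :
  forall a b : 'I_n, lam * killing br (row a E) (row b Ed) = (a == b)%:R.
Hypothesis lam_neq0 : lam != 0.
Hypothesis two_neq0 : (2 : K) != 0.
Implicit Types (i j : nat) (w : seq 'I_n) (ss : seq (seq nat)).

Let form x y : K := lam * killing br x y.
Let named := named_val br E Ed.
Let bval := ladder_val br E Ed.
Let sval := star_val br lam E Ed.

Lemma npairs_cat j s s' : npairs j (s ++ s') = npairs j s ++ npairs j s'.
Proof. by rewrite /npairs map_cat flatten_cat. Qed.

Lemma perm_npairs_flatten j ss :
  perm_eq (npairs j (flatten (rev ss))) (flatten [seq arc j s [::] | s <- ss]).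
Proof.
elim: ss => [|s ss IH] //=.
rewrite rev_cons -cats1 flatten_cat /= cats0 npairs_cat perm_catC perm_cat //.
by have := perm_npairs j s [::]; rewrite cats0.
Qed.

(** [Wa] and [Wb] are the words of the blocks that contain legs, of which there are at most two. All
    blocks made of chords only, wherever they stand in the enumeration, are moved to the front as
    central factors. *)
Lemma named_pull i j ks ss1 ss2 ss3 Wa Wb :
  uniq ks -> chord_range j ks -> {subset flatten (ss1 ++ ss2 ++ ss3) <= ks} ->
  let F ss := flatten [seq arc j s [::] | s <- ss] in
  let kt := flatten (rev ss3) ++ flatten (rev ss2) ++ flatten (rev ss1) in
  uniq (F ss1 ++ Wa ++ F ss2 ++ Wb ++ F ss3) ->
  tcong br (named j i ks (F ss1 ++ Wa ++ F ss2 ++ Wb ++ F ss3))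
           (named j i ks (npairs j kt ++ Wa ++ Wb)) /\
  uniq (npairs j kt ++ Wa ++ Wb).
Proof.
move=> uk rk sub F kt uq.
have sub1 : {subset flatten ss1 <= ks}.
  by move=> k kk; apply: sub; rewrite !flatten_cat !mem_cat kk.
have sub2 : {subset flatten ss2 <= ks}.
  by move=> k kk; apply: sub; rewrite !flatten_cat !mem_cat kk orbT.
have sub3 : {subset flatten ss3 <= ks}.
  by move=> k kk; apply: sub; rewrite !flatten_cat !mem_cat kk !orbT.
have pF ss := permP (perm_npairs_flatten j ss).
have uq1 : uniq ((npairs j (flatten (rev ss1)) ++ Wa) ++ F ss2 ++ Wb ++ F ss3).
  rewrite -(perm_uniq (_ : perm_eq (F ss1 ++ Wa ++ F ss2 ++ Wb ++ F ss3) _)) //.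
  by apply/permP => a; rewrite !count_cat !pF /F; ring.
have uq2 : uniq ((npairs j (flatten (rev ss2)) ++ npairs j (flatten (rev ss1)) ++ Wa ++ Wb)
    ++ F ss3 ++ [::]).
  rewrite -(perm_uniq (_ : perm_eq (F ss1 ++ Wa ++ F ss2 ++ Wb ++ F ss3) _)) //.
  by apply/permP => a; rewrite !count_cat !pF /F /=; ring.
split; last first.
  rewrite -(perm_uniq (_ : perm_eq (F ss1 ++ Wa ++ F ss2 ++ Wb ++ F ss3) _)) //.
  by apply/permP => a; rewrite /kt !npairs_cat !count_cat !pF /F /=; ring.
have H1 := named_segs lieP E_unit dualP i (ss := ss1) (l := [::]) uk rk sub1 uq.
have H2 := named_segs lieP E_unit dualP i (ss := ss2) uk rk sub2 uq1.
have H3 := named_segs lieP E_unit dualP i (ss := ss3) uk rk sub3 uq2.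
apply: tcong_trans H1 _.
rewrite /= in H2; rewrite /= catA; apply: tcong_trans H2 _.
rewrite !cats0 -!catA in H3; rewrite -!catA.
by apply: tcong_trans H3 _; rewrite /kt !npairs_cat -!catA; apply: tcong_refl.
Qed.

(** * The partition sum of a single diagram *)

Section OneDiagram.
Variables i j : nat.
Let D := Jdiag i j.
Let m := size (dedges D).
Let L1 := Jown i j 0.
Let L2 := Jown i j j.+2.
Let N := (2 * j + 3)%N.
Let bc := @block_chords i j.
Implicit Types (P : {set {set {set 'I_m}}}) (B : {set {set 'I_m}}).

Lemma Jdpts : dpts D = iota 0 (2 * j + 4).
Proof. by rewrite /D; case: i. Qed.

Lemma JownP_pts p : p \in dpts D ->
  (exists q : 'I_m, touch_pt p (nth dedge0 (dedges D) q)) /\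
  (forall q : 'I_m, touch_pt p (nth dedge0 (dedges D) q) -> dcomp D q = Jown i j p).
Proof. by rewrite Jdpts mem_iota => hp; apply: JownP; lia. Qed.

Definition part_word P : seq nat :=
  flatten [seq [seq p <- dpts D | Jown i j p \in B] | B : {set {set 'I_m}} <- enum P].

Lemma part_word_perm P : partition P (dcomps D) -> perm_eq (part_word P) (iota 0 (2 * j + 4)).
Proof.
move=> pP; have [+ _ _] := part_diag_perm JownP_pts (@Jdiag_vertP i j) pP.
by rewrite (part_diag_pts JownP_pts pP) -Jdpts.
Qed.

Lemma wsys_part P w : partition P (dcomps D) ->
  wsys br form E Ed (part_diag P) w = named j i (iota 1 j) (part_word P) w.
Proof.
move=> pP; have [h1 h2 h3] := part_diag_perm JownP_pts (@Jdiag_vertP i j) pP.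
rewrite (wsys_Jdiag lieP E_unit dualP w h3 h2); last by rewrite -Jdpts.
by rewrite (part_diag_pts JownP_pts pP).
Qed.

Lemma dcomps_neq0 : dcomps D != set0.
Proof. by apply/set0Pn; exists L1; rewrite dcomps_Jdiag setU11. Qed.

Lemma wbar_Jdiag w : wbar br form E Ed D w = \sum_(P | partition P (dcomps D))
   mobius K #|P| * wsys br form E Ed (part_diag P) w.
Proof.
apply: wbar_mobius; first exact: dcomps_neq0.
have pT : partition [set dcomps D] (dcomps D).
  by rewrite /partition /cover big_set1 eqxx trivIset1 inE eq_sym dcomps_neq0.
rewrite wsys_part // (wsys_Jdiag lieP E_unit dualP w (perm_refl _) (perm_refl _)); last first.
  by rewrite -/D Jdpts.
rewrite /named; congr (named_val _ _ _ _ _ _ _ _).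
rewrite /part_word enum_set1 /= cats0; apply/all_filterP/allP => p pD.
by have [[q tq] H] := JownP_pts pD; rewrite -(H q tq) dcomp_in_dcomps.
Qed.

Lemma block_chords_perm P : partition P (dcomps D) ->
  perm_eq (flatten [seq bc B | B <- enum P]) (iota 1 j).
Proof.
move=> pP; apply: flatten_filter_perm pP _ => k hk.
by rewrite dcomps_Jdiag !inE map_f ?orbT.
Qed.

Lemma block_pts_isolated B : L1 \notin B -> L2 \notin B ->
  [seq p <- dpts D | Jown i j p \in B] = arc j (bc B) [::].
Proof. by move=> /negPf n1 /negPf n2; rewrite block_pts -/L1 -/L2 n1 n2 /= cats0. Qed.

Lemma map_block_isolated (s : seq {set {set 'I_m}}) :
  {in s, forall B, (L1 \notin B) && (L2 \notin B)} ->
  [seq [seq p <- dpts D | Jown i j p \in B] | B : {set {set 'I_m}} <- s] =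
  [seq arc j t [::] | t <- map bc s].
Proof.
move=> H; rewrite -map_comp; apply/eq_in_map => B /H /andP[n1 n2].
exact: block_pts_isolated.
Qed.

Lemma iota_range : chord_range j (iota 1 j).
Proof. by move=> k; rewrite mem_iota; lia. Qed.

Lemma notin_block P B B' x : partition P (dcomps D) -> B \in P -> B' \in P -> B' != B ->
  x \in B -> x \notin B'.
Proof.
move=> pP BP BP' nB xB; apply: contra nB => xB'; have tP := partition_trivIset pP.
by rewrite -(def_pblock tP BP xB) (def_pblock tP BP' xB').
Qed.

Lemma flatten_block_sub (s : seq {set {set 'I_m}}) : {subset flatten (map bc s) <= iota 1 j}.
Proof. by move=> k /flattenP[_ /mapP[B _ ->]]; rewrite mem_filter => /andP[]. Qed.

(** The block with all four legs is the ladder crossed by its own chords; every other chord becomes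
    a factor C. *)
Lemma wsys_part_together P B : partition P (dcomps D) -> B \in P -> L1 \in B -> L2 \in B ->
  tcong br (wsys br form E Ed (part_diag P)) (bval i (size (bc B)) (j - size (bc B))).
Proof.
move=> pP BP h1 h2.
have [s1 [s2 eP]] : exists s1 s2, enum P = s1 ++ B :: s2.
  by apply: mem_split; rewrite mem_enum.
have uE : uniq (s1 ++ B :: s2) by rewrite -eP enum_uniq.
have pc := block_chords_perm pP; have pw := part_word_perm pP.
have iso : {in s1 ++ s2, forall B', (L1 \notin B') && (L2 \notin B')}.
  move=> B' hB'; have nB : B' != B.
    apply: contraTneq hB' => ->; move: uE; rewrite uniq_catC /= mem_cat => /andP[+ _].
    by rewrite mem_cat orbC.
  have BP' : B' \in P.
    by rewrite -mem_enum eP; move: hB'; rewrite !mem_cat inE => /orP[]->; rewrite ?orbT.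
  by rewrite (notin_block pP BP BP' nB h1) (notin_block pP BP BP' nB h2).
have ew : part_word P = flatten [seq arc j s [::] | s <- map bc s1] ++
    (0%N :: arc j (bc B) [:: j.+1; j.+2] ++ [:: N]) ++
    flatten [seq arc j s [::] | s <- map bc s2] ++ [::] ++ flatten [::].
  rewrite /part_word eP map_cat flatten_cat /= !map_block_isolated.
  - by rewrite block_pts -/L1 -/L2 h1 h2 /= cats0.
  - by move=> B' hB'; apply: iso; rewrite mem_cat hB' orbT.
  by move=> B' hB'; apply: iso; rewrite mem_cat hB'.
have uw : uniq (part_word P) by rewrite (perm_uniq pw) iota_uniq.
rewrite ew in uw.
have sub : {subset flatten (map bc s1 ++ map bc s2 ++ [::]) <= iota 1 j}.
  by rewrite cats0 -map_cat; apply: flatten_block_sub.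
have [H _] := named_pull i (ss3 := [::]) (iota_uniq 1 j) iota_range sub uw.
apply: tcong_trans (tcong_trans _ H) _.
  by apply: tcong_eq => w; rewrite wsys_part // ew.
rewrite cats0; set kt := flatten _ ++ _.
have pk : perm_eq (iota 1 j) (kt ++ bc B).
  rewrite perm_sym; apply: perm_trans pc; rewrite eP map_cat flatten_cat /kt /=.
  apply/permP => a; rewrite !count_cat.
  rewrite !(permP (perm_flatten (permEl (perm_rev _)))); ring.
have sz : size kt = (j - size (bc B))%N.
  by have := perm_size pk; rewrite size_iota size_cat => ->; rewrite addnK.
apply: tcong_eq => w; rewrite -sz.
exact: (named_val_eval br E Ed i (iota_uniq 1 j) iota_range pk).
Qed.

(** Both blocks are isolated chords p1p2 and p3p4 crossed by chords of their own, and only the total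
    number of crossings matters. *)
Lemma wsys_part_apart P B B' : i = 0%N -> partition P (dcomps D) -> B \in P -> B' \in P ->
  B != B' -> L1 \in B -> L2 \in B' ->
  tcong br (wsys br form E Ed (part_diag P))
    (sval (size (bc B) + size (bc B')) (j - (size (bc B) + size (bc B')))).
Proof.
move=> ei pP BP BP' nB h1 h2.
have pc := block_chords_perm pP; have pw := part_word_perm pP.
have eB : [seq p <- dpts D | Jown i j p \in B] = 0%N :: arc j (bc B) [:: j.+1].
  have h2' : L2 \notin B by apply: notin_block pP BP' BP nB h2.
  by rewrite block_pts -/L1 -/L2 h1 (negPf h2') /= cats0.
have eB' : [seq p <- dpts D | Jown i j p \in B'] = arc j (bc B') [:: j.+2] ++ [:: N].
  have h1' : L1 \notin B' by apply: notin_block pP BP BP' _ h1; rewrite eq_sym.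
  by rewrite block_pts -/L1 -/L2 h2 (negPf h1').
(* The enumeration may list either block first, so both orders of the two factors occur and lead to
   [named_star12] or [named_star21]. *)
have split2 A A' : A \in P -> A' \in P -> A != A' ->
    (exists s1 s2 s3, enum P = s1 ++ A :: s2 ++ A' :: s3) \/
    (exists s1 s2 s3, enum P = s1 ++ A' :: s2 ++ A :: s3).
  move=> AP AP' nA.
  have [hA hA'] : A \in enum P /\ A' \in enum P by rewrite !mem_enum.
  have [s1 [s2 eP]] := mem_split hA.
  move: hA'; rewrite eP mem_cat inE eq_sym (negPf nA) /= => /orP[]/mem_split[t1 [t2 et]].
    by right; exists t1, t2, s2; rewrite et -catA.
  by left; exists s1, t1, t2; rewrite et.
have key A A' s1 s2 s3 : enum P = s1 ++ A :: s2 ++ A' :: s3 -> (A = B /\ A' = B' \/ A = B' /\ A' = B) ->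
  exists kt, [/\ perm_eq (iota 1 j) (kt ++ bc A ++ bc A'),
     uniq (npairs j kt ++ [seq p <- dpts D | Jown i j p \in A]
                       ++ [seq p <- dpts D | Jown i j p \in A'])
   & tcong br (wsys br form E Ed (part_diag P)) (named j i (iota 1 j)
       (npairs j kt ++ [seq p <- dpts D | Jown i j p \in A]
                    ++ [seq p <- dpts D | Jown i j p \in A']))].
  move=> eP AB.
  have uE : uniq (s1 ++ A :: s2 ++ A' :: s3) by rewrite -eP enum_uniq.
  have iso : {in s1 ++ s2 ++ s3, forall C : {set {set 'I_m}}, (L1 \notin C) && (L2 \notin C)}.
    move=> C hC.
    have uE' : uniq (A :: A' :: s1 ++ s2 ++ s3).
      rewrite -(perm_uniq (_ : perm_eq (s1 ++ A :: s2 ++ A' :: s3) _)) //.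
      by apply/permP => a; rewrite /= !count_cat /= !count_cat /=; ring.
    have CP : C \in P.
      rewrite -mem_enum eP; move: hC; rewrite !(mem_cat, inE).
      by case/or3P=> ->; rewrite ?orbT.
    have nA : C != A.
      apply: contraTneq hC => ->; move: uE'; rewrite /= inE negb_or => /andP[/andP[_ ->] _] //.
    have nA' : C != A'.
      apply: contraTneq hC => ->; move: uE'; rewrite /= => /and3P[_ -> _] //.
    have [nCB nCB'] : C != B /\ C != B' by case: AB nA nA' => -[-> ->].
    by rewrite (notin_block pP BP CP nCB h1) (notin_block pP BP' CP nCB' h2).
  set WA := [seq p <- dpts D | Jown i j p \in A]; set WA' := [seq p <- dpts D | Jown i j p \in A'].
  have ew : part_word P = flatten [seq arc j s [::] | s <- map bc s1] ++ WA ++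
     flatten [seq arc j s [::] | s <- map bc s2] ++ WA' ++
     flatten [seq arc j s [::] | s <- map bc s3].
    rewrite /part_word eP !map_cat !flatten_cat /= !map_cat !flatten_cat /=.
    rewrite !map_block_isolated // => C hC; apply: iso; rewrite !mem_cat hC ?orbT //.
  have uw : uniq (part_word P) by rewrite (perm_uniq pw) iota_uniq.
  rewrite ew in uw.
  have sub : {subset flatten (map bc s1 ++ map bc s2 ++ map bc s3) <= iota 1 j}.
    by rewrite -!map_cat; apply: flatten_block_sub.
  have [H uH] := named_pull i (iota_uniq 1 j) iota_range sub uw.
  exists (flatten (rev (map bc s3)) ++ flatten (rev (map bc s2)) ++ flatten (rev (map bc s1))).
  split=> //.
    rewrite perm_sym; apply: perm_trans pc.
    rewrite eP !map_cat !flatten_cat /= !map_cat !flatten_cat /=.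
    apply/permP => a; rewrite !count_cat.
    rewrite !(permP (perm_flatten (permEl (perm_rev _)))); ring.
  apply: tcong_trans _ H.
  by apply: tcong_eq => w; rewrite wsys_part // ew.
have fin A A' kt : perm_eq (iota 1 j) (kt ++ bc A ++ bc A') ->
   [/\ uniq (kt ++ bc A ++ bc A'), chord_range j (kt ++ bc A ++ bc A') &
       size kt = (j - (size (bc A) + size (bc A')))%N].
  move=> pk; split; first by rewrite -(perm_uniq pk) iota_uniq.
    by move=> k; rewrite -(perm_mem pk); apply: iota_range.
  by have := perm_size pk; rewrite size_iota !size_cat => ->; rewrite addnK.
have [[s1 [s2 [s3 eP]]]|[s1 [s2 [s3 eP]]]] := split2 _ _ BP BP' nB.
  have [kt [pk uk H]] := key _ _ _ _ _ eP (or_introl (conj erefl erefl)).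
  have [uk' rk' sz] := fin _ _ _ pk.
  apply: tcong_trans H _; rewrite eB eB' in uk *; rewrite -sz ei.
  apply: tcong_trans _ (named_star12 lieP E_unit dualP lam_neq0 two_neq0 uk' rk' uk).
  by apply: tcong_eq => w; apply: named_val_perm.
have [kt [pk uk H]] := key _ _ _ _ _ eP (or_intror (conj erefl erefl)).
have [uk' rk' sz] := fin _ _ _ pk.
apply: tcong_trans H _; rewrite eB eB' in uk *; rewrite addnC -sz ei.
apply: tcong_trans _ (named_star21 lieP E_unit dualP lam_neq0 two_neq0 uk' rk' uk).
by apply: tcong_eq => w; apply: named_val_perm.
Qed.

(** Translates the block sizes of the partition sums into numbers of chords: the excess is the
    number of marked components in the block. *)
Lemma card_block B : B \subset dcomps D ->
  #|B| = (size (bc B) + #|B :&: [set L1; L2]|)%N.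
Proof.
move=> /subsetP sB; rewrite size_block_chords -(cardsID (Jchords i j) B); congr (_ + _)%N.
apply: eq_card => x; rewrite !inE; case xB: (x \in B); rewrite ?andbF //= andbT.
have [e1 e2] : L1 \notin Jchords i j /\ L2 \notin Jchords i j.
  by split; apply: Jown_notin; [left | right].
have := sB x xB; rewrite dcomps_Jdiag !inE -/L1 -/L2.
have [->|_] /= := eqVneq x L1; first by move: e1; rewrite inE => ->.
have [->|_] /= := eqVneq x L2; first by move: e2; rewrite inE => ->.
by move=> ->.
Qed.

Lemma wbar_ladder : (0 < i)%N ->
  tcong br (wbar br form E Ed D)
    (fun w => iter j (@fdiff K) (fun s => bval i s (j - s) w) 0%N).
Proof.
move=> i0; have ei : i = i.-1.+1 by rewrite prednK.
have [_ eL _] := Jown_ladder j ei.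
have eD : dcomps D = L1 |: Jchords i j by rewrite dcomps_Jdiag eL setUA setUid.
have nX : L1 \notin Jchords i j by apply: Jown_notin; left.
apply: (@tcong_trans _ _ _ _ (fun w => \sum_(P | partition P (dcomps D)) mobius K #|P| *
   bval i #|pblock P L1|.-1 (j - #|pblock P L1|.-1) w)); last first.
  apply: tcong_eq => w; rewrite eD.
  rewrite (partition_sum_block (fun s => bval i s (j - s) w) nX).
  by rewrite card_Jchords.
apply: (@tcong_trans _ _ _ _ (fun w => \sum_(P | partition P (dcomps D)) mobius K #|P| *
   wsys br form E Ed (part_diag P) w)); first by apply: tcong_eq => w; apply: wbar_Jdiag.
apply: tcong_sum => P pP; apply: tcongZ.
have cL : L1 \in cover P by rewrite (cover_partition pP) eD setU11.
have BP := pblock_mem cL; have LB : L1 \in pblock P L1 by rewrite mem_pblock.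
have -> : #|pblock P L1|.-1 = size (bc (pblock P L1)).
  rewrite (card_block (partitionS pP BP)) [L2]eL setUid (setIidPr _) ?sub1set //.
  by rewrite cards1 addn1.
by apply: wsys_part_together => //; rewrite /L2 eL.
Qed.

(** The first term collects the partitions with p1p2 and p3p4 in one block, the second those that
    separate them. *)
Lemma wbar_chords : i = 0%N ->
  tcong br (wbar br form E Ed D)
    (fun w => iter j (@fdiff K) (fun s => bval 0 s (j - s) w) 0%N -
      2%:R ^+ j * iter j (@fdiff K) (fun s => sval s (j - s) w) 0%N).
Proof.
move=> ei; have nL : L1 != L2 := Jown_apart j ei.
have eD : dcomps D = L1 |: (L2 |: Jchords i j) := dcomps_Jdiag i j.
have n1 : L1 \notin Jchords i j by apply: Jown_notin; left.
have n2 : L2 \notin Jchords i j by apply: Jown_notin; right.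
apply: (@tcong_trans _ _ _ _ (fun w => \sum_(P | partition P (dcomps D)) mobius K #|P| *
   (if pblock P L1 == pblock P L2 then
      bval 0 (#|pblock P L1| - 2)%N (j - (#|pblock P L1| - 2)) w
    else sval (#|pblock P L1| + #|pblock P L2| - 2)%N
           (j - (#|pblock P L1| + #|pblock P L2| - 2)) w))); last first.
  apply: tcong_eq => w; rewrite eD.
  rewrite (partition_sum_two_blocks (fun s => bval 0 s (j - s) w)
    (fun s => sval s (j - s) w) nL n1 n2).
  by rewrite card_Jchords.
apply: (@tcong_trans _ _ _ _ (fun w => \sum_(P | partition P (dcomps D)) mobius K #|P| *
   wsys br form E Ed (part_diag P) w)); first by apply: tcong_eq => w; apply: wbar_Jdiag.
apply: tcong_sum => P pP; apply: tcongZ.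
have c1 : L1 \in cover P by rewrite (cover_partition pP) eD setU11.
have c2 : L2 \in cover P by rewrite (cover_partition pP) eD !inE eqxx orbT.
have B1P := pblock_mem c1; have B2P := pblock_mem c2.
have h1 : L1 \in pblock P L1 by rewrite mem_pblock.
have h2 : L2 \in pblock P L2 by rewrite mem_pblock.
case: (boolP (pblock P L1 == pblock P L2)) => [/eqP e12|n12].
  have -> : (#|pblock P L1| - 2)%N = size (bc (pblock P L1)).
    rewrite (card_block (partitionS pP B1P)) (setIidPr _) ?cards2 ?nL ?addnK //.
    by apply/subsetP => x; rewrite !inE => /orP[]/eqP->; rewrite // e12.
  by have := wsys_part_together pP B1P h1; rewrite e12 => /(_ h2); rewrite ei.
have -> : (#|pblock P L1| + #|pblock P L2| - 2)%N =
    (size (bc (pblock P L1)) + size (bc (pblock P L2)))%N.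
  have h21 := notin_block pP B2P B1P n12 h2.
  have h12 : L1 \notin pblock P L2 by apply: notin_block pP B1P B2P _ h1; rewrite eq_sym.
  rewrite (card_block (partitionS pP B1P)) (card_block (partitionS pP B2P)).
  have -> : pblock P L1 :&: [set L1; L2] = [set L1].
    apply/setP => x; rewrite !inE; have [->|_] /= := eqVneq x L1; first by rewrite h1.
    by have [->|_] := eqVneq x L2; rewrite ?andbF // (negPf h21).
  have -> : pblock P L2 :&: [set L1; L2] = [set L2].
    apply/setP => x; rewrite !inE; have [->|_] /= := eqVneq x L2; first by rewrite h2 orbT.
    by have [->|_] := eqVneq x L1; rewrite ?andbF // (negPf h12).
  by rewrite !cards1 addnACA addnK.
exact: wsys_part_apart.
Qed.
End OneDiagram.

(** * The recursion after projection *)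

Lemma tcong_iter_fdiff m s0 (A B : nat -> tens K n) :
  (forall s, (s <= s0 + m)%N -> tcong br (A s) (B s)) ->
  tcong br (fun w => iter m (@fdiff K) (fun s => A s w) s0)
           (fun w => iter m (@fdiff K) (fun s => B s w) s0).
Proof.
elim: m s0 => [|m IH] s0 H /=; first by apply: H; rewrite addn0.
have H1 : forall s, (s <= s0.+1 + m)%N -> tcong br (A s) (B s).
  by move=> s hs; apply: H; rewrite addnS -addSn.
have H2 : forall s, (s <= s0 + m)%N -> tcong br (A s) (B s).
  by move=> s hs; apply: H; rewrite addnS leqW.
have := tcongD (IH _ H1) (tcongZ (-1) (IH _ H2)).
by apply: tcong_ext => w; rewrite mulN1r.
Qed.

(** With j - s isolated chords, the first two terms of the recursion solved for the longer ladder
    are the values at s + 1 and s of one function, namely the weight with j + 1 chords in all. Their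
    difference is one more [fdiff]. The bound s <= j keeps the truncated subtractions exact. *)
Lemma ladder_val_fdiff i j :
  tcong br (fun w => iter j (@fdiff K) (fun s => bval i.+1 s (j - s) w) 0%N)
    (fun w => iter j.+1 (@fdiff K) (fun s => bval i s (j.+1 - s) w) 0%N +
              lam^-1 * iter j (@fdiff K) (fun s => bval i s (j - s) w) 0%N).
Proof.
apply: (@tcong_trans _ _ _ _ (fun w => iter j (@fdiff K) (fun s =>
   fdiff (fun s => bval i s (j.+1 - s) w) s + lam^-1 * bval i s (j - s) w) 0%N)); last first.
  by apply: tcong_eq => w; rewrite iter_fdiffD -iterSr.
apply: (@tcong_iter_fdiff j 0 (fun s => bval i.+1 s (j - s)) (fun s w =>
   fdiff (fun s => bval i s (j.+1 - s) w) s + lam^-1 * bval i s (j - s) w)) => s sj.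
rewrite add0n in sj; rewrite /fdiff subSS (subSn sj).
have H := ladder_val_recursion lieP E_unit dualP lam_neq0 two_neq0 i s (j - s).
have := tcongD (tcong_sym H) (tcong_refl br (fun w => lam^-1 * bval i s (j - s) w -
   bval i s (j - s).+1 w)).
apply: tcong_ext => w; rewrite /bval; ring.
Qed.

(** The defining recursion of [star_val] says that trading an isolated chord for a crossing one
    multiplies by the Casimir constant after subtraction. *)
Lemma star_val_fdiff j w :
  iter j.+1 (@fdiff K) (fun s => sval s (j.+1 - s) w) 0%N =
  - (2 * lam)^-1 * iter j (@fdiff K) (fun s => sval s (j - s) w) 0%N.
Proof.
rewrite iterSr -iter_fdiffZ; apply: eq_iter_fdiff => s sj.
by rewrite add0n in sj; rewrite /fdiff subSS (subSn sj) /sval /=; ring.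
Qed.

Lemma wbar_recursion i j :
  tcong br (wbar br form E Ed (Jdiag i.+1 j))
    (fun w => wbar br form E Ed (Jdiag i j.+1) w + lam^-1 * wbar br form E Ed (Jdiag i j) w).
Proof.
apply: tcong_trans (wbar_ladder j (ltn0Sn i)) _.
apply: tcong_trans (ladder_val_fdiff i j) _.
apply: tcong_sym; case: (posnP i) => [->|i0]; last first.
  by apply: tcongD; last apply: tcongZ; apply: wbar_ladder.
apply: tcong_trans (tcongD (wbar_chords j.+1 erefl) (tcongZ lam^-1 (wbar_chords j erefl))) _.
apply: tcong_eq => w; rewrite star_val_fdiff exprS invfM.
set a := iter j.+1 _ _ _; set b := iter j _ _ _; set c := iter j _ _ _.
(* The separated partitions cancel: the extra factor 2 for the additional chord turns [(2 * lam)^-1]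
   into [lam^-1], with sign opposite to the contribution of the diagram with [j] chords. *)
have -> : (2 : K) * 2 ^+ j * (- (2^-1 * lam^-1) * b) = - (2 / 2) * (2 ^+ j * lam^-1 * b) by ring.
by rewrite divff //; ring.
Qed.
End Assembly.

Theorem theorem1 (K : closedFieldType) (charK0 : [pchar K] =i pred0) (n : nat)
    (br : 'rV[K]_n -> 'rV[K]_n -> 'rV[K]_n) (lam : K) (E Ed : 'M[K]_n) (i j : nat) :
  simple_lie br -> lam != 0 ->
  E \in unitmx ->
  (forall a b : 'I_n, lam * killing br (row a E) (row b Ed) = (a == b)%:R) ->
  (1 <= i)%N ->
  let form := fun x y => lam * killing br x y in
  in_uideal br (fun w => wbar br form E Ed (Jdiag i j) w
                         - wbar br form E Ed (Jdiag i.-1 j.+1) w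
                         - lam^-1 * wbar br form E Ed (Jdiag i.-1 j) w).
Proof.
case=> lieP _ _ lam_neq0 E_unit dualP; case: i => // i _ form.
have two_neq0 : (2 : K) != 0 by have /negbT := charK0 2; rewrite inE.
have := wbar_recursion lieP E_unit dualP lam_neq0 two_neq0 i j.
by apply: in_uideal_ext => w; rewrite opprD addrA.
Qed.
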